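(* Let $d=1$ and $n\in\mathbb{N}$. Let the initial data $(\xi_\varepsilon)_{\varepsilon\in(0,1)}$ satisfy Assumptions A1, A2 and A3 (see context). Let $(\bar X_m)_{0\le m\le n}$, $S_{m,i}(t)$, $a_m(t,F)$, $c_{m,i}$, $\bar c_{m,i}$ and $b_m(F)$ be as defined in the context, and let $F\in C^{n+1}(\mathbb{R})$ be such that, for some $q,C>0$, $\max_{0\le i\le n+1}|F^{(i)}(x)|\le C(1+|x|^q)$ for all $x\in\mathbb{R}$. Then for each $m\in\{1,\dots,n\}$ and $i\in\{1,\dots,m\}$ there exists a constant $C(m,i)>0$ such that, for all $t\ge0$, $$\bigl|\mathbb{E}[S_{m,i}(t)\mid\xi_0]-c_{m,i}\bigr|\le C(m,i)e^{-t}\quad\text{almost surely on }\{\xi_0>0\},$$ and $$\bigl|\mathbb{E}[S_{m,i}(t)\mid\xi_0]-\bar c_{m,i}\bigr|\le C(m,i)e^{-t}\quad\text{almost surely on }\{\xi_0<0\}.$$ Moreover, for each $m\in\{0,\dots,n\}$ there exists $C(m,F)>0$ such that, for all $t\ge0$, $$|a_m(t,F)-b_m(F)|\le C(m,F)e^{-t}.$$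
   Context: $\mathbb{N}=\{0,1,2,\dots\}$, $\mathbb{N}_+=\{1,2,\dots\}$. $(W_t)_{t\ge0}$ is a standard one-dimensional Brownian motion and the initial data are independent of $W$: the real random variables $(\xi_\varepsilon)_{\varepsilon\in(0,1)}$ together with $\xi_0,\dots,\xi_n$ below are jointly independent of $W$. The underlying dynamics is $\mathrm{d}X_\varepsilon=(X_\varepsilon-X_\varepsilon^3)\,\mathrm{d}t+\sqrt{2\varepsilon}\,\mathrm{d}W_t$, $X_\varepsilon(0)=\xi_\varepsilon$. For $m\in\mathbb{N}_+$ and $1\le i\le m$, $\mathcal{D}_i^m:=\{(j_1,\dots,j_i)\in(\mathbb{N}_+)^i: j_1+\dots+j_i=m\}$; $\mathcal{D}_i^m=\varnothing$ if $i>m$ or $i\le0$ or $m\le0$; sums over the empty set are $0$. Assumption A1: there exist random variables $\xi_0,\dots,\xi_n$ such that for every $p\ge1$ and $0\le k\le n$, $\mathbb{E}|\xi_k|^{2p}<\infty$ and $\mathbb{E}\bigl|\xi_\varepsilon-\sum_{j=0}^k\varepsilon^{j/2}\xi_j\bigr|^{2p}\le C(k,p)\,\varepsilon^{(k+1)p}$ for all $\varepsilon\in(0,1)$, with $C(k,p)$ independent of $\varepsilon$. Assumption A2: there exist constants $r_{max}>r_{min}>0$ such that $r_{min}<|\xi_0|<r_{max}$ almost surely. Assumption A3: for each $m\in\{1,\dots,n\}$ and $i\in\{1,\dots,m\}$ there exists a constant $C>0$ depending on $m,i$ such that $\bigl|\sum_{(j_1,\dots,j_i)\in\mathcal{D}_i^m}\mathbb{E}[\prod_{k=1}^i\xi_{j_k}\mid\xi_0]\bigr|\le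 C$ almost surely. Expansion coefficients ($d=1$): $\mathrm{d}\bar X_0=(\bar X_0-\bar X_0^3)\,\mathrm{d}t$, $\bar X_0(0)=\xi_0$; $\mathrm{d}\bar X_1=(1-3\bar X_0^2)\bar X_1\,\mathrm{d}t+\sqrt2\,\mathrm{d}W_t$, $\bar X_1(0)=\xi_1$; and for $m\ge2$, $\mathrm{d}\bar X_m=(1-3\bar X_0^2)\bar X_m\,\mathrm{d}t-\sum_{(i,j)\in\mathcal{D}_2^m}3\bar X_0\bar X_i\bar X_j\,\mathrm{d}t-\sum_{(i,j,k)\in\mathcal{D}_3^m}\bar X_i\bar X_j\bar X_k\,\mathrm{d}t$, $\bar X_m(0)=\xi_m$. For $1\le i\le m\le n$, $S_{m,i}(t):=\sum_{(j_1,\dots,j_i)\in\mathcal{D}_i^m}\prod_{k=1}^i\bar X_{j_k}(t)$. Weak expansion coefficients: $a_0(t,F):=\mathbb{E}[F(\bar X_0(t))]$ and, for $1\le m\le n$, $a_m(t,F):=\mathbb{E}\bigl[\sum_{i=1}^m\frac1{i!}F^{(i)}(\bar X_0(t))S_{m,i}(t)\bigr]$. The numbers $c_{m,i},\bar c_{m,i}$ ($1\le i\le m\le n$) are determined by the recursion $$c_{m,i}=\frac{i-1}{2}c_{m-2,i-2}-\frac32c_{m,i+1}-\frac12c_{m,i+2},\qquad \bar c_{m,i}=\frac{i-1}{2}\bar c_{m-2,i-2}+\frac32\bar c_{m,i+1}-\frac12\bar c_{m,i+2},$$ with $c_{1,1}=\bar c_{1,1}=0$, $c_{2,2}=\bar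 c_{2,2}=\frac12$, $c_{0,0}=\bar c_{0,0}=1$, and $c_{k,j}=\bar c_{k,j}=0$ whenever $(k,j)\notin\{(0,0)\}\cup\{(k,j):k\ge1,1\le j\le k\}$ (computed by increasing $m$ and, for fixed $m$, backward in $i$ from $m$ to $1$); they are the limits as $t\to\infty$ of $\mathbb{E}[S_{m,i}(t)\mid\xi_0>0]$ and $\mathbb{E}[S_{m,i}(t)\mid\xi_0<0]$ respectively. Finally $b_m(F):=\lim_{t\to\infty}a_m(t,F)$, given by $b_0(F)=F(1)\mathbb{P}(\xi_0>0)+F(-1)\mathbb{P}(\xi_0<0)$ and, for $1\le m\le n$, $b_m(F)=\mathbb{P}(\xi_0>0)\sum_{i=1}^m\frac{c_{m,i}}{i!}F^{(i)}(1)+\mathbb{P}(\xi_0<0)\sum_{i=1}^m\frac{\bar c_{m,i}}{i!}F^{(i)}(-1)$. *)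

(* Defs.v *)
From HB Require Import structures.
From mathcomp Require Import all_boot all_order all_algebra.
From mathcomp Require Import all_classical all_reals all_analysis.
From mathcomp Require Import zify lra.
Set Implicit Arguments.
Unset Strict Implicit.
Unset Printing Implicit Defensive.
Import Order.TTheory GRing.Theory Num.Theory.
Import numFieldNormedType.Exports.
Local Open Scope classical_set_scope.
Local Open Scope ring_scope.

Section compositions.

(* (j_1, ..., j_i) is a map j on 'I_i; as each j_k is at most m, taking values
   in 'I_m.+1 loses nothing. The set is empty when i = 0, even if m = 0. *)
Definition compositions (m i : nat) : {set {ffun 'I_i -> 'I_m.+1}} :=
  [set j : {ffun 'I_i -> 'I_m.+1} |
    [&& (0 < i)%N, [forall k, (0 < j k)%N] & (\sum_k j k == m)%N]].

Definition comp_sum (R : realType) (x : nat -> R) (m i : nat) : R :=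
  \sum_(j in compositions m i) \prod_(k < i) x (j k).

End compositions.

Section coefficients.
Context {R : realType}.

(* N bounds the recursion depth: 2 m - i decreases at each recursive call.
   The truncated m - 2 and i - 2 are harmless: their term is multiplied by
   i - 1, and 2 <= i <= m otherwise. *)
Fixpoint wcoef_fuel (s : R) (N m i : nat) : R :=
  if N is N'.+1 then
    if (m == 0%N) && (i == 0%N) then 1
    else if (1 <= i <= m)%N then
      (i%:R - 1) / 2 * wcoef_fuel s N' (m - 2) (i - 2)
      + s * (3 / 2) * wcoef_fuel s N' m i.+1
      - 1 / 2 * wcoef_fuel s N' m i.+2
    else 0
  else 0.

Definition wcoef (s : R) (m i : nat) : R := wcoef_fuel s (2 * m).+1 m i.

Definition c_ : nat -> nat -> R := wcoef (-1).
Definition cbar_ : nat -> nat -> R := wcoef 1.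

Lemma wcoef_fuelE s N N' m i : (2 * m - i < N)%N -> (2 * m - i < N')%N ->
  wcoef_fuel s N m i = wcoef_fuel s N' m i.
Proof.
elim: N N' m i => [//|N IH] [//|N'] m i hN hN' /=.
case: ifPn => // _; case: ifPn => // /andP[i1 im].
have [ei|i2] : i = 1%N \/ (2 <= i)%N by case: i i1 {im hN hN'} => [|[|i]] //; [left|right].
  rewrite ei subrr !mul0r; congr (_ + _ - _); congr (_ * _).
    by apply: IH; rewrite ei in im hN hN'; lia.
  by apply: IH; rewrite ei in im hN hN'; lia.
by congr (_ + _ - _); congr (_ * _); apply: IH; lia.
Qed.

Lemma wcoef00 s : wcoef s 0 0 = 1.
Proof. by []. Qed.

Lemma wcoef_out s m i : (m, i) != (0, 0)%N -> ~~ (1 <= i <= m)%N ->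
  wcoef s m i = 0.
Proof. by rewrite /wcoef /= xpair_eqE => /negbTE -> /negbTE ->. Qed.

Lemma wcoef_rec s m i : (1 <= i <= m)%N ->
  wcoef s m i = (i%:R - 1) / 2 * wcoef s (m - 2) (i - 2)
    + s * (3 / 2) * wcoef s m i.+1 - 1 / 2 * wcoef s m i.+2.
Proof.
move=> im; rewrite {1}/wcoef /= im; case: ifPn => [/andP[_ /eqP i0]|_].
  by rewrite i0 in im.
have [ei|i2] : i = 1%N \/ (2 <= i)%N by case: i im => [|[|i]] //; [left|right].
  rewrite ei subrr !mul0r; congr (_ + _ - _); congr (_ * _);
    by apply: wcoef_fuelE; lia.
by congr (_ + _ - _); congr (_ * _); apply: wcoef_fuelE; lia.
Qed.

Lemma c_rec m i : (1 <= i <= m)%N ->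
  c_ m i = (i%:R - 1) / 2 * c_ (m - 2) (i - 2)
    - 3 / 2 * c_ m i.+1 - 1 / 2 * c_ m i.+2.
Proof. by move=> im; rewrite /c_ (wcoef_rec _ im); lra. Qed.

Lemma cbar_rec m i : (1 <= i <= m)%N ->
  cbar_ m i = (i%:R - 1) / 2 * cbar_ (m - 2) (i - 2)
    + 3 / 2 * cbar_ m i.+1 - 1 / 2 * cbar_ m i.+2.
Proof. by move=> im; rewrite /cbar_ (wcoef_rec _ im); lra. Qed.

Lemma wcoef11 s : wcoef s 1 1 = 0.
Proof. by rewrite wcoef_rec// !(@wcoef_out s 1)//; lra. Qed.

Lemma wcoef22 s : wcoef s 2 2 = 1 / 2.
Proof. by rewrite wcoef_rec// !(@wcoef_out s 2)// wcoef00; lra. Qed.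

End coefficients.

Section probability_notions.
Context d (T : measurableType d) (R : realType) (P : probability T R).

Definition sigma_of (X : T -> R) : set_system T :=
  preimage_set_system setT X measurable.

Definition sigma_family (I : Type) (D : set I) (X : I -> T -> R) :
    set_system T :=
  <<s \bigcup_(i in D) sigma_of (X i) >>.

Definition independent_sigma (G H : set_system T) : Prop :=
  forall A B, G A -> H B -> P (A `&` B) = (P A * P B)%E.

(* Z is a version of E[Y | X] *)
Definition is_cond_exp (Y X Z : T -> R) : Prop :=
  [/\ sigma_of Z `<=` sigma_of X,
      P.-integrable setT (EFin \o Z) &
      forall A, sigma_of X A ->
        \int[P]_(w in A) (Z w)%:E = \int[P]_(w in A) (Y w)%:E]%E.

(* A version of E[Y | X], unique up to P-null sets; it exists when Y is
   P-integrable, and is 0 by default when there is none. *)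
Definition cond_exp (Y X : T -> R) : T -> R :=
  xget (cst 0) [set Z | is_cond_exp Y X Z].

(* Standard Brownian motion; only the times t >= 0 matter. *)
Definition brownian_motion (W : R -> {RV P >-> R}) : Prop :=
  [/\ {ae P, forall w, W 0 w = 0},
      forall s t, 0 <= s -> s < t -> forall B : set R, measurable B ->
        P ((fun w => W t w - W s w) @^-1` B) =
        normal_prob 0 (Num.sqrt (t - s)) B,
      forall s t, 0 <= s -> s < t ->
        independent_sigma (sigma_of (fun w => W t w - W s w))
          (sigma_family `[0, s] W) &
      {ae P, forall w, {within `[0, +oo[, continuous (fun t => W t w)}}].

End probability_notions.

Section expansion.
Context d (T : measurableType d) (R : realType) (P : probability T R).
Variable n : nat.
Variables (xie : R -> {RV P >-> R}) (xi : nat -> {RV P >-> R}).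

(* Of xie only the indices eps in (0, 1) matter, of xi only 0, ..., n. *)

Definition init_sigma : set_system T :=
  <<s \bigcup_(e in `]0, 1[) sigma_of (xie e) `|`
      \bigcup_(k in [set k | (k <= n)%N]) sigma_of (xi k) >>.

Definition assumption_A1 : Prop :=
  forall (p : R) (k : nat), 1 <= p -> (k <= n)%N ->
    ('E_P[fun w => (`|xi k w| `^ (2 * p))%R] < +oo)%E /\
    exists C : R, forall e : R, 0 < e < 1 ->
      ('E_P[fun w => (`|xie e w - \sum_(j < k.+1) e `^ (j%:R / 2) * xi j w|
                       `^ (2 * p))%R]
       <= (C * e `^ (k.+1%:R * p))%:E)%E.

Definition assumption_A2 : Prop :=
  exists rmin rmax : R, [/\ 0 < rmin, rmin < rmax &
    {ae P, forall w, rmin < `|xi 0%N w| < rmax}].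

Definition assumption_A3 : Prop :=
  forall m i : nat, (1 <= m <= n)%N -> (1 <= i <= m)%N ->
    exists2 C : R, 0 < C &
      {ae P, forall w,
        `|\sum_(j in compositions m i)
            cond_exp P (fun v => \prod_(k < i) xi (j k) v) (xi 0%N) w| <= C}.

Definition drift (m : nat) (x : nat -> R) : R :=
  match m with
  | 0 => x 0%N - x 0%N ^+ 3
  | 1 => (1 - 3 * x 0%N ^+ 2) * x 1%N
  | _ => (1 - 3 * x 0%N ^+ 2) * x m
         - 3 * x 0%N * comp_sum x m 2 - comp_sum x m 3
  end.

(* The noise is additive, so the equations make sense path by path, in
   integral form. *)
Definition expansion_coefficients (W : R -> {RV P >-> R})
    (X : nat -> R -> {RV P >-> R}) : Prop :=
  forall m, (m <= n)%N -> {ae P, forall w,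
    {within `[0, +oo[, continuous (fun t => X m t w)} /\
    forall t, 0 <= t ->
      X m t w = xi m w
        + \int[lebesgue_measure]_(s in `[0, t]) drift m (fun j => X j s w)
        + (if m == 1%N then Num.sqrt 2 * W t w else 0)}.

Definition S_ (X : nat -> R -> {RV P >-> R}) (m i : nat) (t : R) : T -> R :=
  fun w => comp_sum (fun j => X j t w) m i.

Definition a_ (X : nat -> R -> {RV P >-> R}) (m : nat) (t : R) (F : R -> R) :
    \bar R :=
  (if m == 0%N then 'E_P[fun w => F (X 0%N t w)]
   else 'E_P[fun w => (\sum_(1 <= i < m.+1)
               (i`!%:R)^-1 * derive1n i F (X 0%N t w) * S_ X m i t w)%R])%E.

Definition b_ (m : nat) (F : R -> R) : R :=
  let ppos := fine (P [set w | 0 < xi 0%N w]) in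
  let pneg := fine (P [set w | xi 0%N w < 0]) in
  if m == 0%N then F 1 * ppos + F (-1) * pneg
  else ppos * (\sum_(1 <= i < m.+1) c_ m i / i`!%:R * derive1n i F 1)
     + pneg * (\sum_(1 <= i < m.+1) cbar_ m i / i`!%:R * derive1n i F (-1)).

End expansion.

Definition continuously_differentiable (R : realType) (k : nat) (F : R -> R) :
    Prop :=
  (forall i, (i < k)%N -> forall x, derivable (derive1n i F) x 1) /\
  continuous (derive1n k F).

(* Main.v *)
Require Import Defs.
From HB Require Import structures.
From mathcomp Require Import all_boot all_order all_algebra.
From mathcomp Require Import all_classical all_reals all_analysis.
From mathcomp Require Import measurable_realfun zify ring lra.
Import Order.TTheory GRing.Theory Num.Theory.
Import numFieldNormedType.Exports.
Local Open Scope classical_set_scope.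
Local Open Scope ring_scope.
Set Implicit Arguments.
Unset Strict Implicit.
Unset Printing Implicit Defensive.

(* The zeroth coefficient is the explicit flow of x' = x - x^3 started at xi_0,
   which tends to the sign e of xi_0 at rate exp(-2t). The sums S_{m,i} are the
   coefficients of 'X^m in the i-th power of the generating polynomial
   sum_j X_j 'X^j, so Ito's formula for powers of this polynomial gives a closed
   linear system for them: the drift of S_{m,i} is
     i (1 - 3 x^2) S_{m,i} - 3 i x S_{m,i+1} - i S_{m,i+2} + i (i-1) S_{m-2,i-2}
   with x the flow, and c_{m,i} is its stationary solution at x = e. Tested
   against functions g(xi_0), and multiplied by the i-th power of the integrating
   factor of the linearized equation, S_{m,i} - c_{m,i} satisfies a Gronwall
   estimate whose source terms decay by induction on 2m - i; A3 controls the
   initial value. Duality in g turns this into the bound on conditional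
   expectations, and the choice g = F^(i)(flow) into the bound on a_m.
   Ito's formula is only needed in expectation. It is obtained without stochastic
   integrals, from expansions of the processes over a time step of length r^2
   with remainder r^3 times a variable bounded in all moments; such expansions
   are closed under sums and products. *)

(** * Riemann sums of a derivative *)

(** A3 controls at time 0 the sums over compositions, and not the individual conditional moments, so
    the argument has to stay within the system of the [S_{m,i}]; this is why the drift must close up
    on them. Testing against [g(xi_0)] turns conditional expectations, which are defined up to null
    sets depending on [t], into genuine functions of [t]. All estimates are linear in the [L^1] norm
    of [g(xi_0)], so the weights, the flow and the derivatives of [F] can be absorbed into [g]. The
    rate comes from the exponents. The [i]-th power of the integrating factor grows like
    [exp(2 i t)] and the source like [exp((2 i - 1) t)]; since [2 i - 1 > 0], integration keeps this
    exponent and division leaves [exp(- t)]. Asking for [exp(- 2 t)] would give exponent 0 at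
    [i = 1], whose integral grows like [t]. Moments of the processes are known on bounded horizons
    only, with constants that depend on the horizon. This is harmless: these constants multiply the
    discretization error, and [Tm / r^2] steps with an error of order [r^3] each add up to order
    [Tm r], which tends to 0. *)

Section riemann.
Context {R : realType}.
Implicit Types (k H : R -> R) (a b : R).

(** Increments of primitives will be limits of these finite sums, so that measurability, adaptedness
    and moment bounds of time integrals follow without joint measurability or Fubini's theorem.
    Taking [N.+1] pieces avoids an empty subdivision. *)
Definition riemann_sum k a b (N : nat) : R :=
  \sum_(i < N.+1) (b - a) / N.+1%:R * k (a + i%:R * ((b - a) / N.+1%:R)).

Lemma unif_continuous_segment k a b e : continuous k -> 0 < e ->
  exists2 d, 0 < d & forall x y, a <= x <= b -> `|x - y| < d ->
    `|k x - k y| < e.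
Proof.
move=> ck e0.
have := @segment_compact R a b; rewrite compact_near_coveringP => cpt.
have H : \forall d \near 0^'+, `[a, b] `<=`
    (fun x => forall y, `|x - y| < d -> `|k x - k y| < e).
  apply: (cpt R (0^'+)) => x _.
  have e20 : 0 < e / 2 by rewrite divr_gt0.
  have /cvgrPdist_lt/(_ _ e20)/nbhs_ballP[r /= r0 xr] := ck x.
  exists (ball x (r / 2), [set d | d < r / 2]) => /=.
    split; first by apply: nbhsx_ballx; rewrite divr_gt0.
    by apply: nbhs_right_lt; rewrite divr_gt0.
  move=> [x' d] /= [xx' dr] y x'y.
  have h1 : `|k x - k x'| < e / 2.
    by apply: xr; apply: lt_trans xx' _; rewrite ltr_pdivrMr// ltr_pMr// ltr1n.
  have h2 : `|k x - k y| < e / 2.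
    apply: xr; rewrite /ball /= (splitr r).
    by rewrite (le_lt_trans (ler_distD x' _ _))// ltrD// (lt_trans x'y).
  by rewrite (splitr e) (le_lt_trans (ler_distD (k x) _ _))// ltrD// distrC.
have [d [d0 Hd]] : exists d, 0 < d /\ `[a, b] `<=`
    (fun x => forall y, `|x - y| < d -> `|k x - k y| < e).
  near (0:R)^'+ => d; exists d; split; first by near: d; exact: nbhs_right_gt.
  by near: d.
by exists d => // x y xab; apply: Hd; rewrite /= in_itv.
Unshelve. all: by end_near. Qed.

(** The increment of [H] telescopes over the subdivision, the mean value theorem turns each piece
    into a value of [k] times the mesh, and uniform continuity moves that value to the left
    endpoint. *)
Lemma riemann_sum_cvg k H a b : a < b -> continuous k -> continuous H ->
  (forall x, a < x < b -> is_derive x 1 H (k x)) ->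
  riemann_sum k a b N @[N --> \oo] --> H b - H a.
Proof.
move=> ab ck cH dH; apply/cvgrPdist_le => e e0 /=.
have ba : 0 < b - a by rewrite subr_gt0.
have e0' : 0 < e / (b - a) by rewrite divr_gt0.
have [d d0 unif] := unif_continuous_segment a b ck e0'.
near=> N.
have hd : (b - a) / N.+1%:R < d.
  rewrite ltr_pdivrMr// mulrC -ltr_pdivrMr//.
  have : (b - a) / d < N%:R by near: N; exact: nbhs_infty_gtr.
  by move=> /lt_trans; apply; rewrite ltr_nat.
set h := (b - a) / N.+1%:R.
have h0 : 0 < h by rewrite divr_gt0.
have Nh : N.+1%:R * h = b - a by rewrite /h mulrC divfK// gt_eqF.
pose p i : R := a + i%:R * h.
have pS i : p i.+1 = p i + h by rewrite /p -natr1 mulrDl mul1r addrA.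
have pb : p N.+1 = b by rewrite /p Nh addrC subrK.
have p0 : p 0%N = a by rewrite /p mul0r addr0.
have -> : H b - H a = \sum_(i < N.+1) (H (p i.+1) - H (p i)).
  by rewrite -(big_mkord xpredT (fun i => H (p i.+1) - H (p i))) telescope_sumr// pb p0.
rewrite /riemann_sum -/h -sumrB.
apply: le_trans (ler_norm_sum _ _ _) _.
have -> : e = \sum_(i < N.+1) (e / (b - a) * h).
  rewrite sumr_const card_ord -mulrnAr -(mulr_natl h) Nh mulfVK//.
  by rewrite gt_eqF.
apply: ler_sum => i _; rewrite -/(p i).
have api : a <= p i by rewrite lerDl mulr_ge0// ltW.
have pib : p i.+1 <= b.
  by rewrite -pb /p lerD2l ler_pM2r// ler_nat.
have [c cI ->] : exists2 c, c \in `]p i, p i.+1[ &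
    H (p i.+1) - H (p i) = k c * (p i.+1 - p i).
  apply: MVT; first by rewrite pS ltrDl.
    move=> x; rewrite in_itv/= => /andP[x1 x2]; apply: dH.
    by rewrite (le_lt_trans api)//= (lt_le_trans x2).
  exact: continuous_subspaceT.
rewrite pS [p i + h]addrC addrK -(mulrC h) -mulrBr normrM gtr0_norm// mulrC.
rewrite ler_pM2r// ltW// distrC.
move: cI; rewrite in_itv/= pS => /andP[c1 c2].
have pih : p i <= b by rewrite (le_trans _ pib)// pS lerDl ltW.
apply: unif; first by rewrite api pih.
by rewrite distrC gtr0_norm ?subr_gt0// ltrBlDl (lt_trans c2)// ltrD2l.
Unshelve. all: by end_near. Qed.

Lemma is_derive_near (f g : R -> R) (x df : R) :
  (\forall y \near x, f y = g y) -> is_derive x 1 f df -> is_derive x 1 g df.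
Proof.
by move=> fg dfx; apply: (@near_eq_is_derive _ _ _ f) => //.
Qed.

Lemma continuous_normr_comp (f : R -> R) :
  {within `[0, +oo[, continuous f} -> continuous (fun t : R => f `|t|).
Proof.
move=> /continuous_within_itvcyP[cf cf0] x.
have [->|x0] := eqVneq x 0.
  apply/cvgrPdist_lt => e e0; rewrite normr0.
  move/cvgrPdist_lt : cf0 => /(_ _ e0) [d /= d0 fd].
  exists d => //= y /=; rewrite sub0r normrN => yd.
  have [->|y0] := eqVneq y 0; first by rewrite normr0 subrr normr0.
  by apply: fd; rewrite /= ?sub0r ?normrN ?normr_id ?normr_gt0.
have nx0 : `|x| \in `]0, +oo[ by rewrite in_itv/= normr_gt0 x0.
apply: (@cvg_comp _ _ _ (fun t : R => `|t|) f _ (nbhs (`|x| : R))).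
  exact: norm_continuous.
exact: cf.
Qed.

(** The integrand is replaced by its composition with the absolute value, which is continuous on the
    whole line and unchanged on the domain of integration. The upper end [t + 1] serves to make [t]
    an interior point. *)
Lemma integral_eq_is_derive (X f : R -> R) x0 :
  continuous (fun s : R => f `|s|) ->
  (forall t : R, 0 <= t -> X t = x0 + \int[lebesgue_measure]_(s in `[0, t]) f s) ->
  forall t : R, 0 < t -> is_derive t 1 X (f t).
Proof.
move=> cf XE t t0.
pose g (s : R) := f `|s|.
have cg : continuous g by [].
pose G (x : R) := \int[lebesgue_measure]_(s in `[0, x]) g s.
have [dG G'] : derivable G t 1 /\ derive1 G t = g t.
  apply: (@continuous_FTC1_closed R g 0 t (t + 1)) => //.
  - by rewrite ltrDl.
  - apply: continuous_compact_integrable; first exact: segment_compact.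
    exact: continuous_subspaceT.
  - exact: cg.
have H : is_derive t 1 (fun x : R => x0 + G x) (f t).
  have -> : f t = 0 + g t by rewrite add0r /g gtr0_norm.
  apply: is_deriveD.
  by rewrite -G' derive1E; exact: derivableP.
apply: is_derive_near H.
  near=> y.
  have y0 : 0 < y by near: y; exact: lt_nbhsr.
  rewrite XE ?(ltW y0)//; congr (_ + _); apply: eq_Rintegral => s.
  by rewrite inE/= in_itv/= => /andP[s0 _]; rewrite /g ger0_norm.
Unshelve. all: by end_near. Qed.
End riemann.

(** * The deterministic flow *)

Section flow.
Context {R : realType}.
Implicit Types t z : R.

(* [flow] solves x' = x - x^3, and [weight] is the integrating factor of the
   linearized equation: its logarithmic derivative is 3 x^2 - 1. *)
Definition flow_radicand t z : R := z ^+ 2 + (1 - z ^+ 2) * expR (- (2 * t)).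
Definition flow_den t z : R := Num.sqrt (flow_radicand t z).
Definition flow t z : R := z / flow_den t z.
Definition weight t z : R := expR (2 * t) * flow_den t z ^+ 3.

Lemma expRN2_bounds t : 0 <= t -> 0 < expR (- (2 * t)) <= 1.
Proof.
move=> t0; rewrite expR_gt0/= -[leRHS]expR0 ler_expR oppr_le0.
by rewrite mulr_ge0.
Qed.

(** With [e = exp(- 2 t)] in []0, 1]], the radicand is the convex combination [(1 - e) z^2 + e] of
    [z^2] and 1. *)
Lemma flow_radicand_gt0 t z : 0 <= t -> 0 < flow_radicand t z.
Proof.
move=> /expRN2_bounds; rewrite /flow_radicand; set e := expR _ => /andP[e0 e1].
have := sqr_ge0 z; set w := z ^+ 2 => w0.
by nra.
Qed.

Lemma flow_den_gt0 t z : 0 <= t -> 0 < flow_den t z.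
Proof. by move=> t0; rewrite sqrtr_gt0 flow_radicand_gt0. Qed.

Lemma sqr_flow_den t z : 0 <= t -> flow_den t z ^+ 2 = flow_radicand t z.
Proof. by move=> t0; rewrite sqr_sqrtr// ltW// flow_radicand_gt0. Qed.

Lemma flow0 z : flow 0 z = z.
Proof.
rewrite /flow /flow_den /flow_radicand mulr0 oppr0 expR0 mulr1 addrC subrK.
by rewrite sqrtr1 divr1.
Qed.

Lemma weight0 z : weight 0 z = 1.
Proof.
rewrite /weight /flow_den /flow_radicand mulr0 oppr0 expR0 mulr1 addrC subrK.
by rewrite sqrtr1 expr1n mulr1.
Qed.

Lemma weight_gt0 t z : 0 <= t -> 0 < weight t z.
Proof. by move=> t0; rewrite mulr_gt0 ?expR_gt0// exprn_gt0// flow_den_gt0. Qed.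

Lemma is_derive_flow_radicand t z : is_derive t 1 (fun s => flow_radicand s z)
    ((1 - z ^+ 2) * (- 2 * expR (- (2 * t)))).
Proof.
have -> : (fun s => flow_radicand s z) =
    cst (z ^+ 2) + (fun s => (1 - z ^+ 2) *: expR (- (2 *: s))) by [].
apply: is_derive_eq.
by rewrite add0r /GRing.scale/= mulr1; ring.
Qed.

Lemma is_derive_flow_den t z : 0 <= t ->
  is_derive t 1 (flow_den ^~ z) (flow_den t z * (flow t z ^+ 2 - 1)).
Proof.
move=> t0; have q0 := flow_radicand_gt0 z t0; have d0 := flow_den_gt0 z t0.
have := @is_derive1_comp _ Num.sqrt (flow_radicand ^~ z) t _ _ (is_derive1_sqrt q0) (is_derive_flow_radicand t z).
rewrite -/(flow_den t z) => /is_derive_eq; apply.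
have qE := sqr_flow_den z t0.
have dn0 : flow_den t z != 0 by rewrite gt_eqF.
rewrite /flow exprMn exprVn.
(* The radicand [q] solves the linear equation [q' = - 2 (q - z^2)]. *)
have -> : (1 - z ^+ 2) * (- 2 * expR (- (2 * t))) =
   - 2 * (flow_den t z ^+ 2 - z ^+ 2) by rewrite qE /flow_radicand; ring.
by field.
Qed.

Lemma is_derive_flow t z : 0 <= t ->
  is_derive t 1 (flow ^~ z) (flow t z - flow t z ^+ 3).
Proof.
move=> t0; have d0 := flow_den_gt0 z t0.
have dn0 : flow_den t z != 0 by rewrite gt_eqF.
have dd := is_derive_flow_den z t0.
have -> : (flow ^~ z) = (z *: (fun s => (flow_den s z)^-1)) by [].
have := is_deriveZ z (@is_deriveV _ (flow_den ^~ z) t _ 1 dn0 dd).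
move=> /is_derive_eq; apply.
by rewrite /GRing.scale/= /flow; field.
Qed.

Lemma is_derive_weight t z : 0 <= t ->
  is_derive t 1 (weight ^~ z) ((3 * flow t z ^+ 2 - 1) * weight t z).
Proof.
move=> t0; have dd := is_derive_flow_den z t0.
have -> : (weight ^~ z) = (fun s => expR (2 *: s)) * (flow_den ^~ z) ^+ 3 by [].
apply: is_derive_eq.
rewrite !fctE /GRing.scale/= /weight.
ring.
Qed.

Lemma continuous_of_is_derive (f : R -> R) (x df : R) :
  is_derive x 1 f df -> {for x, continuous f}.
Proof. by move=> h; apply: differentiable_continuous; apply/derivable1_diffP; case: h. Qed.

Lemma continuous_weight_normr z : continuous (fun s : R => weight `|s| z).
Proof.
move=> s; apply: (@cvg_comp _ _ _ (fun t : R => `|t|) (weight ^~ z) _ (nbhs (`|s| : R))).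
  exact: norm_continuous.
exact: (continuous_of_is_derive (is_derive_weight z (normr_ge0 s))).
Qed.

(** The drift [x - x^3] is one-sided Lipschitz with constant 1: the cubic part only brings solutions
    closer, because [X^2 + X x + x^2 >= 0]. Hence the squared distance to the flow, multiplied by
    [exp(- 2 t)], does not increase, and it starts at 0. *)
Lemma flow_unique (X : R -> R) : continuous X ->
  (forall t : R, 0 < t -> is_derive t 1 X (X t - X t ^+ 3)) ->
  forall t : R, 0 <= t -> X t = flow t (X 0).
Proof.
move=> cX dX t; rewrite le_eqVlt => /predU1P[<-|t0]; first by rewrite flow0.
set z := X 0.
pose E (s : R) := (X s - flow s z) ^+ 2 * expR (- (2 * s)).
pose dE (s : R) := - 2 * (X s - flow s z) ^+ 2 * expR (- (2 * s)) *
   (X s ^+ 2 + X s * flow s z + flow s z ^+ 2).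
have dEP (s : R) : 0 < s -> is_derive s 1 E (dE s).
  move=> s0; have dXs := dX _ s0; have dF := is_derive_flow z (ltW s0).
  have -> : E = (X - (flow ^~ z)) ^+ 2 * (fun s => expR (- (2 *: s))) by [].
  apply: is_derive_eq.
  rewrite !fctE /GRing.scale/= /dE.
ring.
have cE : {within `[0, t], continuous E}.
  apply: continuous_in_subspaceT => s; rewrite inE/= in_itv/= => /andP[s0 _].
  apply: (@continuousM _ _ (fun s : R => (X s - flow s z) ^+ 2)
    (fun s : R => expR (- (2 * s)))).
    apply: (@continuous_comp _ _ _ (fun s : R => X s - flow s z) (fun x => x ^+ 2)).
      apply: continuousB; first exact: cX.
      exact: continuous_of_is_derive (is_derive_flow z s0).
    exact: exprn_continuous.
  apply: (@continuous_comp _ _ _ (fun s : R => - (2 * s)) expR).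
    by apply: cvgN; apply: cvgM; [exact: cvg_cst|exact: cvg_id].
  exact: continuous_expR.
have [c] := @MVT R E dE 0 t t0 (fun s sI => dEP s ltac:(by move: sI; rewrite in_itv/= => /andP[])) cE.
rewrite in_itv/= subr0 => /andP[c0 _].
have E0 : E 0 = 0 by rewrite /E flow0 subrr expr0n mul0r.
rewrite E0 subr0 => Et.
have : E t <= 0.
  rewrite Et /dE !mulNr oppr_le0.
  apply: mulr_ge0 (ltW t0); apply: mulr_ge0; last by nra.
  by rewrite mulr_ge0 ?expR_ge0// mulr_ge0 ?sqr_ge0.
rewrite /E pmulr_lle0 ?expR_gt0// => h.
apply/eqP; rewrite -subr_eq0 -sqrf_eq0 eq_le h; exact: sqr_ge0.
Qed.
End flow.

(** * Uniform bounds on the flow when the initial point has modulus between [r] and [K] *)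

Section flow_bounds.
Context {R : realType}.
Variables (r K : R) (r0 : 0 < r) (r1 : r <= 1) (K1 : 1 <= K).
Implicit Types t z : R.

Lemma sqr_initial_bounds z : r <= `|z| <= K -> r ^+ 2 <= z ^+ 2 <= K ^+ 2.
Proof.
move=> /andP[rz zK]; rewrite -(real_normK (num_real z)).
by rewrite !lerXn2r ?nnegrE ?(ltW r0)// (le_trans ler01).
Qed.

(** The radicand lies between [z^2] and 1. This is the reason for the convention [r <= 1 <= K]: the
    interval must contain the limit point 1 as well as the initial modulus. *)
Lemma flow_radicand_bounds t z : 0 <= t -> r <= `|z| <= K ->
  r ^+ 2 <= flow_radicand t z <= K ^+ 2.
Proof.
move=> /expRN2_bounds + /sqr_initial_bounds.
rewrite /flow_radicand; set e := expR _ => /andP[e0 e1] /andP[].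
set w := z ^+ 2 => rw wK.
have r21 : r ^+ 2 <= 1 by rewrite exprn_ile1// ltW.
have K21 : 1 <= K ^+ 2 by rewrite exprn_ege1.
apply/andP; split; nra.
Qed.

Lemma flow_den_bounds t z : 0 <= t -> r <= `|z| <= K ->
  r <= flow_den t z <= K.
Proof.
move=> t0 zrK; have := flow_radicand_bounds t0 zrK.
rewrite -(sqr_flow_den _ t0) => /andP[h1 h2].
have d0 := flow_den_gt0 z t0.
have K0 : 0 <= K by rewrite (le_trans ler01).
by rewrite -(@ler_pXn2r _ 2 isT) ?nnegrE ?(ltW r0) ?(ltW d0)// h1/=
  -(@ler_pXn2r _ 2 isT) ?nnegrE// ltW.
Qed.

Lemma sqr_flowE t z : 0 <= t -> flow t z ^+ 2 = z ^+ 2 / flow_radicand t z.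
Proof. by move=> t0; rewrite /flow exprMn exprVn sqr_flow_den. Qed.

(** The difference equals [(z^2 - 1) exp(- 2 t)] divided by the radicand; [K^2] bounds [|z^2 - 1|]
    because [K >= 1], and [r^2] bounds the radicand from below. *)
Lemma sqr_flow_sub1 t z : 0 <= t -> r <= `|z| <= K ->
  `|flow t z ^+ 2 - 1| <= K ^+ 2 / r ^+ 2 * expR (- (2 * t)).
Proof.
move=> t0 zrK; have := flow_radicand_bounds t0 zrK => /andP[h1 h2].
have q0 := flow_radicand_gt0 z t0.
rewrite sqr_flowE//.
have -> : z ^+ 2 / flow_radicand t z - 1 =
   (z ^+ 2 - 1) * expR (- (2 * t)) / flow_radicand t z.
  have qn0 : flow_radicand t z != 0 by rewrite gt_eqF.
  by move: qn0; rewrite {2 3}/flow_radicand => qn0; rewrite -[X in _ - X = _](divff qn0) -mulrBl /flow_radicand; congr (_ / _); ring.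
have /andP[e0 _] := expRN2_bounds t0.
have /andP[z1 z2] := sqr_initial_bounds zrK.
rewrite !normrM normfV (gtr0_norm q0) (gtr0_norm e0) mulrAC.
rewrite ler_pM2r// ler_pM ?invr_ge0 ?(ltW q0)//.
  have K21 : 1 <= K ^+ 2 by rewrite exprn_ege1.
  have := sqr_ge0 r; have := sqr_ge0 z.
  by rewrite ler_norml; move=> *; apply/andP; split; lra.
by rewrite lef_pV2 ?posrE ?exprn_gt0.
Qed.

Lemma flow_le t z : 0 <= t -> r <= `|z| <= K -> `|flow t z| <= K.
Proof.
move=> t0 zrK.
have K0 : 0 <= K by rewrite (le_trans ler01).
rewrite -(@ler_pXn2r _ 2 isT) ?nnegrE// real_normK ?num_real// sqr_flowE//.
rewrite ler_pdivrMr ?flow_radicand_gt0// /flow_radicand.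
have /andP[e0 e1] := expRN2_bounds t0.
have K21 : 1 <= K ^+ 2 by rewrite exprn_ege1.
have /andP[_ zK2] := sqr_initial_bounds zrK.
have := sqr_ge0 z; move: e0 e1 zK2 K21.
set e := expR _; set w := z ^+ 2; set k := K ^+ 2 => e0 e1 wk k1 w0.
clearbody e w k.
(* The left sides of [h1] and [h2] add up to [k] times the radicand minus [w]. *)
have h1 : 0 <= (k - 1) * w * (1 - e) by rewrite mulr_ge0 ?mulr_ge0 ?subr_ge0.
have h2 : 0 <= (k - w) * e by rewrite mulr_ge0 ?subr_ge0 ?(ltW e0).
lra.
Qed.

(** The flow keeps the sign of [z], so [|x + s| >= 1] and the factorization
    [x^2 - s^2 = (x - s) (x + s)] transfers the estimate on squares. *)
Lemma flow_sub_sign t z s : s ^+ 2 = 1 -> 0 < s * z -> 0 <= t ->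
  r <= `|z| <= K -> `|flow t z - s| <= K ^+ 2 / r ^+ 2 * expR (- (2 * t)).
Proof.
move=> s1 sz t0 zrK; apply: le_trans (sqr_flow_sub1 t0 zrK).
have sx : 0 < s * flow t z.
  by rewrite /flow mulrA divr_gt0// flow_den_gt0.
rewrite -s1 subr_sqr normrM ler_peMr//.
have -> : `|flow t z + s| = `|s * (flow t z + s)|.
  have ns : `|s| = 1.
    apply/eqP; rewrite -(@eqrXn2 _ 2) ?ler01// expr1n real_normK ?num_real//.
    by rewrite s1.
  by rewrite normrM ns mul1r.
by rewrite mulrDr -expr2 s1 gtr0_norm ?lerDr ?(ltW sx)// addr_gt0.
Qed.

Lemma weight_bounds t z : 0 <= t -> r <= `|z| <= K ->
  expR (2 * t) * r ^+ 3 <= weight t z <= expR (2 * t) * K ^+ 3.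
Proof.
move=> t0 zrK; have /andP[h1 h2] := flow_den_bounds t0 zrK.
rewrite /weight !ler_pM2l ?expR_gt0// !lerXn2r ?nnegrE ?(ltW r0)//.
- by rewrite ltW// flow_den_gt0.
- by rewrite (le_trans ler01).
- by rewrite ltW// flow_den_gt0.
Qed.

End flow_bounds.

Section flow_measurable.
Context {R : realType}.
Implicit Types t z : R.

Lemma continuous_flow_den t : continuous (flow_den t).
Proof.
move=> z; apply: (@continuous_comp _ _ _ (flow_radicand t)); last exact: sqrt_continuous.
apply: cvgD; first exact: exprn_continuous.
apply: cvgM; last exact: cvg_cst.
by apply: cvgB; [exact: cvg_cst|exact: exprn_continuous].
Qed.

Lemma measurable_flow t : 0 <= t -> measurable_fun setT (flow t).
Proof.
move=> t0; apply: continuous_measurable_fun => z.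
apply: cvgM; first exact: cvg_id.
by apply: cvgV; [rewrite gt_eqF// flow_den_gt0|exact: continuous_flow_den].
Qed.

Lemma measurable_weight t : measurable_fun setT (weight t).
Proof.
apply: continuous_measurable_fun => z.
apply: cvgM; first exact: cvg_cst.
apply: (@continuous_comp _ _ _ (flow_den t) (fun x => x ^+ 3)).
  exact: continuous_flow_den.
exact: exprn_continuous.
Qed.
End flow_measurable.

(** * Sums over compositions as coefficients of powers *)

Section comp_sum_poly.
Context {R : realType}.
Implicit Types (x : nat -> R) (p q : {poly R}).

(* The constant coefficient is dropped: compositions have positive parts. *)
Definition series_poly (n : nat) x : {poly R} :=
  \poly_(j < n.+1) (if j == 0%N then 0 else x j).

Lemma coef_series_poly n x m : (m <= n)%N ->
  (series_poly n x)`_m = if m == 0%N then 0 else x m.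
Proof. by move=> mn; rewrite coef_poly ltnS mn. Qed.

Lemma coef_exp_eq p q n i : (forall k, (k <= n)%N -> p`_k = q`_k) ->
  forall k, (k <= n)%N -> (p ^+ i)`_k = (q ^+ i)`_k.
Proof.
move=> pq; elim: i => [|i IH] k kn; first by rewrite !expr0.
rewrite !exprS !coefM; apply: eq_bigr => j _.
by rewrite pq ?IH// (leq_trans _ kn)// ?leq_subr// -ltnS.
Qed.

Lemma coef_exp_lt p i m : p`_0 = 0 -> (m < i)%N -> (p ^+ i)`_m = 0.
Proof.
move=> p0; elim: i m => [//|i IH] m mi.
rewrite exprS coefM big_ord_recl p0 mul0r add0r big1// => j _.
by rewrite IH ?mulr0// lift0; have := ltn_ord j; lia.
Qed.

(** Distributivity expands the power into a sum over maps from the [i] factors to exponents. The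
    coefficient of degree [m] selects the maps of sum [m], and the missing constant term kills those
    with a zero part. *)
Lemma comp_sumE x n m i : (m <= n)%N -> (0 < i)%N ->
  comp_sum x m i = (series_poly n x ^+ i)`_m.
Proof.
move=> mn i0.
(* Truncating at degree [m] instead of [n] makes the expansion range over the very type in which
   [compositions m i] lives. *)
rewrite (@coef_exp_eq _ (series_poly m x) m) => [|k km|//]; last first.
  by rewrite !coef_series_poly// (leq_trans km).
rewrite /series_poly poly_def -[in RHS](card_ord i) -prodr_const bigA_distr_bigA/=.
rewrite coef_sum /comp_sum.
rewrite [LHS]big_mkcond/= [RHS](eq_bigr (fun f : {ffun 'I_i -> 'I_m.+1} =>
  if f \in compositions m i then \prod_(k < i) x (f k) else 0))// => f _.
rewrite inE i0/=.
set y := fun j : nat => if j == 0%N then 0 else x j.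
rewrite -/y.
have -> : \prod_(k < i) (y (f k) *: 'X^(f k)) =
   (\prod_(k < i) y (f k)) *: 'X^(\sum_(k < i) f k)%N :> {poly R}.
  elim/big_rec3 : _ => [|k a b c _ ->]; first by rewrite scale1r.
  by rewrite exprD -scalerAl -scalerAr scalerA.
rewrite coefZ coefXn eq_sym.
case: forallP => [f0|nf0]/=; last first.
  have [k fk] : exists k, f k == 0%N :> nat.
    apply: contra_notP nf0 => nk k; rewrite lt0n; apply/negP => fk.
    by apply: nk; exists k.
  by rewrite (bigD1 k)//= /y fk mul0r mul0r.
case: eqP => _; last by rewrite mulr0.
rewrite mulr1; apply: eq_bigr => k _.
by rewrite /y eqn0Ngt f0.
Qed.

(** The case distinction in [drift] disappears: at [m = 1] the quadratic and cubic coefficients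
    vanish, since the polynomial has no constant term. *)
Lemma drift_polyE x n m : (1 <= m <= n)%N ->
  drift m x = (1 - 3 * x 0%N ^+ 2) * (series_poly n x)`_m
    - 3 * x 0%N * (series_poly n x ^+ 2)`_m - (series_poly n x ^+ 3)`_m.
Proof.
move=> /andP[m1 mn]; rewrite coef_series_poly//.
have p0 : (series_poly n x)`_0 = 0 by rewrite coef_series_poly.
case: m m1 mn => [//|[|m]] _ mn /=.
  by rewrite !coef_exp_lt// mulr0 !subr0.
by rewrite -!comp_sumE.
Qed.

(** The other parts are positive and there is at least one of them. This makes the equations of the
    expansion triangular: the nonlinear terms at level [m] involve lower levels only. *)
Lemma compositions_lt m i (f : {ffun 'I_i -> 'I_m.+1}) k : (2 <= i)%N ->
  f \in compositions m i -> (0 < f k < m)%N.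
Proof.
move=> i2; rewrite inE => /and3P[_ /forallP f0 /eqP fm].
rewrite f0/= -[X in (_ < X)%N]fm (bigD1 k)//= -[X in (X < _)%N]addn0 ltn_add2l.
have [j jk] : exists j : 'I_i, j != k.
  have [k0|k0] := eqVneq (k : nat) 0%N.
    by exists (Ordinal i2); rewrite -val_eqE/= k0.
  by exists (Ordinal (ltnW i2)); rewrite -val_eqE/= eq_sym.
by rewrite (bigD1 j)//= ltn_addr.
Qed.
End comp_sum_poly.

(** * Properties closed under ring operations *)

Section ring_closed.
Context {R : realType} {A B : Type}.
Variable Q : (A -> B -> R) -> Prop.
Hypothesis Qcst : forall c : R, Q (fun _ _ => c).
Hypothesis QD : forall f g, Q f -> Q g -> Q (fun a b => f a b + g a b).
Hypothesis QM : forall f g, Q f -> Q g -> Q (fun a b => f a b * g a b).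

Let Q_eq f g : Q f -> (forall a b, g a b = f a b) -> Q g.
Proof. by move=> Qf gf; have -> : g = f by apply/funext => a; apply/funext. Qed.

(** [Q] will stand for continuity of paths, for boundedness in all moments and for the class [good];
    polynomial expressions in the expansion coefficients then inherit each of them by one common
    argument. *)
Lemma ring_closed_sum (I : Type) (s : seq I) (p : pred I) (F : I -> A -> B -> R) :
  (forall i, p i -> Q (F i)) -> Q (fun a b => \sum_(i <- s | p i) F i a b).
Proof.
move=> QF; elim: s => [|i s IH].
  by apply: Q_eq (Qcst 0) _ => a b; rewrite big_nil.
have [pi|npi] := boolP (p i).
  by apply: Q_eq (QD (QF _ pi) IH) _ => a b; rewrite big_cons pi.
by apply: Q_eq IH _ => a b; rewrite big_cons (negbTE npi).
Qed.

Lemma ring_closed_prod (I : Type) (s : seq I) (p : pred I) (F : I -> A -> B -> R) :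
  (forall i, p i -> Q (F i)) -> Q (fun a b => \prod_(i <- s | p i) F i a b).
Proof.
move=> QF; elim: s => [|i s IH].
  by apply: Q_eq (Qcst 1) _ => a b; rewrite big_nil.
have [pi|npi] := boolP (p i).
  by apply: Q_eq (QM (QF _ pi) IH) _ => a b; rewrite big_cons pi.
by apply: Q_eq IH _ => a b; rewrite big_cons (negbTE npi).
Qed.

Lemma ring_closed_exp f i : Q f -> Q (fun a b => f a b ^+ i).
Proof.
move=> Qf; elim: i => [|i IH]; first exact: Q_eq (Qcst 1) _.
by apply: Q_eq (QM Qf IH) _ => a b; rewrite exprS.
Qed.

Lemma ring_closed_comp_sum (x : nat -> A -> B -> R) m i : (2 <= i)%N ->
  (forall j, (0 < j < m)%N -> Q (x j)) ->
  Q (fun a b => comp_sum (fun j => x j a b) m i).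
Proof.
move=> i2 Qx; apply: ring_closed_sum => f fC; apply: ring_closed_prod => k _.
exact/Qx/compositions_lt.
Qed.

End ring_closed.

(** * Families bounded in all moments *)

(** Jensen's inequality for the power [p] and a uniform average. It carries moment bounds from the
    terms of a Riemann sum to the sum without loss. *)
Lemma mean_exp_le (R : realFieldType) (M : nat) (x : 'I_M.+1 -> R) (p : nat) :
  (forall i, 0 <= x i) ->
  ((\sum_i x i) / M.+1%:R) ^+ p <= (\sum_i x i ^+ p) / M.+1%:R.
Proof.
move=> x0; have M0 : 0 < M.+1%:R :> R by rewrite ltr0n.
elim: p => [|p IH].
  rewrite expr0 (eq_bigr (fun=> 1))=> [|i _]; last by rewrite expr0.
  by rewrite sumr_const card_ord divff// gt_eqF.
rewrite exprS; apply: le_trans (_ : (\sum_i x i) / M.+1%:R * ((\sum_i x i ^+ p) / M.+1%:R) <= _).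
  by rewrite ler_wpM2l// divr_ge0 ?sumr_ge0// ler0n.
rewrite mulrACA mulrA ler_pM2r ?invr_gt0// ler_pdivrMr//.
(* Chebyshev's sum inequality, by symmetrization of the double sum *)
set S := _ * _.
have E1 : S = \sum_i \sum_j x i * x j ^+ p.
  by rewrite /S mulr_suml; apply: eq_bigr => i _; rewrite mulr_sumr.
have E2 : S = \sum_i \sum_j x j * x i ^+ p by rewrite E1 exchange_big.
suff : S + S <= (\sum_i x i ^+ p.+1) * M.+1%:R *+ 2 by rewrite -mulr2n lerMn2r.
rewrite {1}E1 E2 -big_split/=; under eq_bigr do rewrite -big_split/=.
apply: (@le_trans _ _ (\sum_(i < M.+1) \sum_(j < M.+1) (x i ^+ p.+1 + x j ^+ p.+1))).
  apply: ler_sum => i _; apply: ler_sum => j _.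
  rewrite -subr_ge0 !exprS.
  have -> : x i * x i ^+ p + x j * x j ^+ p - (x i * x j ^+ p + x j * x i ^+ p) =
    (x i - x j) * (x i ^+ p - x j ^+ p) by ring.
  have [ij|/ltW ij] := leP (x i) (x j).
    by rewrite mulr_le0// subr_le0// lerXn2r// nnegrE.
  by rewrite mulr_ge0// subr_ge0// lerXn2r// nnegrE.
have -> : \sum_(i < M.+1) \sum_(j < M.+1) (x i ^+ p.+1 + x j ^+ p.+1) =
    \sum_(i < M.+1) (x i ^+ p.+1 *+ M.+1 + \sum_(j < M.+1) x j ^+ p.+1).
  by apply: eq_bigr => i _; rewrite big_split/= sumr_const card_ord.
rewrite big_split/= sumr_const card_ord.
by rewrite mulr2n mulr_natr sumrMnl.
Qed.

Section moments.
Context d (T : measurableType d) (R : realType) (P : probability T R).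

(** The index set will consist of times, of time steps, or of a single point; what matters is that
    each moment is bounded uniformly over it. The integrals are extended-real, so that finiteness is
    part of the claim. *)
Definition moment_bounded (I : Type) (D : set I) (Y : I -> T -> R) : Prop :=
  (forall i, D i -> measurable_fun setT (Y i)) /\
  forall p : nat, exists C : R, forall i, D i ->
    (\int[P]_w (`|Y i w| ^+ p)%:E <= C%:E)%E.

Lemma measurable_normX (Y : T -> R) p : measurable_fun setT Y ->
  measurable_fun setT (fun w => (`|Y w| ^+ p)%:E).
Proof.
move=> mY; apply/measurable_EFinP; apply: measurable_funX.
by apply: measurableT_comp mY; exact: normr_measurable.
Qed.

Section closure.
Context {I : Type} (D : set I).
Implicit Types Y Z : I -> T -> R.

Lemma moment_bounded_le Y Z : moment_bounded D Z ->
  (forall i, D i -> measurable_fun setT (Y i)) ->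
  (forall i, D i -> {ae P, forall w, `|Y i w| <= `|Z i w|}) ->
  moment_bounded D Y.
Proof.
move=> [mZ ZC] mY YZ; split=> // p; have [C hC] := ZC p; exists C => i Di.
apply: le_trans (hC i Di); apply: ae_ge0_le_integral => //.
- exact: measurable_normX (mY _ Di).
- exact: measurable_normX (mZ _ Di).
- by apply: filterS (YZ i Di) => w h _; rewrite lee_fin lerXn2r ?nnegrE.
Qed.

Lemma moment_bounded_ae_le_cst Y (K : R) :
  (forall i, D i -> measurable_fun setT (Y i)) ->
  (forall i, D i -> {ae P, forall w, `|Y i w| <= K}) ->
  moment_bounded D Y.
Proof.
move=> mY YK; apply: (@moment_bounded_le _ (fun _ _ => K)) => //.
  split=> // p; exists (`|K| ^+ p) => i _.
  rewrite integral_cst// [X in (_ * X)%E](_ : _ = 1%E) ?mule1//.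
  exact: probability_setT.
by move=> i /YK; apply: filterS => w /le_trans; apply; exact: ler_norm.
Qed.

Lemma moment_boundedD Y Z : moment_bounded D Y -> moment_bounded D Z ->
  moment_bounded D (fun i w => Y i w + Z i w).
Proof.
move=> [mY hY] [mZ hZ]; split=> [i Di|p].
  by apply: measurable_funD; [exact: mY|exact: mZ].
have [A hA] := hY p; have [B hB] := hZ p.
exists (2 ^+ p * (A + B)) => i Di.
apply: (@le_trans _ _ (\int[P]_w ((2 ^+ p)%:E *
    ((`|Y i w| ^+ p)%:E + (`|Z i w| ^+ p)%:E)))%E).
  apply: ge0_le_integral => //.
  - by apply: measurable_normX; apply: measurable_funD; [exact: mY|exact: mZ].
  - by apply: measurable_funeM; apply: emeasurable_funD; apply: measurable_normX; auto.
  - move=> w _; rewrite -EFinD -EFinM lee_fin.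
    apply: (@le_trans _ _ ((2 * Num.max `|Y i w| `|Z i w|) ^+ p)).
      rewrite lerXn2r ?nnegrE// ?mulr_ge0// ?le_max ?normr_ge0//.
      rewrite (le_trans (ler_normD _ _))// mulr_natl mulr2n lerD//.
        by rewrite le_max lexx.
      by rewrite le_max lexx orbT.
    rewrite exprMn ler_pM2l ?exprn_gt0//.
    by case: (leP `|Y i w|) => _; [rewrite lerDr|rewrite lerDl]; rewrite exprn_ge0.
rewrite ge0_integralZl//; last 2 first.
- by apply: emeasurable_funD; apply: measurable_normX; auto.
- by move=> w _; rewrite adde_ge0// lee_fin exprn_ge0.
rewrite ge0_integralD//; last 2 first.
- by apply: measurable_normX; auto.
- by apply: measurable_normX; auto.
by rewrite EFinM lee_pmul2l ?lte_fin ?exprn_gt0// EFinD leeD ?hA ?hB.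
Qed.

(** The inequality [a b <= a^2 + b^2] takes the place of Hoelder's, at the price of doubling the
    exponent; this is why all moments are handled together. *)
Lemma moment_boundedM Y Z : moment_bounded D Y -> moment_bounded D Z ->
  moment_bounded D (fun i w => Y i w * Z i w).
Proof.
move=> [mY hY] [mZ hZ]; split=> [i Di|p].
  by apply: measurable_funM; [exact: mY|exact: mZ].
have [A hA] := hY (p * 2)%N; have [B hB] := hZ (p * 2)%N.
exists (A + B) => i Di.
apply: (@le_trans _ _ (\int[P]_w
    ((`|Y i w| ^+ (p * 2))%:E + (`|Z i w| ^+ (p * 2))%:E))%E).
  apply: ge0_le_integral => //.
  - by apply: measurable_normX; apply: measurable_funM; [exact: mY|exact: mZ].
  - by apply: emeasurable_funD; apply: measurable_normX; auto.
  - move=> w _; rewrite -EFinD lee_fin normrM exprMn !exprM.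
    set a := _ ^+ p; set b := _ ^+ p; have := sqr_ge0 (a - b).
    have : 0 <= a by rewrite exprn_ge0.
    have : 0 <= b by rewrite exprn_ge0.
    nra.
rewrite ge0_integralD//; last 2 first.
- by apply: measurable_normX; auto.
- by apply: measurable_normX; auto.
by rewrite EFinD leeD ?hA ?hB.
Qed.

Lemma moment_bounded_reindex (J : Type) (D' : set J) (phi : J -> I) Y :
  (forall j, D' j -> D (phi j)) -> moment_bounded D Y ->
  moment_bounded D' (fun j => Y (phi j)).
Proof.
move=> DD [mY hY]; split=> [j /DD|p]; first exact: mY.
by have [C hC] := hY p; exists C => j /DD; exact: hC.
Qed.

Lemma moment_bounded_cst (c : I -> R) (K : R) : (forall i, D i -> `|c i| <= K) ->
  moment_bounded D (fun i _ => c i).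
Proof.
by move=> cK; apply: (@moment_bounded_ae_le_cst _ K) => // i /cK ?; apply: aeW.
Qed.

Lemma moment_bounded_integrable Y i : moment_bounded D Y -> D i ->
  P.-integrable setT (EFin \o Y i).
Proof.
move=> [mY /(_ 1%N)[C hC]] Di; apply/integrableP; split.
  exact/measurable_EFinP/mY.
by apply: le_lt_trans (hC i Di) (ltry _).
Qed.

Lemma moment_bounded_Rintegral Y : moment_bounded D Y ->
  exists2 C : R, 0 < C & forall i, D i -> `|\int[P]_w Y i w| <= C.
Proof.
move=> mbY; have [mY /(_ 1%N)[C hC]] := mbY; exists (`|C| + 1).
  by rewrite ltr_wpDl.
move=> i Di; have iY := moment_bounded_integrable mbY Di.
apply: le_trans (le_normr_Rintegral _ iY) _ => //.
rewrite (@le_trans _ _ `|C|)// ?lerDl//.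
rewrite (le_trans _ (ler_norm C))//.
rewrite -lee_fin fineK ?hC//.
by apply: integrable_fin_num => //; exact: integrable_norm iY.
Qed.
End closure.

(** Fatou's lemma, applied off the null set on which convergence may fail. *)
Lemma moment_le_of_cvg (f : nat -> T -> R) (Y : T -> R) p (C : R) :
  (forall N, measurable_fun setT (f N)) -> measurable_fun setT Y ->
  (forall N, (\int[P]_w (`|f N w| ^+ p)%:E <= C%:E)%E) ->
  {ae P, forall w, f N w @[N --> \oo] --> Y w} ->
  (\int[P]_w (`|Y w| ^+ p)%:E <= C%:E)%E.
Proof.
move=> mf mY fC [N [mN PN fY]].
rewrite (ge0_negligible_integral _ _ _ _ PN)//; last exact: measurable_normX.
have mNC : measurable (setT `\` N) by exact: measurableD.
apply: (@le_trans _ _ (\int[P]_(w in setT `\` N)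
    limn_einf (fun k => (`|f k w| ^+ p)%:E))%E).
  rewrite le_eqVlt; apply/orP; left; apply/eqP; apply: eq_integral => // w; rewrite inE/= => -[_ Nw].
  have {}fY : f k w @[k --> \oo] --> Y w by apply: contrapT => /fY.
  have h : (`|f k w| ^+ p)%:E @[k --> \oo] --> (`|Y w| ^+ p)%:E.
    apply: cvg_EFin; first by apply: nearW.
    have := cvg_comp _ _ (cvg_norm fY) (@exprn_continuous _ p `|Y w|).
    by apply.
  by rewrite (cvg_limn_einf_sup h).1.
apply: le_trans (fatou _ _ _ _) _ => //.
  by move=> k; apply: measurable_funTS; exact: measurable_normX.
rewrite limn_einf_lim; apply: lime_le; first exact: is_cvg_einfs.
apply: nearW => k; apply: le_trans (_ : _ <= \int[P]_(w in setT `\` N) (`|f k w| ^+ p)%:E)%E _.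
  by apply: ereal_inf_lbound; exists k => /=.
apply: le_trans (fC k); apply: ge0_subset_integral => //.
exact: measurable_normX.
Qed.

Lemma measurable_riemann_sum (k : R -> T -> R) a b N :
  (forall s, a <= s <= b -> measurable_fun setT (k s)) -> a <= b ->
  measurable_fun setT (fun w => riemann_sum (k ^~ w) a b N).
Proof.
move=> mk ab; apply: measurable_sum => i.
apply: measurable_funM => //; apply: mk.
have h0 : 0 <= (b - a) / N.+1%:R by rewrite divr_ge0// subr_ge0.
rewrite lerDl mulr_ge0//= -lerBrDl mulrCA ler_piMr// ?subr_ge0//.
by rewrite ler_pdivrMr ?ltr0n// mul1r ler_nat ltnW.
Qed.

(** The sum is [b - a] times an average of values of [k], so Jensen's inequality gives the exact
    factor [(b - a) ^+ p]. This power of the length produces the orders in [r] of the later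
    expansions. *)
Lemma riemann_sum_moment_le (k : R -> T -> R) a b p (C : R) N :
  (forall s, a <= s <= b -> measurable_fun setT (k s)) -> a <= b ->
  (forall s, a <= s <= b -> (\int[P]_w (`|k s w| ^+ p)%:E <= C%:E)%E) ->
  (\int[P]_w (`|riemann_sum (k ^~ w) a b N| ^+ p)%:E <=
   ((b - a) ^+ p * C)%:E)%E.
Proof.
move=> mk ab kC.
set h := (b - a) / N.+1%:R.
have h0 : 0 <= h by rewrite divr_ge0// subr_ge0.
have sab (i : 'I_N.+1) : a <= a + i%:R * h <= b.
  rewrite lerDl mulr_ge0//= -lerBrDl mulrCA ler_piMr// ?subr_ge0//.
  by rewrite ler_pdivrMr ?ltr0n// mul1r ler_nat ltnW.
apply: (@le_trans _ _ (\int[P]_w (((b - a) ^+ p / N.+1%:R)%:E *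
   \sum_(i < N.+1) (`|k (a + i%:R * h) w| ^+ p)%:E))%E).
  apply: ge0_le_integral => //.
  - apply: measurable_normX; exact: measurable_riemann_sum.
  - apply: measurable_funeM; apply: emeasurable_sum => i.
    by apply: measurable_normX; exact: mk.
  - move=> w _; rewrite sumEFin -EFinM lee_fin.
    rewrite -mulrA [_^-1 * _]mulrC.
    apply: le_trans (_ : ((b - a) * ((\sum_(i < N.+1) `|k (a + i%:R * h) w|) / N.+1%:R)) ^+ p <= _).
      rewrite lerXn2r ?nnegrE ?mulr_ge0 ?divr_ge0 ?subr_ge0 ?sumr_ge0//.
      rewrite mulrA (mulrAC _ _ _^-1) -/h mulr_sumr.
      rewrite (le_trans (ler_norm_sum _ _ _))//; apply: ler_sum => i _.
      by rewrite normrM ger0_norm.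
    rewrite exprMn ler_wpM2l ?exprn_ge0 ?subr_ge0//.
    exact: mean_exp_le.
rewrite ge0_integralZl//; last 3 first.
- by apply: emeasurable_sum => i; apply: measurable_normX; exact: mk.
- by move=> w _; apply: sume_ge0 => i _; rewrite lee_fin exprn_ge0.
- by rewrite lee_fin divr_ge0// exprn_ge0// subr_ge0.
rewrite ge0_integral_sum//; last first.
  by move=> i; apply: measurable_normX; exact: mk.
apply: le_trans (_ : ((b - a) ^+ p / N.+1%:R)%:E * \sum_(i < N.+1) C%:E <= _)%E.
  rewrite lee_wpmul2l//; first by rewrite lee_fin divr_ge0// exprn_ge0// subr_ge0.
  by apply: lee_sum => i _; exact: kC.
rewrite sumEFin sumr_const card_ord -EFinM lee_fin -(mulr_natl C) mulrA divfK//.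
Qed.
End moments.

(** * Gaussian moments *)

Section density.
Context d (T : measurableType d) (R : realType) (P : probability T R).
Notation mu := (@lebesgue_measure R).
Variables (X : T -> R) (g : R -> R).
Hypothesis mX : measurable_fun setT X.
Hypothesis mg : measurable_fun setT g.
Hypothesis g0 : forall x, 0 <= g x.
Hypothesis Xg : forall B, measurable B ->
  P (X @^-1` B) = (\int[mu]_(x in B) (g x)%:E)%E.

Import HBNNSimple.

Let density_indic (B : set R) : measurable B ->
  (\int[P]_w (\1_B (X w))%:E = \int[mu]_x (\1_B x * g x)%:E)%E.
Proof.
move=> mB; rewrite (eq_integral (fun w => (\1_(X @^-1` B) w)%:E)); last first.
  by move=> w _; rewrite !indicE; congr (_%:R%:E); rewrite /mem/= /in_mem/=; apply/asboolP/asboolP.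
have mXB : measurable (X @^-1` B) by rewrite -[X @^-1` B]setTI; exact: mX.
rewrite integral_indic// setIT; apply: etrans (Xg mB) _.
rewrite integral_mkcond.
by apply: eq_integral => x _; rewrite epatch_indic/= -EFinM mulrC.
Qed.

Let density_nnsfun (f : {nnsfun R >-> R}) :
  (\int[P]_w (f (X w))%:E = \int[mu]_x (f x * g x)%:E)%E.
Proof.
have mfr (r : R) : measurable_fun setT (\1_(f @^-1` [set r]) : R -> R).
  by apply: measurable_indic; apply: measurable_sfunP; exact: measurable_set1.
under [LHS]eq_integral do rewrite fimfunE -fsumEFin//.
rewrite [LHS]ge0_integral_fsum//; last 2 first.
  - move=> r; apply/measurable_EFinP/measurable_funM => //.
    by apply: measurableT_comp mX; exact: mfr.
  - by move=> r w _; rewrite EFinM nnfun_muleindic_ge0.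
under [RHS]eq_integral.
  move=> x xD; rewrite fimfunE mulrC EFinM -fsumEFin// ge0_mule_fsumr; last first.
    by move=> r; rewrite EFinM nnfun_muleindic_ge0.
  over.
rewrite [RHS]ge0_integral_fsum//; last 2 first.
  - move=> r; apply: emeasurable_funM; first exact/measurable_EFinP.
    apply/measurable_EFinP/measurable_funM => //; exact: mfr.
  - move=> r x _; rewrite mule_ge0//; first by rewrite lee_fin.
    by rewrite EFinM nnfun_muleindic_ge0.
apply: eq_fsbigr => r rf.
have [r0|r0] := ltP r 0.
  rewrite preimage_nnfun0//.
  by rewrite !integral0_eq// => x _; rewrite indic0/= mulr0 ?mule0.
under eq_integral do rewrite EFinM.
have m1 : measurable_fun setT (fun w => (\1_(f @^-1` [set r]) (X w) : R)%:E).
  by apply/measurable_EFinP; apply: measurableT_comp mX; exact: mfr.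
have m2 : measurable_fun setT (fun x : R => (\1_(f @^-1` [set r]) x * g x)%:E).
  by apply/measurable_EFinP/measurable_funM => //; exact: mfr.
rewrite (ge0_integralZl P measurableT m1)//.
rewrite density_indic; last by apply: measurable_sfunP; exact: measurable_set1.
rewrite -(ge0_integralZl mu measurableT m2) ?lee_fin//; last first.
  by move=> x _; rewrite lee_fin mulr_ge0.
by apply: eq_integral => x _; rewrite -!EFinM; congr (_%:E); ring.
Qed.

Lemma ge0_integral_density (h : R -> R) : measurable_fun setT h ->
  (forall x, 0 <= h x) ->
  (\int[P]_w (h (X w))%:E = \int[mu]_x (h x * g x)%:E)%E.
Proof.
move=> mh h0.
have meh : measurable_fun setT (EFin \o h) by exact/measurable_EFinP.
have eh0 x : setT x -> (0 <= (EFin \o h) x)%E by move=> _; rewrite lee_fin.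
pose f_ := nnsfun_approx measurableT meh.
have mf n : measurable_fun [set: R] (f_ n) by [].
have nd m n (x : R) : (m <= n)%N -> f_ m x <= f_ n x.
  by move=> mn; exact/lefP/nd_nnsfun_approx.
have fh x : (f_ n x)%:E @[n --> \oo] --> (h x)%:E.
  by have /(_ x I) := cvg_nnsfun_approx measurableT meh eh0.
transitivity (limn (fun n => \int[P]_w (f_ n (X w))%:E)%E).
  rewrite -monotone_convergence//=.
  - by apply: eq_integral => w _; apply/esym/cvg_lim => //; exact: fh.
  - by move=> n; apply/measurable_EFinP; exact: measurableT_comp mX.
  - by move=> n w _; rewrite lee_fin.
  - by move=> w _ m n mn; rewrite lee_fin; exact/lefP/nd_nnsfun_approx.
transitivity (limn (fun n => \int[mu]_x (f_ n x * g x)%:E)%E); last first.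
  rewrite -monotone_convergence//=.
  - apply: eq_integral => x _; apply/cvg_lim => //.
    under eq_fun do rewrite EFinM. rewrite EFinM.
    by apply: cvgeZr => //; exact: fh.
  - move=> n; apply/measurable_EFinP; apply: measurable_funM; last exact: mg.
    exact: mf.
  - by move=> n x _; rewrite lee_fin mulr_ge0.
  - move=> x _ m n mn; rewrite lee_fin ler_wpM2r//; exact: nd.
by congr (limn _); apply/funext => n; exact: density_nnsfun.
Qed.

Lemma integrable_density (h : R -> R) : measurable_fun setT h ->
  P.-integrable setT (fun w => (h (X w))%:E) ->
  mu.-integrable setT (fun x => (h x * g x)%:E).
Proof.
move=> mh /integrableP[_ hoo]; apply/integrableP; split.
  by apply/measurable_EFinP/measurable_funM.
under eq_integral do rewrite /= normrM (ger0_norm (g0 _)).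
rewrite -ge0_integral_density//.
  exact: measurableT_comp.
Qed.

Lemma integral_density (h : R -> R) : measurable_fun setT h ->
  (\int[P]_w (h (X w))%:E = \int[mu]_x (h x * g x)%:E)%E.
Proof.
move=> mh.
rewrite [LHS]integralE [RHS]integralE.
have mp : measurable_fun setT (fun x => Num.max (h x) 0).
  by apply: measurable_maxr.
have mn : measurable_fun setT (fun x => Num.max (- h x) 0).
  by apply: measurable_maxr => //; exact: measurableT_comp.
congr (_ - _)%E.
  rewrite (eq_integral (fun w => (Num.max (h (X w)) 0)%:E)); last first.
    by move=> w _; rewrite funeposE/= EFin_max.
  rewrite (@ge0_integral_density (fun x => Num.max (h x) 0))//; last by move=> x; rewrite le_max lexx orbT.
  apply: eq_integral => x _; rewrite funeposE/= -EFin_max; congr (_%:E).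
  by rewrite maxr_pMl// mul0r.
rewrite (eq_integral (fun w => (Num.max (- h (X w)) 0)%:E)); last first.
  by move=> w _; rewrite funenegE/= EFin_max.
rewrite (@ge0_integral_density (fun x => Num.max (- h x) 0))//; last by move=> x; rewrite le_max lexx orbT.
apply: eq_integral => x _; rewrite funenegE/= -EFin_max; congr (_%:E).
by rewrite maxr_pMl// mul0r mulNr.
Qed.
End density.

Section integral_derivative.
Context {R : realType}.
Notation mu := (@lebesgue_measure R).

(** The mean and the variance of a Gaussian come from recognizing densities times polynomials as
    derivatives of decaying functions, so that its normalization is the only Gaussian integral
    involved. The proof integrates over [[-n, n]] and passes to the limit by dominated
    convergence. *)
Lemma integral_is_derive_eq0 (H h : R -> R) :
  continuous h -> (forall x : R, is_derive x 1 H (h x)) ->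
  mu.-integrable setT (EFin \o h) ->
  H n%:R @[n --> \oo] --> (0 : R) -> H (- n%:R) @[n --> \oo] --> (0 : R) ->
  (\int[mu]_x (h x)%:E = 0)%E.
Proof.
move=> ch dH ih Hp Hn.
have mh : measurable_fun setT h by exact: continuous_measurable_fun.
pose f n x := (h x * \1_(`[- n%:R, n%:R]%classic : set R) x).
have := @dominated_convergence _ _ R mu setT measurableT
   (fun n x => (f n x)%:E) (EFin \o h) (fun x => `|(EFin \o h) x|%E).
case.
- move=> n; apply/measurable_EFinP/measurable_funM => //; exact: measurable_indic.
- exact/measurable_EFinP.
- apply: aeW => x _ /=; apply: (cvg_near_cst (h x)%:E).
  have : \forall n \near \oo, `|x| < n%:R by exact: nbhs_infty_gtr.
  apply: filterS => n xn; rewrite /f indicE mem_set ?mulr1//= in_itv/=.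
  by rewrite -ler_norml ltW.
- exact: integrable_abse.
- apply: aeW => n x _ /=; rewrite lee_fin normrM ler_piMr// indicE.
  by case: (_ \in _); rewrite ?normr1 ?normr0.
move=> _ _ cv.
(* The index is shifted because [[-n, n]] is degenerate at [n = 0]. *)
have fE n : (\int[mu]_x (f n.+1 x)%:E = (H n.+1%:R - H (- n.+1%:R))%:E)%E.
  transitivity (\int[mu]_(x in `[(- n.+1%:R)%R : R, n.+1%:R%R]) (h x)%:E)%E.
    rewrite [RHS]integral_mkcond; apply: eq_integral => x _.
    by rewrite epatch_indic/= -EFinM.
  have nn : - n.+1%:R < n.+1%:R :> R by rewrite (@lt_trans _ _ 0)// ?oppr_lt0 ltr0n.
  rewrite (@continuous_FTC2 _ h H)//.
  - exact: continuous_subspaceT.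
  - have cH : continuous H by move=> x; exact: continuous_of_is_derive (dH x).
    split.
    + by move=> x _; case: (dH x).
    + by apply: cvg_at_right_filter; exact: cH.
    + by apply: cvg_at_left_filter; exact: cH.
  - by move=> x _; rewrite derive1E; case: (dH x).
have cv0 : ((H n.+1%:R - H (- n.+1%:R))%:E @[n --> \oo] --> 0%E).
  apply: cvg_EFin; first exact: nearW.
  rewrite -(subr0 0); apply: cvgB.
    by move: Hp; rewrite -(cvg_shiftS (fun n => H n%:R)).
  by move: Hn; rewrite -(cvg_shiftS (fun n => H (- n%:R))).
apply/esym/(cvg_unique _ cv0) => //.
by move: cv; rewrite -cvg_shiftS /=; under eq_fun do rewrite fE.
Qed.
End integral_derivative.

Section normal_pdf_facts.
Context {R : realType}.
Notation mu := (@lebesgue_measure R).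
Implicit Types (s x : R) (p : nat).

Lemma normal_pdf0E s x : 0 < s ->
  normal_pdf 0 s x = normal_peak s * expR (- (x / s) ^+ 2 / 2).
Proof.
move=> s0; rewrite normal_pdfE ?gt_eqF// /normal_fun subr0; congr (_ * expR _).
by rewrite -mulr_natr exprMn exprVn !mulNr invfM mulrA.
Qed.

Lemma normal_peakM2 s : 0 < s -> normal_peak s = 2 * normal_peak (2 * s).
Proof.
move=> s0; rewrite /normal_peak.
have -> : (2 * s) ^+ 2 * pi *+ 2 = 2 ^+ 2 * (s ^+ 2 * pi *+ 2) by ring.
rewrite sqrtrM ?sqr_ge0// sqrtr_sqr ger0_norm//.
by rewrite invfM mulrA divff// mul1r.
Qed.

(** [3/8 = 1/2 - 1/8] is the gap, at [u = x / s], between the Gaussian exponents for standard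
    deviations [s] and [2 s]. *)
Lemma norm_exp_le_expR p : exists2 C : R, 0 <= C &
  forall u : R, `|u| ^+ p <= C * expR (3 / 8 * u ^+ 2).
Proof.
exists (1 + (8 / 3) ^+ p * p`!%:R) => [|u].
  by rewrite addr_ge0// mulr_ge0// exprn_ge0// divr_ge0.
set v := 3 / 8 * u ^+ 2.
have v0 : 0 <= v by rewrite mulr_ge0 ?sqr_ge0// divr_ge0.
have ev1 : 1 <= expR v by rewrite -[leLHS]expR0 ler_expR.
have vp : v ^+ p <= p`!%:R * expR v.
  case: p => [|p]; first by rewrite expr0 fact0 mul1r.
  rewrite mulrC -ler_pdivrMr//; apply: le_trans (expR_ge1Dxn p v0).
  by rewrite lerDr.
have up : `|u| ^+ p <= 1 + (u ^+ 2) ^+ p.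
  have -> : (u ^+ 2) ^+ p = (`|u| ^+ p) ^+ 2.
    by rewrite -(real_normK (num_real u)) -!exprM mulnC.
  have : 0 <= `|u| ^+ p by rewrite exprn_ge0.
  by set a := `|u| ^+ p => a0; nra.
apply: le_trans up _; rewrite mulrDl mul1r lerD//.
have -> : (u ^+ 2) ^+ p = (8 / 3) ^+ p * v ^+ p.
  by rewrite -exprMn /v mulrA -[8 / 3 * _]mulrA; congr (_ ^+ _); field.
by rewrite -mulrA ler_wpM2l// exprn_ge0// divr_ge0.
Qed.

(** Doubling the standard deviation absorbs any polynomial factor, and the peak changes by a factor
    2. The constant does not depend on [s], hence the moments of [x / s] are bounded uniformly in
    [s]. *)
Lemma norm_exp_normal_pdf_le p : exists2 C : R, 0 <= C &
  forall s x, 0 < s ->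
    `|x / s| ^+ p * normal_pdf 0 s x <= C * normal_pdf 0 (2 * s) x.
Proof.
have [C C0 hC] := norm_exp_le_expR p; exists (2 * C) => [|s x s0].
  by rewrite mulr_ge0.
rewrite !normal_pdf0E ?mulr_gt0// (normal_peakM2 s0).
have -> : - (x / (2 * s)) ^+ 2 / 2 = 3 / 8 * (x / s) ^+ 2 + - (x / s) ^+ 2 / 2.
  by field; rewrite gt_eqF.
have := hC (x / s); rewrite expRD.
set E1 := expR (3 / 8 * _); set E2 := expR _; set A := _ ^+ p => h.
have -> : A * (2 * normal_peak (2 * s) * E2) = 2 * normal_peak (2 * s) * E2 * A.
  by ring.
have -> : 2 * C * (normal_peak (2 * s) * (E1 * E2)) =
  2 * normal_peak (2 * s) * E2 * (C * E1) by ring.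
by rewrite ler_wpM2l// !mulr_ge0 ?normal_peak_ge0 ?expR_ge0.
Qed.

Lemma integral_norm_exp_normal_pdf p : exists2 C : R, 0 <= C &
  forall s, 0 < s ->
    (\int[mu]_x (`|x / s| ^+ p * normal_pdf 0 s x)%:E <= C%:E)%E.
Proof.
have [C C0 hC] := norm_exp_normal_pdf_le p; exists C => // s s0.
apply: (@le_trans _ _ (\int[mu]_x (C%:E * (normal_pdf 0 (2 * s) x)%:E)))%E.
  apply: ge0_le_integral => //.
  - by move=> x _; rewrite lee_fin mulr_ge0 ?exprn_ge0 ?normal_pdf_ge0.
  - apply/measurable_EFinP/measurable_funM; last exact: measurable_normal_pdf.
    apply: measurable_funX; apply: measurableT_comp => //.
    exact: measurable_funM.
  - by apply: measurable_funeM; apply/measurable_EFinP; exact: measurable_normal_pdf.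
  - by move=> x _; rewrite -EFinM lee_fin hC.
rewrite ge0_integralZl//; last 2 first.
- by apply/measurable_EFinP; exact: measurable_normal_pdf.
- by move=> x _; rewrite lee_fin normal_pdf_ge0.
by rewrite integral_normal_pdf mule1.
Qed.

Lemma is_derive_normal_pdf s x : 0 < s ->
  is_derive x 1 (normal_pdf 0 s) (- (x / s ^+ 2) * normal_pdf 0 s x).
Proof.
move=> s0; have sn0 : s != 0 by rewrite gt_eqF.
have -> : normal_pdf 0 s =
    (fun y => normal_peak s *: expR ((- (2^-1 * s^-1 ^+ 2)) *: y ^+ 2)).
  apply/funext => y; rewrite normal_pdf0E//; congr (_ * expR _).
  by rewrite /GRing.scale/=; field.
apply: is_derive_eq.
rewrite /GRing.scale/=.
by field.
Qed.

Lemma cvg_seq0_of_norm_le (H : R -> R) (C : R) :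
  (forall x, `|x| * `|H x| <= C) ->
  H n%:R @[n --> \oo] --> (0 : R) /\ H (- n%:R) @[n --> \oo] --> (0 : R).
Proof.
move=> HC.
suff Hs (z : R) : `|z| = 1 -> H (z * n%:R) @[n --> \oo] --> (0 : R).
  split; first by have := Hs 1 (normr1 _); under eq_fun do rewrite mul1r.
  by have := Hs (- 1) (normrN1 _); under eq_fun do rewrite mulN1r.
move=> z1; rewrite -(cvg_shiftS (fun n => H (z * n%:R)))/=.
apply/norm_cvg0P; apply: (@squeeze_cvgr _ _ _ _ (cst 0) (fun n => C * n.+1%:R^-1)).
- apply: nearW => n /=; rewrite normr_ge0/=.
  rewrite ler_pdivlMr ?ltr0n// mulrC.
  by have := HC (z * n.+1%:R); rewrite normrM z1 mul1r ger0_norm.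
- exact: cvg_cst.
- by rewrite -[X in _ --> X](mulr0 C); apply: cvgM; [exact: cvg_cst|exact: cvg_harmonic].
Qed.

Lemma normal_pdf_decay s p : 0 < s ->
  exists C, forall x, `|x| ^+ p * normal_pdf 0 s x <= C.
Proof.
move=> s0; have [C C0 hC] := norm_exp_normal_pdf_le p.
exists (s ^+ p * (C * normal_peak (2 * s))) => x.
apply: (@le_trans _ _ (s ^+ p * (`|x / s| ^+ p * normal_pdf 0 s x))).
  rewrite normrM normfV (gtr0_norm s0) exprMn exprVn mulrA mulrCA divff ?mulr1//.
  by rewrite gt_eqF// exprn_gt0.
rewrite ler_pM2l ?exprn_gt0//; apply: le_trans (hC _ _ s0) _.
by rewrite ler_wpM2l// normal_pdf_ub// gt_eqF// mulr_gt0.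
Qed.
End normal_pdf_facts.

Section normal_moments.
Context d (T : measurableType d) (R : realType) (P : probability T R).
Variables (X : T -> R) (s : R).
Hypothesis s0 : 0 < s.
Hypothesis mX : measurable_fun setT X.
Hypothesis Xs : forall B : set R, measurable B ->
  P (X @^-1` B) = normal_prob 0 s B.
Notation mu := (@lebesgue_measure R).
Let mpdf : measurable_fun setT (normal_pdf 0 s) := measurable_normal_pdf 0 s.
Let pdf0 : forall x, 0 <= normal_pdf 0 s x := normal_pdf_ge0 0 s.

Lemma normal_norm_moment p (C : R) :
  (\int[mu]_x (`|x / s| ^+ p * normal_pdf 0 s x)%:E <= C%:E)%E ->
  (\int[P]_w (`|X w / s| ^+ p)%:E <= C%:E)%E.
Proof.
rewrite -(@ge0_integral_density _ _ _ P X (normal_pdf 0 s) mX mpdf pdf0 Xs (fun x => `|x / s| ^+ p))//.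
  apply: measurable_funX; apply: measurableT_comp => //; exact: measurable_funM.
Qed.

Let integrable_normX p : P.-integrable setT (fun w => (`|X w / s| ^+ p)%:E).
Proof.
have [C C0 hC] := @integral_norm_exp_normal_pdf R p.
have mXp : measurable_fun setT (fun w => `|X w / s| ^+ p).
  apply: measurable_funX; apply: measurableT_comp => //; exact: measurable_funM.
apply/integrableP; split; first exact/measurable_EFinP.
under eq_integral do rewrite /= ger0_norm ?exprn_ge0//.
exact: le_lt_trans (normal_norm_moment (hC _ s0)) (ltry _).
Qed.

Lemma normal_mean : (\int[P]_w (X w / s)%:E = 0)%E.
Proof.
rewrite (@integral_density _ _ _ P X (normal_pdf 0 s) mX mpdf pdf0 Xs (fun x => x / s))//; last exact: measurable_funM.
have [C hC] := @normal_pdf_decay R s 1 s0.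
(* The density [f] satisfies [f' = - (x / s^2) f], hence [H' = (x / s) f]. *)
pose H := (fun x => - s *: normal_pdf 0 s x).
have HC x : `|x| * `|H x| <= s * C.
  rewrite normrM normrN (gtr0_norm s0) (ger0_norm (pdf0 _)) mulrCA ler_pM2l//.
  exact: hC.
have [Hp Hn] := cvg_seq0_of_norm_le HC.
apply: (@integral_is_derive_eq0 R H) => //.
- move=> x; apply: cvgM; first by apply: cvgM; [exact: cvg_id|exact: cvg_cst].
  by apply: continuous_normal_pdf; rewrite gt_eqF.
- move=> x; have dg := is_derive_normal_pdf x s0.
  apply: is_derive_eq; rewrite /GRing.scale/=; field.
  by rewrite gt_eqF.
- apply: (@integrable_density _ _ _ P X (normal_pdf 0 s) mX mpdf pdf0 Xs (fun x => x / s)).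
    exact: measurable_funM.
  have := integrable_normX 1; apply: le_integrable => //.
    by apply/measurable_EFinP; exact: measurable_funM.
  by move=> w _; rewrite /= lee_fin expr1 normr_id.
Qed.

Lemma normal_variance : (\int[P]_w ((X w / s) ^+ 2 - 1)%:E = 0)%E.
Proof.
have mh : measurable_fun setT (fun x : R => (x / s) ^+ 2 - 1).
  by apply: measurable_funB => //; apply: measurable_funX; exact: measurable_funM.
rewrite (@integral_density _ _ _ P X (normal_pdf 0 s) mX mpdf pdf0 Xs (fun x => (x / s) ^+ 2 - 1))//.
have [C hC] := @normal_pdf_decay R s 2 s0.
(* By the product rule and [f' = - (x / s^2) f], the derivative of [H] is [((x / s)^2 - 1) f]. *)
pose H := (fun x => (- x) * normal_pdf 0 s x).
have HC x : `|x| * `|H x| <= C.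
  by rewrite normrM normrN (ger0_norm (pdf0 _)) mulrA -expr2; exact: hC.
have [Hp Hn] := cvg_seq0_of_norm_le HC.
apply: (@integral_is_derive_eq0 R H) => //.
- move=> x; apply: cvgM; last by apply: continuous_normal_pdf; rewrite gt_eqF.
  apply: cvgB; last exact: cvg_cst.
  apply: (@continuous_comp _ _ _ (fun x : R => x / s) (fun x => x ^+ 2)).
    by apply: cvgM; [exact: cvg_id|exact: cvg_cst].
  exact: exprn_continuous.
- move=> x; have dg := is_derive_normal_pdf x s0.
  have -> : H = -%R * normal_pdf 0 s by [].
  apply: is_derive_eq; rewrite /GRing.scale/=; field.
  by rewrite gt_eqF.
- apply: (@integrable_density _ _ _ P X (normal_pdf 0 s) mX mpdf pdf0 Xs (fun x => (x / s) ^+ 2 - 1)) => //.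
  have : P.-integrable setT (fun w => (`|X w / s| ^+ 2)%:E - 1%:E)%E.
    apply: integrableB => //; exact: finite_measure_integrable_cst.
  apply: le_integrable => //.
    apply/measurable_EFinP; exact: measurableT_comp mh mX.
  by move=> w _; rewrite /= real_normK ?num_real.
Qed.
End normal_moments.

(** * The past of the Brownian motion *)

Section expectation_product.
Context d (T : measurableType d) (R : realType) (P : probability T R).
Variables (Y Z : T -> R).
Hypotheses (mY : measurable_fun setT Y) (mZ : measurable_fun setT Z).
Hypothesis YZ : forall A B : set R, measurable A -> measurable B ->
  P (Y @^-1` A `&` Z @^-1` B) = (P (Y @^-1` A) * P (Z @^-1` B))%E.

(** Independence says that the joint law and the product of the laws agree on rectangles, hence they
    are equal; Fubini's theorem then factors the integral. *)
Lemma expectation_indepM :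
  P.-integrable setT (EFin \o Y) -> P.-integrable setT (EFin \o Z) ->
  P.-integrable setT (fun w => (Y w * Z w)%:E) ->
  \int[P]_w (Y w * Z w) = \int[P]_w Y w * \int[P]_w Z w.
Proof.
move=> iY iZ iYZ.
pose Y' : {mfun T >-> R} := mfun_Sub (mem_set mY).
pose Z' : {mfun T >-> R} := mfun_Sub (mem_set mZ).
have mp : measurable_fun setT (fun w => (Y w, Z w)) by exact: measurable_fun_pair.
pose p' : {mfun T >-> (R * R)%type} := mfun_Sub (mem_set mp).
pose m1 := distribution P Y'; pose m2 := distribution P Z'.
pose m := distribution P p'.
have mE (S : set (R * R)) : measurable S -> (m1 \x m2)%E S = m S.
  move=> mS; apply: (product_measure_unique _ mS) => A B mA mB.
  rewrite /m /m1 /m2 /distribution /pushforward/=; apply: etrans (YZ mA mB).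
  by congr (P _); apply/seteqP; split.
have mmul : measurable_fun setT (fun x : R * R => x.1 * x.2).
  by apply: measurable_funM; [exact: measurable_fst|exact: measurable_snd].
have mmulE : measurable_fun setT (fun x : R * R => (x.1 * x.2)%:E).
  exact/measurable_EFinP.
have im : m.-integrable setT (fun x => (x.1 * x.2)%:E).
  exact: (@integrable_pushforward _ _ _ _ _ _ mp).
have ip : (m1 \x m2)%E.-integrable setT (fun x => (x.1 * x.2)%:E).
  apply/integrableP; split => //.
  move/integrableP : im => [_]; rewrite (@eq_measure_integral _ _ _ setT (m1 \x m2)%E)//.
  by move=> A mA _; first [exact: mE|exact/esym/mE].
have E1 : (\int[m]_x (x.1 * x.2)%:E = \int[P]_w (Y w * Z w)%:E)%E.
  exact: (@integral_pushforward _ _ _ _ _ _ mp).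
have E2 : (\int[m1 \x m2]_x (x.1 * x.2)%:E = \int[m]_x (x.1 * x.2)%:E)%E.
  by apply: eq_measure_integral => A mA _; first [exact: mE|exact/esym/mE].
have E3 := integral12_prod_meas1 ip.
have mE1 : measurable_fun setT (fun z : R => z%:E) by exact/measurable_EFinP.
have iZ' : m2.-integrable setT (fun z => z%:E).
  by apply: (@integrable_pushforward _ _ _ _ _ _ mZ).
have iY' : m1.-integrable setT (fun z => z%:E).
  by apply: (@integrable_pushforward _ _ _ _ _ _ mY).
have EZ : (\int[m2]_z z%:E = \int[P]_w (Z w)%:E)%E.
  by apply: (@integral_pushforward _ _ _ _ _ _ mZ).
have EY : (\int[m1]_z z%:E = \int[P]_w (Y w)%:E)%E.
  by apply: (@integral_pushforward _ _ _ _ _ _ mY).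
have fZ := integrable_fin_num measurableT iZ.
have fY := integrable_fin_num measurableT iY.
rewrite /Rintegral -E1 -E2 -E3 -fineM//; congr fine.
rewrite /fubini_F/= -EY -EZ.
have fm2 : (\int[m2]_z z%:E)%E \is a fin_num by rewrite EZ.
transitivity (\int[m1]_y (y%:E * (fine (\int[m2]_z z%:E))%:E))%E.
  apply: eq_integral => y _; rewrite fineK// -integralZl//.
by rewrite integralZr// fineK.
Qed.
End expectation_product.

Section null_completion.
Context d (T : measurableType d) (R : realType) (P : probability T R).
Implicit Types (G : set_system T) (Y Z : T -> R).

(* The expansion coefficients satisfy their equations only almost surely, hence
   are adapted only up to null sets. *)
Definition null_completion G : set_system T :=
  [set A | measurable A /\
    exists2 B, <<s G >> B & {ae P, forall w, A w <-> B w}].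

Lemma sigma_algebra_null_completion G : sigma_algebra setT (null_completion G).
Proof.
split.
- split; first exact: measurable0.
  by exists set0; [exact: sigma_algebra0|apply: aeW].
- move=> A [mA [B GB AB]]; rewrite setTD; split; first exact: measurableC.
  exists (~` B); first exact: sigma_algebraC.
  by apply: filterS AB => w AB; split => nA /AB.
- move=> A hA; split; first by apply: bigcupT_measurable => i; case: (hA i).
  have /choice[B hB] i : exists B, <<s G >> B /\ {ae P, forall w, A i w <-> B w}.
    by have [_ [B ? ?]] := hA i; exists B.
  exists (\bigcup_i B i); first by apply: sigma_algebra_bigcup => i; case: (hB i).
  have := @ae_foralln _ _ _ P _ (fun i => (hB i).2).
  by apply: filterS => w h; split=> -[i _ /h ?]; exists i.
Qed.

(** Stated as measurability out of a generated sigma-algebra type, so that the closure properties of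
    measurable functions under sums, products, compositions and limits apply directly. *)
Definition adapted G Y : Prop :=
  measurable_fun setT (Y : g_sigma_algebraType (null_completion G) -> R).

Lemma measurable_null_completion G :
  (measurable : set (set (g_sigma_algebraType (null_completion G)))) =
  null_completion G.
Proof. exact/measurable_g_measurableTypeE/sigma_algebra_null_completion. Qed.

Lemma adaptedP G Y : adapted G Y <->
  forall B : set R, measurable B -> null_completion G (Y @^-1` B).
Proof.
split=> [aY B mB|h _ B mB].
  have := aY measurableT B mB.
  by rewrite setTI measurable_null_completion.
by rewrite setTI measurable_null_completion; exact: h.
Qed.

Lemma adapted_measurable G Y : adapted G Y -> measurable_fun setT Y.
Proof. by move=> /adaptedP h _ B mB; rewrite setTI; case: (h _ mB). Qed.

Lemma adapted_ae_eq G Y Z : adapted G Y -> measurable_fun setT Z ->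
  {ae P, forall w, Y w = Z w} -> adapted G Z.
Proof.
move=> /adaptedP aY mZ YZ; apply/adaptedP => B mB.
have [_ [C GC YC]] := aY B mB; split; first by rewrite -[_ @^-1` _]setTI; exact: mZ.
by exists C => //; apply: filterS2 YZ YC => w /= ->.
Qed.

Lemma adapted_cst G (c : R) : adapted G (fun _ => c).
Proof. exact: measurable_cst. Qed.

Lemma adaptedD G Y Z : adapted G Y -> adapted G Z ->
  adapted G (fun w => Y w + Z w).
Proof. exact: measurable_funD. Qed.

Lemma adaptedM G Y Z : adapted G Y -> adapted G Z ->
  adapted G (fun w => Y w * Z w).
Proof. exact: measurable_funM. Qed.

Lemma adapted_comp G Y (h : R -> R) : measurable_fun setT h -> adapted G Y ->
  adapted G (fun w => h (Y w)).
Proof. by move=> mh; exact: measurableT_comp. Qed.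

Lemma adapted_subset G G' Y : <<s G >> `<=` <<s G' >> -> adapted G Y ->
  adapted G' Y.
Proof.
move=> GG' /adaptedP aY; apply/adaptedP => B mB.
by have [mY [C GC YC]] := aY B mB; split => //; exists C => //; exact: GG'.
Qed.

Lemma adapted_generated G Y : measurable_fun setT Y ->
  (forall B : set R, measurable B -> <<s G >> (Y @^-1` B)) -> adapted G Y.
Proof.
move=> mY h; apply/adaptedP => B mB; split; first by rewrite -[_ @^-1` _]setTI; exact: mY.
by exists (Y @^-1` B); [exact: h|apply: aeW].
Qed.

Lemma adapted_cvg G (f : nat -> T -> R) Y : (forall k, adapted G (f k)) ->
  measurable_fun setT Y -> {ae P, forall w, f k w @[k --> \oo] --> Y w} ->
  adapted G Y.
Proof.
move=> af mY [N [mN PN fY]].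
have aeN : {ae P, forall w, ~ N w}.
  by exists N; split => // w /=; apply: contra_notP => h; apply: contrapT.
(* The exceptional set is measurable and null, so its complement has an indicator almost surely
   equal to 1 and therefore adapted; multiplying by it makes the convergence hold everywhere. *)
have aN : adapted G (\1_(~` N)).
  have cst1 := @adapted_cst G 1.
  apply: (adapted_ae_eq cst1); first exact/measurable_indic/measurableC.
  by apply: filterS aeN => w Nw; rewrite indicE mem_set.
apply: (@adapted_ae_eq _ (fun w => Y w * \1_(~` N) w)) => //; last first.
  by apply: filterS aeN => w Nw; rewrite indicE mem_set// mulr1.
apply: (@measurable_fun_cvg _ (g_sigma_algebraType (null_completion G)) _ setT
  (fun k w => f k w * \1_(~` N) w)).
  by move=> k; exact: adaptedM (af k) aN.
move=> w _; rewrite indicE; have [Nw|Nw] := boolP (w \in ~` N).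
  apply: cvgM; last exact: cvg_cst.
  by apply: contrapT => /fY; move: Nw; rewrite inE.
by rewrite mulr0; under eq_fun do rewrite mulr0; exact: cvg_cst.
Qed.

Lemma adapted_riemann_sum G (k : R -> T -> R) a b N :
  (forall s, a <= s <= b -> adapted G (k s)) -> a <= b ->
  adapted G (fun w => riemann_sum (k ^~ w) a b N).
Proof. by move=> ak ab; exact: measurable_riemann_sum. Qed.

(** The measures [P (D n E)] and [P D * P E] of [D] agree on the pi-system [G], hence on the
    sigma-algebra it generates; the completion changes events by null sets only. *)
Lemma adapted_indep G (E : set T) Y : setI_closed G -> G setT ->
  G `<=` measurable -> measurable E ->
  (forall C, G C -> P (C `&` E) = (P C * P E)%E) -> adapted G Y ->
  forall B : set R, measurable B ->
    P (Y @^-1` B `&` E) = (P (Y @^-1` B) * P E)%E.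
Proof.
move=> GI GT Gm mE GE /adaptedP aY B mB.
have [mA [C GC AC]] := aY B mB.
have mC : measurable C by apply: (smallest_sub (@sigma_algebra_measurable _ T) Gm).
have aeeq (D : set T) : measurable D -> P (Y @^-1` B `&` D) = P (C `&` D).
  move=> mD; have mAD := measurableI _ _ mA mD; have mCD := measurableI _ _ mC mD.
  rewrite -(setIT (_ `&` D)) -(setIT (C `&` D)) -!integral_indic//.
  apply: ae_eq_integral => //; [exact/measurable_EFinP/measurable_indic..|].
  apply: filterS AC => w AC _ /=; rewrite !indicE; congr ((nat_of_bool _)%:R%:E).
  by apply/idP/idP; rewrite !inE => -[/AC ? ?]; split => //; exact/AC.
have PE : P E \is a fin_num by exact: fin_num_measure.
have CE : P (C `&` E) = (P C * P E)%E.
  pose e : {nonneg R} := NngNum (fine_ge0 (measure_ge0 P E)).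
  have mscaleE D : mscale e P D = (P D * P E)%E.
    by transitivity ((fine (P E))%:E * P D)%E => //; rewrite fineK// muleC.
  have := @g_sigma_algebra_measure_unique _ R T G _ (fun=> setT) _ _
     (mrestr P mE) (mscale e P).
  move=> /(_ Gm (fun=> GT)) H.
  have cover : \bigcup_(_ : nat) [set: T] = setT.
    by apply/seteqP; split => // w _; exists 0%N.
  have HG D : G D -> mrestr P mE D = mscale e P D.
    by move=> GD; rewrite mscaleE; exact: GE.
  have Hfin (k : nat) : (mrestr P mE [set: T] < +oo)%E.
    have -> : mrestr P mE setT = P (setT `&` E) by [].
    by rewrite setTI ltey_eq PE.
  by rewrite -mscaleE; exact: (H cover GI HG Hfin C GC).
by rewrite -[Y @^-1` B in RHS]setIT !aeeq// setIT.
Qed.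
End null_completion.

Section past_filtration.
Context d (T : measurableType d) (R : realType) (P : probability T R).
Variables (G0 : set_system T) (W : R -> {RV P >-> R}).
Hypothesis G0_sigma : sigma_algebra setT G0.
Hypothesis G0_measurable : G0 `<=` measurable.
Hypothesis hW : brownian_motion W.
Hypothesis G0W : independent_sigma P G0 (sigma_family [set t : R | 0 <= t] W).

Let Wpast (s : R) : set_system T := sigma_family `[0, s] W.

(** Intersections of an initial event and a Brownian event form a pi-system on which independence of
    later increments can be checked directly; the generated sigma-algebra is reached through
    [adapted_indep]. *)
Definition past (s : R) : set_system T :=
  [set C | exists A B, [/\ G0 A, Wpast s B & C = A `&` B]].

(* A pair [tr] encodes the time step from [tr.1] to [tr.1 + tr.2 ^+ 2]. *)
Definition normalized_increment (tr : R * R) (w : T) : R :=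
  (W (tr.1 + tr.2 ^+ 2) w - W tr.1 w) / tr.2.

Let setI_sigma (G : set_system T) A B : sigma_algebra setT G ->
  G A -> G B -> G (A `&` B).
Proof.
move=> sG; rewrite -(measurable_g_measurableTypeE sG); exact: measurableI.
Qed.

Let setT_sigma (G : set_system T) : sigma_algebra setT G -> G setT.
Proof.
move=> sG; rewrite -(measurable_g_measurableTypeE sG); exact: measurableT.
Qed.

Let sigma_family_sigma (D : set R) : sigma_algebra setT (sigma_family D W).
Proof. exact: smallest_sigma_algebra. Qed.

Lemma sigma_family_preimage (D : set R) u (B : set R) : D u -> measurable B ->
  sigma_family D W (W u @^-1` B).
Proof.
move=> Du mB; apply: sub_sigma_algebra; exists u => //; exists B => //.
by rewrite setTI.
Qed.

Lemma sigma_family_subset (D D' : set R) : D `<=` D' ->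
  sigma_family D W `<=` sigma_family D' W.
Proof.
by move=> DD'; apply: sub_sigma_algebra2; apply: bigcup_subset.
Qed.

Lemma sigma_family_measurable (D : set R) : sigma_family D W `<=` measurable.
Proof.
apply: smallest_sub; first exact: sigma_algebra_measurable.
by move=> _ [u _ [B mB <-]]; exact: measurable_funP.
Qed.

Lemma setI_closed_past s : setI_closed (past s).
Proof.
move=> _ _ [A [B [GA FB ->]]] [A' [B' [GA' FB' ->]]].
exists (A `&` A'), (B `&` B'); split.
- exact: setI_sigma.
- exact: (setI_sigma (sigma_family_sigma _)).
- by rewrite setIACA.
Qed.

Lemma pastT s : past s setT.
Proof.
exists setT, setT; split; [exact: setT_sigma| |by rewrite setIT].
exact: (setT_sigma (sigma_family_sigma _)).
Qed.

Lemma past_measurable s : past s `<=` measurable.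
Proof.
move=> _ [A [B [GA FB ->]]]; apply: measurableI; first exact: G0_measurable.
exact: sigma_family_measurable FB.
Qed.

(** For [C] the intersection of [A] and [D], independence of the initial data splits off [A], since
    [D] and the increment both belong to the sigma-algebra of [W]; independence of Brownian
    increments then splits off [D]. *)
Lemma past_indep s t (C : set T) (B : set R) : 0 <= s -> s < t -> past s C ->
  measurable B ->
  P (C `&` (fun w => W t w - W s w) @^-1` B) =
  (P C * P ((fun w => (W t w - W s w)%R) @^-1` B))%E.
Proof.
move=> s0 st [A [D [GA FD ->]]] mB; set E := _ @^-1` B.
have FE : sigma_family [set t : R | 0 <= t] W E.
  pose S := \bigcup_(i in [set t : R | 0 <= t]) sigma_of (W i).
  have mWu u : 0 <= u -> measurable_fun setT (W u : g_sigma_algebraType S -> R).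
    move=> u0 _ B1 mB1; rewrite setTI.
    exact: (@sigma_family_preimage [set t : R | 0 <= t]).
  have : measurable_fun setT ((fun w => W t w - W s w) : g_sigma_algebraType S -> R).
    by apply: measurable_funB; apply: mWu => //; rewrite (le_trans s0)// ltW.
  by move=> /(_ measurableT B mB); rewrite setTI.
have FD' : sigma_family [set t : R | 0 <= t] W D.
  by apply: sigma_family_subset FD => u/=; rewrite in_itv/= => /andP[].
rewrite -setIA G0W//; last exact: (setI_sigma (sigma_family_sigma _)).
rewrite (G0W GA FD') -muleA; congr (_ * _)%E.
rewrite setIC; have [_ _ ind _] := hW.
rewrite muleC; apply: (ind s t s0 st E D _ FD).
by exists B => //; rewrite setTI.
Qed.

Lemma adapted_past_init s (Y : T -> R) : measurable_fun setT Y ->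
  (forall B : set R, measurable B -> G0 (Y @^-1` B)) -> adapted P (past s) Y.
Proof.
move=> mY h; apply: adapted_generated => // B mB; apply: sub_sigma_algebra.
exists (Y @^-1` B), setT; split; [exact: h| |by rewrite setIT].
exact: (setT_sigma (sigma_family_sigma _)).
Qed.

Lemma adapted_past_W u s : 0 <= u -> u <= s -> adapted P (past s) (W u).
Proof.
move=> u0 us; apply: adapted_generated => // B mB; apply: sub_sigma_algebra.
exists setT, (W u @^-1` B); split; [exact: setT_sigma| |by rewrite setTI].
by apply: sigma_family_preimage => //; rewrite /= in_itv/= u0.
Qed.

Lemma adapted_past_le s s' (Y : T -> R) : s <= s' -> adapted P (past s) Y ->
  adapted P (past s') Y.
Proof.
move=> ss'; apply: adapted_subset; apply: sub_sigma_algebra2.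
move=> _ [A [B [GA FB ->]]]; exists A, B; split => //.
apply: sigma_family_subset FB => u/=; rewrite !in_itv/= => /andP[-> us].
exact: le_trans us ss'.
Qed.

(** A step is measured by the square root of its length, which is the standard deviation of the
    Brownian increment: all orders become integer powers of [r]. *)
Definition step_domain (Tm : R) : set (R * R) :=
  [set tr | [/\ 0 <= tr.1, 0 < tr.2 & tr.1 + tr.2 ^+ 2 <= Tm]].

Lemma measurable_increment s t : measurable_fun setT (fun w => W t w - W s w).
Proof. exact: measurable_funB. Qed.

Lemma increment_normal s r (B : set R) : 0 <= s -> 0 < r -> measurable B ->
  P ((fun w => W (s + r ^+ 2) w - W s w) @^-1` B) = normal_prob 0 r B.
Proof.
move=> s0 r0 mB; have [_ gauss _ _] := hW.
have st : s < s + r ^+ 2 by rewrite ltrDl exprn_gt0.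
rewrite (gauss _ _ s0 st _ mB); congr (normal_prob _ _ _).
by rewrite addrC addKr sqrtr_sqr gtr0_norm.
Qed.

Lemma moment_bounded_increment Tm :
  moment_bounded P (step_domain Tm) normalized_increment.
Proof.
split=> [[s r] [s0 r0 _]|p].
  by apply: measurable_funM => //; exact: measurable_increment.
have [C C0 hC] := @integral_norm_exp_normal_pdf R p.
exists C => -[s r] [/= s0 r0 _]; apply: (@normal_norm_moment _ _ _ P _ r) => //.
- exact: measurable_increment.
- by move=> B mB; exact: increment_normal.
- exact: hC.
Qed.

Let incr_indep s r (h : R -> R) (Y : T -> R) : 0 <= s -> 0 < r ->
  measurable_fun setT h -> adapted P (past s) Y ->
  P.-integrable setT (EFin \o Y) ->
  P.-integrable setT (fun w => (h (normalized_increment (s, r) w))%:E) ->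
  P.-integrable setT (fun w => (Y w * h (normalized_increment (s, r) w))%:E) ->
  \int[P]_w (Y w * h (normalized_increment (s, r) w)) =
  \int[P]_w Y w * \int[P]_w h (normalized_increment (s, r) w).
Proof.
move=> s0 r0 mh aY iY ih iYh.
have st : s < s + r ^+ 2 by rewrite ltrDl exprn_gt0.
apply: expectation_indepM => //.
- exact: adapted_measurable aY.
- apply: measurableT_comp => //; apply: measurable_funM => //.
  exact: measurable_increment.
move=> A B mA mB.
(* Independence is known for the raw increment, so both [h] and the normalization are moved into the
   set. *)
pose B' := (fun x => h (x / r)) @^-1` B.
have mB' : measurable B'.
  rewrite -[B']setTI; apply: (measurableT_comp mh) => //.
  exact: measurable_funM.
have -> : (fun w => h (normalized_increment (s, r) w)) @^-1` B =
  (fun w => W (s + r ^+ 2) w - W s w) @^-1` B' by [].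
apply: (adapted_indep (setI_closed_past (s := s)) (pastT s) (@past_measurable s) _ _ aY mA).
- rewrite -[X in measurable X]setTI; exact: measurable_increment.
- by move=> C GC; exact: past_indep.
Qed.

Lemma integral_adapted_increment Tm s r (Y : T -> R) : step_domain Tm (s, r) ->
  adapted P (past s) Y -> P.-integrable setT (EFin \o Y) ->
  P.-integrable setT (fun w => (Y w * normalized_increment (s, r) w)%:E) ->
  \int[P]_w (Y w * normalized_increment (s, r) w) = 0.
Proof.
move=> D aY iY iYN; have [/= s0 r0 _] := D.
rewrite (@incr_indep s r id)//.
  rewrite [X in _ * X](_ : _ = 0) ?mulr0//.
  rewrite /Rintegral (@normal_mean _ _ _ P _ r)//; first exact: measurable_increment.
  by move=> B mB; exact: increment_normal.
exact: (moment_bounded_integrable (moment_bounded_increment Tm) D).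
Qed.

Lemma integral_adapted_increment_sqr Tm s r (Y : T -> R) :
  step_domain Tm (s, r) ->
  adapted P (past s) Y -> P.-integrable setT (EFin \o Y) ->
  P.-integrable setT
    (fun w => (Y w * (normalized_increment (s, r) w ^+ 2 - 1))%:E) ->
  \int[P]_w (Y w * (normalized_increment (s, r) w ^+ 2 - 1)) = 0.
Proof.
move=> D aY iY iYN; have [/= s0 r0 _] := D.
have m2 : measurable_fun setT (fun x : R => x ^+ 2 - 1).
  by apply: measurable_funB => //; exact: exprn_measurable.
rewrite (@incr_indep s r (fun x => x ^+ 2 - 1))//.
  rewrite [X in _ * X](_ : _ = 0) ?mulr0//.
  rewrite /Rintegral (@normal_variance _ _ _ P _ r)//; first exact: measurable_increment.
  by move=> B mB; exact: increment_normal.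
have mb := moment_bounded_increment Tm.
have mb2 : moment_bounded P (step_domain Tm)
    (fun i w => normalized_increment i w * normalized_increment i w + -1).
  apply: moment_boundedD; first exact: moment_boundedM.
  by apply: (@moment_bounded_cst _ _ _ _ _ _ (fun=> -1) 1) => i _; rewrite normrN1.
exact: (moment_bounded_integrable mb2 D).
Qed.
End past_filtration.

(** * Ito expansions over small time steps *)

Section primitives.
Context d (T : measurableType d) (R : realType) (P : probability T R).
Implicit Types (Y k : R -> T -> R).

Definition ae_continuous Y := {ae P, forall w, continuous (Y ^~ w)}.

(** Time 0 is excluded because paths extended by the absolute value may have a corner there. *)
Definition ae_primitive Y k := {ae P, forall w (t : R), 0 < t ->
  is_derive t 1 (Y ^~ w) (k t w)}.

Section difference.
Variables (Y k : R -> T -> R) (a b : R).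
Hypotheses (a0 : 0 <= a) (ab : a < b).
Hypotheses (cY : ae_continuous Y) (ck : ae_continuous k).
Hypothesis Yk : ae_primitive Y k.
Hypothesis mY : measurable_fun setT (fun w => Y b w - Y a w).

Let riem : {ae P, forall w,
  riemann_sum (k ^~ w) a b N @[N --> \oo] --> Y b w - Y a w}.
Proof.
apply: filterS3 cY ck Yk => w cYw ckw Ykw.
apply: (riemann_sum_cvg ab ckw cYw) => x /andP[ax _].
by apply: Ykw; exact: le_lt_trans ax.
Qed.

(** Minkowski's inequality for time integrals, obtained on Riemann sums and passed to the limit by
    Fatou's lemma. *)
Lemma primitive_moment_le p (C : R) :
  (forall s, a <= s <= b -> measurable_fun setT (k s)) ->
  (forall s, a <= s <= b -> (\int[P]_w (`|k s w| ^+ p)%:E <= C%:E)%E) ->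
  (\int[P]_w (`|Y b w - Y a w| ^+ p)%:E <= ((b - a) ^+ p * C)%:E)%E.
Proof.
move=> mk kC; apply: (@moment_le_of_cvg _ _ _ _
    (fun N w => riemann_sum (k ^~ w) a b N)) => //.
- by move=> N; apply: measurable_riemann_sum => //; exact: ltW.
- by move=> N; apply: riemann_sum_moment_le => //; exact: ltW.
Qed.

Lemma primitive_adapted G : (forall s, a <= s <= b -> adapted P G (k s)) ->
  adapted P G (fun w => Y b w - Y a w).
Proof.
move=> ak; apply: (@adapted_cvg _ _ _ _ _
    (fun N w => riemann_sum (k ^~ w) a b N)) => //.
by move=> N; apply: adapted_riemann_sum => //; exact: ltW.
Qed.
End difference.
End primitives.

(** * Processes whose increments have the order of Brownian ones in all moments *)

Section good_process.
Context d (T : measurableType d) (R : realType) (P : probability T R).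
Variables (G0 : set_system T) (W : R -> {RV P >-> R}).
Hypothesis G0_sigma : sigma_algebra setT G0.
Variable Tm : R.
Hypothesis Tm0 : 0 < Tm.
Implicit Types (Y Z k : R -> T -> R) (tr : R * R).

Definition time_domain : set R := [set t | 0 <= t <= Tm].

Definition step_increment Y tr (w : T) := Y (tr.1 + tr.2 ^+ 2) w - Y tr.1 w.

(** The last condition is Hoelder continuity of exponent 1/2 in every moment, the regularity of [W]
    itself. For the integrand of a primitive it supplies the extra factor [r] that brings the
    expansion error from [r^2] to [r^3]. *)
Definition good Y : Prop :=
  [/\ moment_bounded P time_domain Y,
      forall t, time_domain t -> adapted P (past G0 W t) (Y t),
      ae_continuous P Y &
      moment_bounded P (step_domain Tm)
        (fun tr w => step_increment Y tr w / tr.2)].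

Lemma step_domain_left tr : step_domain Tm tr -> time_domain tr.1.
Proof.
move=> [t0 r0 trT]; rewrite /time_domain/= t0/= (le_trans _ trT)// lerDl.
by rewrite exprn_ge0// ltW.
Qed.

Lemma step_domain_right tr : step_domain Tm tr ->
  time_domain (tr.1 + tr.2 ^+ 2).
Proof.
by move=> [t0 r0 trT]; rewrite /time_domain/= trT andbT addr_ge0// exprn_ge0// ltW.
Qed.

Lemma moment_bounded_left Y : moment_bounded P time_domain Y ->
  moment_bounded P (step_domain Tm) (fun tr => Y tr.1).
Proof. exact/moment_bounded_reindex/step_domain_left. Qed.

Lemma moment_bounded_right Y : moment_bounded P time_domain Y ->
  moment_bounded P (step_domain Tm) (fun tr => Y (tr.1 + tr.2 ^+ 2)).
Proof.
exact: (@moment_bounded_reindex _ _ _ _ _ _ _ _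
  (fun tr => tr.1 + tr.2 ^+ 2) Y step_domain_right).
Qed.

Lemma moment_bounded_step : moment_bounded P (step_domain Tm) (fun tr _ => tr.2).
Proof.
apply: (@moment_bounded_cst _ _ _ _ _ _ _ (1 + Tm)) => -[t r] [/= t0 r0 tT].
have : r ^+ 2 <= Tm by rewrite (le_trans _ tT)// lerDr.
by rewrite gtr0_norm//; nra.
Qed.

Lemma moment_bounded_eq (I : Type) (D : set I) (F F' : I -> T -> R) :
  moment_bounded P D F -> (forall i w, D i -> F' i w = F i w) ->
  moment_bounded P D F'.
Proof.
move=> mF FF'; apply: (moment_bounded_le mF) => i Di.
  by have -> : F' i = F i by [apply/funext => w; exact: FF']; case: mF => + _; apply.
by apply: aeW => w; rewrite FF'.
Qed.

Lemma ae_continuousD Y Z : ae_continuous P Y -> ae_continuous P Z ->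
  ae_continuous P (fun t w => Y t w + Z t w).
Proof.
by move=> cY cZ; apply: filterS2 cY cZ => w cY cZ t; apply: cvgD; [exact: cY|exact: cZ].
Qed.

Lemma ae_continuousM Y Z : ae_continuous P Y -> ae_continuous P Z ->
  ae_continuous P (fun t w => Y t w * Z t w).
Proof.
by move=> cY cZ; apply: filterS2 cY cZ => w cY cZ t; apply: cvgM; [exact: cY|exact: cZ].
Qed.

Lemma goodD Y Z : good Y -> good Z -> good (fun t w => Y t w + Z t w).
Proof.
move=> [mY aY cY hY] [mZ aZ cZ hZ]; split.
- exact: moment_boundedD.
- by move=> t tT; apply: adaptedD; [exact: aY|exact: aZ].
- exact: ae_continuousD.
- apply: moment_bounded_eq (moment_boundedD hY hZ) _ => tr w _.
  by rewrite /step_increment; ring.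
Qed.

Lemma goodM Y Z : good Y -> good Z -> good (fun t w => Y t w * Z t w).
Proof.
move=> [mY aY cY hY] [mZ aZ cZ hZ]; split.
- exact: moment_boundedM.
- by move=> t tT; apply: adaptedM; [exact: aY|exact: aZ].
- exact: ae_continuousM.
- have h1 := moment_boundedM hY (moment_bounded_right mZ).
  have h2 := moment_boundedM (moment_bounded_left mY) hZ.
  apply: moment_bounded_eq (moment_boundedD h1 h2) _ => tr w _.
  by rewrite /step_increment; ring.
Qed.

Lemma good_static (Z : T -> R) : moment_bounded P [set: unit] (fun=> Z) ->
  (forall t, adapted P (past G0 W t) Z) -> good (fun _ => Z).
Proof.
move=> mZ aZ; split => //.
- exact: (@moment_bounded_reindex _ _ _ _ _ _ _ _ (fun=> tt) (fun=> Z) (fun _ _ => I) mZ).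
- by apply: aeW => w; exact: cst_continuous.
- apply: (@moment_bounded_eq _ _ (fun _ _ => 0)).
    by apply: (@moment_bounded_cst _ _ _ _ _ _ (fun=> 0) 0) => i _; rewrite normr0.
  by move=> tr w _; rewrite /step_increment subrr mul0r.
Qed.

Lemma good_cst (c : R) : good (fun _ _ => c).
Proof.
apply: good_static; last by move=> t; exact: adapted_cst.
by apply: (@moment_bounded_cst _ _ _ _ _ _ (fun=> c) `|c|).
Qed.

Lemma good_lipschitz Y (K : R) :
  (forall t, time_domain t -> measurable_fun setT (Y t)) ->
  (forall t, time_domain t -> adapted P (past G0 W t) (Y t)) ->
  ae_continuous P Y ->
  {ae P, forall w, forall t, time_domain t -> `|Y t w| <= K} ->
  {ae P, forall w, forall s t, 0 <= s -> s <= t -> t <= Tm ->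
     `|Y t w - Y s w| <= K * (t - s)} -> good Y.
Proof.
move=> mY aY cY YK YL; split => //.
- apply: (@moment_bounded_ae_le_cst _ _ _ _ _ _ _ K) => // t tT.
  by apply: filterS YK => w; exact.
- have mr := moment_boundedM moment_bounded_step
    (@moment_bounded_cst _ _ _ P _ (step_domain Tm) (fun=> K) `|K| (fun _ _ => lexx _)).
  apply: (moment_bounded_le mr) => tr D.
    apply: measurable_funM => //; apply: measurable_funB; apply: mY.
      exact: step_domain_right.
    exact: step_domain_left.
  case: D => t0 r0 trT; apply: filterS YL => w YL.
  rewrite normrM normfV (gtr0_norm r0) ler_pdivrMr// normrM (gtr0_norm r0).
  have := YL tr.1 (tr.1 + tr.2 ^+ 2) t0; rewrite lerDl exprn_ge0 ?(ltW r0)//.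
  move=> /(_ isT trT); rewrite addrAC subrr add0r => /le_trans; apply.
  rewrite mulrAC -expr2 mulrC ler_wpM2l// ?exprn_ge0 ?(ltW r0)//.
  exact: ler_norm.
Qed.

(** Increments of a primitive are of order [r^2] in all moments, so after division by [r] a factor
    [r] remains, which is bounded on a finite horizon. *)
Lemma good_primitive Y k :
  (forall t, time_domain t -> measurable_fun setT (Y t)) ->
  moment_bounded P time_domain k ->
  (forall t, time_domain t -> adapted P (past G0 W t) (k t)) ->
  ae_continuous P k -> ae_continuous P Y -> ae_primitive P Y k ->
  moment_bounded P [set: unit] (fun=> Y 0) ->
  (forall t, adapted P (past G0 W t) (Y 0)) -> good Y.
Proof.
move=> mY [mk kC] ak ck cY Yk mY0 aY0.
have mD a b : 0 <= a -> a < b -> b <= Tm -> measurable_fun setT (fun w => Y b w - Y a w).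
  move=> a0 ab bT; apply: measurable_funB; apply: mY.
    by rewrite /time_domain/= bT (le_trans a0)// ltW.
  by rewrite /time_domain/= a0 (le_trans (ltW ab)).
have td a b s : 0 <= a -> b <= Tm -> a <= s <= b -> time_domain s.
  move=> a0 bT /andP[as_ sb]; rewrite /time_domain/= (le_trans a0)//=.
  exact: le_trans sb bT.
split => //.
- have m0 : moment_bounded P time_domain (fun=> Y 0).
    exact: (@moment_bounded_reindex _ _ _ _ _ _ _ _ (fun=> tt) (fun=> Y 0) (fun _ _ => I) mY0).
  have m1 : moment_bounded P time_domain (fun t w => Y t w - Y 0 w).
    split=> [t tT|p].
      apply: measurable_funB; first exact: mY.
      by apply: mY; rewrite /time_domain/= lexx ltW.
    (* At [t = 0] the moment is [0 ^+ p], which equals 1 for [p = 0]; hence the maximum with 1. *)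
    have [C hC] := kC p; exists (Num.max (Tm ^+ p * `|C|) 1) => t /andP[t0 tT].
    move: t0; rewrite le_eqVlt => /predU1P[<-|t0].
      rewrite (eq_integral (fun=> (0 ^+ p)%:E)).
        rewrite integral_cst// [X in (_ * X)%E](_ : _ = 1%E); last exact: probability_setT.
        by rewrite mule1 lee_fin le_max expr0n orbC; case: eqP => _; rewrite ?lexx ?ler01.
      by move=> w _; rewrite subrr normr0.
    apply: (@le_trans _ _ ((t - 0) ^+ p * C)%:E).
      apply: (primitive_moment_le (k := k)) => //.
      + exact: mD.
      + by move=> s s0t; apply: mk; exact: td s0t.
      + by move=> s s0t; apply: hC; exact: td s0t.
    rewrite lee_fin subr0 le_max; apply/orP; left.
    apply: le_trans (_ : t ^+ p * `|C| <= _).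
      by rewrite ler_wpM2l ?exprn_ge0 ?ler_norm// ltW.
    by rewrite ler_wpM2r// lerXn2r ?nnegrE// ltW.
  by apply: moment_bounded_eq (moment_boundedD m0 m1) _ => t w _; rewrite addrC subrK.
- move=> t /andP[]; rewrite le_eqVlt => /predU1P[<- _|t0 tT]; first exact: aY0.
  have aD : adapted P (past G0 W t) (fun w => Y t w - Y 0 w).
    apply: (primitive_adapted (k := k)) => //; first exact: mD.
    move=> s s0t; have sT := td _ _ _ (lexx 0) tT s0t.
    move: s0t => /andP[_ st]; exact: adapted_past_le st (ak _ sT).
  apply: adapted_ae_eq (adaptedD (aY0 t) aD) _ _.
    by apply: mY; rewrite /time_domain/= tT ltW.
  by apply: aeW => w; rewrite addrC subrK.
- have mavg : moment_bounded P (step_domain Tm)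
      (fun tr w => step_increment Y tr w / tr.2 ^+ 2).
    split=> [tr D|p].
      apply: measurable_funM => //; apply: mD; case: D => //.
      by move=> _ r0 _; rewrite ltrDl exprn_gt0.
    have [C hC] := kC p; exists C => tr [t0 r0 trT].
    have r20 : 0 < tr.2 ^+ 2 by rewrite exprn_gt0.
    have rp0 : 0 < (tr.2 ^+ 2) ^+ p by rewrite exprn_gt0.
    have := @primitive_moment_le _ _ _ P Y k tr.1 (tr.1 + tr.2 ^+ 2) t0.
    rewrite ltrDl => /(_ r20 cY ck Yk (mD _ _ t0 _ trT) p C).
    rewrite ltrDl => /(_ r20).
    move=> /(_ (fun s s0t => mk s (td _ _ _ t0 trT s0t))).
    move=> /(_ (fun s s0t => hC s (td _ _ _ t0 trT s0t))).
    rewrite addrAC subrr add0r => h.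
    have mI : measurable_fun setT (fun w => (`|step_increment Y tr w| ^+ p)%:E).
      apply: measurable_normX; apply: mD => //; by rewrite ltrDl.
    rewrite (eq_integral (fun w => (((tr.2 ^+ 2) ^+ p)^-1)%:E *
        (`|step_increment Y tr w| ^+ p)%:E)%E); last first.
      move=> w _; rewrite normrM normfV (gtr0_norm r20) exprMn exprVn mulrC EFinM.
      by rewrite muleC.
    rewrite ge0_integralZl//; last by rewrite lee_fin invr_ge0 ltW.
    rewrite -[X in (_ <= X)%E](_ : (((tr.2 ^+ 2) ^+ p)^-1)%:E * ((tr.2 ^+ 2) ^+ p * C)%:E = C%:E)%E.
      by rewrite lee_pmul2l// lte_fin invr_gt0.
    by rewrite -EFinM mulKf// gt_eqF.
  apply: moment_bounded_eq (moment_boundedM moment_bounded_step mavg) _.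
  move=> tr w [_ r0 _]; field; rewrite gt_eqF//.
Qed.
End good_process.

Section ito_process.
Context d (T : measurableType d) (R : realType) (P : probability T R).
Variables (G0 : set_system T) (W : R -> {RV P >-> R}).
Hypothesis G0_sigma : sigma_algebra setT G0.
Hypothesis G0_measurable : G0 `<=` measurable.
Hypothesis hW : brownian_motion W.
Hypothesis G0W : independent_sigma P G0 (sigma_family [set t : R | 0 <= t] W).
Variable Tm : R.
Hypothesis Tm0 : 0 < Tm.
Implicit Types (Y Z k b sg tau : R -> T -> R) (tr : R * R).
Let N := normalized_increment W.
Let MB := @moment_bounded _ T R P _ (time_domain Tm).
Let MBS := @moment_bounded _ T R P _ (step_domain Tm).
Let AD Y := forall t, time_domain Tm t -> adapted P (past G0 W t) (Y t).

(** Over a step of length [r^2] the noise acts at order [r], the drift and the centred square at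
    order [r^2]; the quotient by [r^3] is what has to stay bounded in all moments for the errors to
    disappear on refinement. *)
Definition ito_remainder Y b sg tau tr (w : T) : R :=
  (step_increment Y tr w - tr.2 ^+ 2 * b tr.1 w - tr.2 * (sg tr.1 w * N tr w)
    - tr.2 ^+ 2 * (tau tr.1 w * (N tr w ^+ 2 - 1))) / tr.2 ^+ 3.

Record ito_expansion Y b sg tau : Prop := ItoExpansion {
  ito_mb : MB Y; ito_mb_drift : MB b; ito_mb_noise : MB sg; ito_mb_sqr : MB tau;
  ito_adapted : AD Y; ito_adapted_noise : AD sg; ito_adapted_sqr : AD tau;
  ito_mb_rem : MBS (ito_remainder Y b sg tau) }.

(* [b] and [sg] are the coefficients of an Ito process; [tau] is the
   coefficient of the centred square of the Brownian increment, which has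
   mean zero and so disappears from expectations. *)
Definition ito Y b sg : Prop := exists tau, ito_expansion Y b sg tau.

Let mbN : MBS N := moment_bounded_increment hW Tm.

Let mbL Y : MB Y -> MBS (fun tr => Y tr.1) := @moment_bounded_left _ _ _ _ Tm Y.

Let mbcst (c : R) : MBS (fun _ _ => c).
Proof. by apply: (@moment_bounded_cst _ _ _ _ _ _ (fun=> c) `|c|). Qed.

Let mbr : MBS (fun tr _ => tr.2) := moment_bounded_step P Tm.

Let mbM2 : MBS (fun tr w => N tr w ^+ 2 - 1).
Proof.
apply: moment_bounded_eq (moment_boundedD (moment_boundedM mbN mbN) (mbcst (-1))) _.
by move=> tr w _; rewrite expr2.
Qed.

Lemma ito_eq Y b sg Y' b' sg' : ito Y b sg ->
  (forall t w, time_domain Tm t -> Y' t w = Y t w) ->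
  (forall t w, time_domain Tm t -> b' t w = b t w) ->
  (forall t w, time_domain Tm t -> sg' t w = sg t w) -> ito Y' b' sg'.
Proof.
move=> [tau [mY mb ms mt aY as_ at_ mr]] EY Eb Es; exists tau; split => //.
- exact: moment_bounded_eq mY EY.
- exact: moment_bounded_eq mb Eb.
- exact: moment_bounded_eq ms Es.
- by move=> t tT; have -> : Y' t = Y t by [apply/funext => w; exact: EY]; exact: aY.
- by move=> t tT; have -> : sg' t = sg t by [apply/funext => w; exact: Es]; exact: as_.
- apply: moment_bounded_eq mr _ => tr w D.
  have D1 := step_domain_left D; have D2 := step_domain_right D.
  by rewrite /ito_remainder /step_increment !EY// Eb// Es.
Qed.

Lemma ito_static (Z : T -> R) : MB (fun=> Z) -> AD (fun=> Z) ->
  ito (fun _ => Z) (fun _ _ => 0) (fun _ _ => 0).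
Proof.
move=> mZ aZ; exists (fun _ _ => 0).
have m0 : MB (fun _ _ => 0).
  by apply: (@moment_bounded_cst _ _ _ _ _ _ (fun=> 0) 0) => t _; rewrite normr0.
have a0 : AD (fun _ _ => 0) by move=> t _; exact: adapted_cst.
split => //; apply: moment_bounded_eq (mbcst 0) _ => tr w _.
by rewrite /ito_remainder /step_increment subrr !mul0r !mulr0 !subr0 mul0r.
Qed.

Lemma itoD Y b sg Y' b' sg' : ito Y b sg -> ito Y' b' sg' ->
  ito (fun t w => Y t w + Y' t w) (fun t w => b t w + b' t w)
    (fun t w => sg t w + sg' t w).
Proof.
move=> [tau [mY mb ms mt aY as_ at_ mr]] [tau' [mY' mb' ms' mt' aY' as' at' mr']].
exists (fun t w => tau t w + tau' t w); split; try exact: moment_boundedD.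
- by move=> t tT; apply: adaptedD; [exact: aY|exact: aY'].
- by move=> t tT; apply: adaptedD; [exact: as_|exact: as'].
- by move=> t tT; apply: adaptedD; [exact: at_|exact: at'].
- apply: moment_bounded_eq (moment_boundedD mr mr') _ => tr w _.
  by rewrite /ito_remainder /step_increment; ring.
Qed.

(** The product of the two noise terms is [r^2 sg sg' N^2]. Its mean part [r^2 sg sg'] is the Ito
    correction in the drift, and the centred part [N^2 - 1] goes to [tau]; everything else beyond
    the product rule is of order [r^3]. *)
Lemma itoM Y b sg Y' b' sg' : ito Y b sg -> ito Y' b' sg' ->
  ito (fun t w => Y t w * Y' t w)
    (fun t w => Y t w * b' t w + b t w * Y' t w + sg t w * sg' t w)
    (fun t w => Y t w * sg' t w + sg t w * Y' t w).
Proof.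
move=> [tau [mY mb ms mt aY as_ at_ mr]] [tau' [mY' mb' ms' mt' aY' as' at' mr']].
exists (fun t w => Y t w * tau' t w + tau t w * Y' t w + sg t w * sg' t w).
have adD (F H : R -> T -> R) : AD F -> AD H -> AD (fun t w => F t w + H t w).
  by move=> aF aH t tT; apply: adaptedD; [exact: aF|exact: aH].
have adM (F H : R -> T -> R) : AD F -> AD H -> AD (fun t w => F t w * H t w).
  by move=> aF aH t tT; apply: adaptedM; [exact: aF|exact: aH].
have mbD (F H : R -> T -> R) : MB F -> MB H -> MB (fun t w => F t w + H t w).
  exact: moment_boundedD.
have mbM (F H : R -> T -> R) : MB F -> MB H -> MB (fun t w => F t w * H t w).
  exact: moment_boundedM.
split; [by auto 6 ..|].
(* Delta Y = r (sg N + r B) with B bounded in every moment *)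
pose B tr w := b tr.1 w + tau tr.1 w * (N tr w ^+ 2 - 1) +
  tr.2 * ito_remainder Y b sg tau tr w.
pose B' tr w := b' tr.1 w + tau' tr.1 w * (N tr w ^+ 2 - 1) +
  tr.2 * ito_remainder Y' b' sg' tau' tr w.
have mB : MBS B.
  apply: moment_boundedD; last exact: moment_boundedM.
  by apply: moment_boundedD (mbL mb) _; exact: moment_boundedM (mbL mt) mbM2.
have mB' : MBS B'.
  apply: moment_boundedD; last exact: moment_boundedM.
  by apply: moment_boundedD (mbL mb') _; exact: moment_boundedM (mbL mt') mbM2.
have m1 := moment_boundedM (mbL mY) mr'.
have m2 := moment_boundedM (mbL mY') mr.
have m3 := moment_boundedM (moment_boundedM (mbL ms) mbN) mB'.
have m4 := moment_boundedM (moment_boundedM (mbL ms') mbN) mB.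
have m5 := moment_boundedM mbr (moment_boundedM mB mB').
apply: moment_bounded_eq (moment_boundedD (moment_boundedD (moment_boundedD
  (moment_boundedD m1 m2) m3) m4) m5) _ => tr w [_ r0 _].
rewrite /B /B' /ito_remainder /step_increment.
have rn0 : tr.2 != 0 by rewrite gt_eqF.
by field.
Qed.

Lemma ito_sum (I : Type) (s : seq I) (F b sg : I -> R -> T -> R) :
  (forall i, ito (F i) (b i) (sg i)) ->
  ito (fun t w => \sum_(i <- s) F i t w) (fun t w => \sum_(i <- s) b i t w)
    (fun t w => \sum_(i <- s) sg i t w).
Proof.
move=> h; elim: s => [|i s IH].
  have m0 : MB (fun _ _ => 0).
    by apply: (@moment_bounded_cst _ _ _ _ _ _ (fun=> 0) 0) => t _; rewrite normr0.
  apply: (ito_eq (ito_static m0 _)); first by move=> t _; exact: adapted_cst.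
  - by move=> t w _; rewrite big_nil.
  - by move=> t w _; rewrite big_nil.
  - by move=> t w _; rewrite big_nil.
by apply: (ito_eq (itoD (h i) IH)) => t w _; rewrite big_cons.
Qed.

(** After division by [r^3] one has to bound the integral of [k s - k t] over a step of length
    [r^2]. Since [k] is [good], its oscillation on the step is of order [r] in all moments, which
    gives [r^2 * r]. *)
Lemma ito_primitive Y k : good G0 W Tm k -> good G0 W Tm Y ->
  ae_primitive P Y k -> ito Y k (fun _ _ => 0).
Proof.
move=> [mk ak ck hk] [mY aY cY hY] Yk; exists (fun _ _ => 0).
have m0 : MB (fun _ _ => 0).
  by apply: (@moment_bounded_cst _ _ _ _ _ _ (fun=> 0) 0) => t _; rewrite normr0.
have a0 : AD (fun _ _ => 0) by move=> t _; exact: adapted_cst.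
split => //; split=> [tr D|p].
  have r0 : 0 < tr.2 by case: D.
  rewrite /ito_remainder; apply: measurable_funM => //.
  have mN : measurable_fun setT (N tr) by case: mbN => h _; exact: h.
  have D1 := step_domain_left D; have D2 := step_domain_right D.
  case: mY => mY _; case: mk => mk _.
  have mYD : measurable_fun setT (step_increment Y tr).
    by apply: measurable_funB; exact: mY.
  apply: measurable_funB; last by apply: measurable_funM => //; apply: measurable_funM => //;
    apply: measurable_funB => //; exact: measurable_funX.
  apply: measurable_funB; last by apply: measurable_funM => //; exact: measurable_funM.
  by apply: measurable_funB => //; apply: measurable_funM => //; exact: mk.
have [C hC] := hk.2 p; exists `|C| => tr D; have [t0 r0 trT] := D.
have D1 := step_domain_left D; have D2 := step_domain_right D.
set t := tr.1 in t0 trT D1 D2 *; set r := tr.2 in r0 trT D2 *.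
have r20 : 0 < r ^+ 2 by rewrite exprn_gt0.
(* subtract the tangent line at t *)
pose Y1 s w := Y s w - s * k t w; pose k1 s w := k s w - k t w.
have cY1 : ae_continuous P Y1.
  apply: filterS cY => w cY s; apply: cvgB; first exact: cY.
  by apply: cvgM; [exact: cvg_id|exact: cvg_cst].
have ck1 : ae_continuous P k1.
  by apply: filterS ck => w ck s; apply: cvgB; [exact: ck|exact: cvg_cst].
have Yk1 : ae_primitive P Y1 k1.
  apply: filterS Yk => w Yk s s0; have dY := Yk s s0.
  have -> : Y1 ^~ w = (Y ^~ w) - (k t w *: (@idfun R)).
    by apply/funext => u; rewrite /Y1 /= mulrC.
  apply: is_derive_eq; rewrite /k1 /GRing.scale/= mulr1 //.
have mY1 : measurable_fun setT (fun w => Y1 (t + r ^+ 2) w - Y1 t w).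
  case: mY => mY _; case: mk => mk _.
  apply: measurable_funB; apply: measurable_funB; try exact: mY.
    by apply: measurable_funM => //; exact: mk.
  by apply: measurable_funM => //; exact: mk.
have mk1 s : t <= s <= t + r ^+ 2 -> measurable_fun setT (k1 s).
  case: mk => mk _ /andP[ts sr]; apply: measurable_funB; apply: mk => //.
  by rewrite /time_domain/= (le_trans t0)//= (le_trans sr).
have hk1 s : t <= s <= t + r ^+ 2 ->
    (\int[P]_w (`|k1 s w| ^+ p)%:E <= (r ^+ p * `|C|)%:E)%E.
  move=> /andP[]; rewrite le_eqVlt => /predU1P[<- _|ts sr].
    rewrite (eq_integral (fun=> (0 ^+ p)%:E)); last first.
      by move=> w _; rewrite /k1 subrr normr0.
    rewrite integral_cst// [X in (_ * X)%E](_ : _ = 1%E); last exact: probability_setT.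
    rewrite mule1 lee_fin expr0n; case: eqP => [p0|_]; last first.
      by rewrite mulr_ge0// exprn_ge0// ltW.
    (* For [p = 0] the left side is [0 ^+ 0 = 1], and [C] dominates it because the zeroth moment
       over any step is 1. *)
    have := hC tr D; rewrite p0 expr0 mul1r.
    rewrite (eq_integral (fun=> 1%E)); last by move=> w _; rewrite expr0.
    rewrite integral_cst// [X in (_ * X)%E](_ : _ = 1%E); last exact: probability_setT.
    by rewrite mule1 lee_fin => /le_trans; apply; exact: ler_norm.
  (* The interval from [t] to [s] is itself an admissible step, of parameter [q <= r]. *)
  pose q := Num.sqrt (s - t).
  have q0 : 0 < q by rewrite sqrtr_gt0 subr_gt0.
  have q2 : q ^+ 2 = s - t by rewrite sqr_sqrtr// subr_ge0 ltW.
  have qr : q <= r.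
    rewrite -(@ler_pXn2r _ 2 isT) ?nnegrE ?(ltW q0) ?(ltW r0)// q2 lerBlDl.
    exact: sr.
  have Dq : step_domain Tm (t, q).
    by split => //=; rewrite q2 addrC subrK (le_trans sr).
  have := hC _ Dq; rewrite /step_increment/= q2 addrC subrK => h.
  have mI : measurable_fun setT (fun w => (`|(k s w - k t w) / q| ^+ p)%:E).
    apply: measurable_normX; apply: measurable_funM => //.
    by apply: (mk1 s); rewrite (ltW ts).
  rewrite (eq_integral (fun w => ((q ^+ p)%:E * (`|(k s w - k t w) / q| ^+ p)%:E)%E)); last first.
    move=> w _; rewrite -EFinM normrM normfV (gtr0_norm q0) exprMn exprVn mulrCA.
    by rewrite divff ?mulr1// gt_eqF// exprn_gt0.
  rewrite ge0_integralZl//; last by rewrite lee_fin exprn_ge0// ltW.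
  apply: (@le_trans _ _ ((q ^+ p)%:E * `|C|%:E)%E).
    rewrite lee_wpmul2l// ?lee_fin ?exprn_ge0 ?(ltW q0)//.
    by rewrite (le_trans h)// lee_fin ler_norm.
  by rewrite -EFinM lee_fin ler_wpM2r// lerXn2r// nnegrE ltW.
have ab : t < t + r ^+ 2 by rewrite ltrDl.
have := primitive_moment_le t0 ab cY1 ck1 Yk1 mY1 mk1 hk1.
rewrite addrAC subrr add0r => h.
have r3 : 0 < r ^+ 3 by rewrite exprn_gt0.
have mI := measurable_normX p mY1.
rewrite (eq_integral (fun w => (((r ^+ 3) ^+ p)^-1)%:E *
    (`|Y1 (t + r ^+ 2) w - Y1 t w| ^+ p)%:E)%E); last first.
  move=> w _; rewrite -EFinM -exprVn -(gtr0_norm r3) -normfV -exprMn -normrM.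
  congr ((`| _ | ^+ p)%:E).
  by rewrite /ito_remainder /step_increment /Y1 -/t -/r; ring.
rewrite ge0_integralZl//; last by rewrite lee_fin invr_ge0 exprn_ge0// ltW.
apply: (@le_trans _ _ (((r ^+ 3) ^+ p)^-1%:E * ((r ^+ 2) ^+ p * (r ^+ p * `|C|))%:E)%E).
  by rewrite lee_wpmul2l// lee_fin invr_ge0 exprn_ge0// ltW.
rewrite -EFinM lee_fin.
have -> : (r ^+ 3) ^+ p = (r ^+ 2) ^+ p * r ^+ p.
  by rewrite -!exprM -exprD; congr (_ ^+ _); lia.
rewrite (mulrA _ (r ^+ p)) mulrA mulVf ?mul1r//.
by rewrite gt_eqF// mulr_gt0 ?exprn_gt0.
Qed.

Lemma ito_brownian (c : R) : good G0 W Tm (fun t => W `|t|) ->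
  ito (fun t w => c * W `|t| w) (fun _ _ => 0) (fun _ _ => c).
Proof.
move=> [mW aW cW _]; exists (fun _ _ => 0).
have mc (e : R) : MB (fun _ _ => e).
  by apply: (@moment_bounded_cst _ _ _ _ _ _ (fun=> e) `|e|).
have ac (e : R) : AD (fun _ _ => e) by move=> t _; exact: adapted_cst.
split => //.
- exact: (moment_boundedM (mc c) mW).
- by move=> t tT; apply: adaptedM; [exact: adapted_cst|exact: aW].
- apply: moment_bounded_eq (mbcst 0) _ => tr w [t0 r0 _].
  have rn0 : tr.2 != 0 by rewrite gt_eqF.
  rewrite /ito_remainder /step_increment /N /normalized_increment.
  rewrite ger0_norm ?addr_ge0 ?exprn_ge0 ?(ltW r0)// ger0_norm//.
  by field.
Qed.

(** At the left end of the step [sg] and [tau] are independent of the increment, while [N] and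
    [N^2 - 1] have mean zero; the drift and the remainder are all that survives. *)
Lemma ito_expectation Y b sg : ito Y b sg -> exists2 C : R, 0 < C &
  forall t r, step_domain Tm (t, r) ->
    `|\int[P]_w Y (t + r ^+ 2) w - \int[P]_w Y t w - r ^+ 2 * \int[P]_w b t w|
      <= C * r ^+ 3.
Proof.
move=> [tau [mY mb ms mt aY as_ at_ mr]].
have [C C0 hC] := moment_bounded_Rintegral mr; exists C => // t r D.
have [/= t0 r0 trT] := D.
have D1 := step_domain_left D; have D2 := step_domain_right D.
have i1 := moment_bounded_integrable mY D1.
have ib := moment_bounded_integrable mb D1.
have is_ := moment_bounded_integrable ms D1.
have it := moment_bounded_integrable mt D1.
have isN := moment_bounded_integrable (moment_boundedM (mbL ms) mbN) D.
have itN := moment_bounded_integrable (moment_boundedM (mbL mt) mbM2) D.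
have ir := moment_bounded_integrable mr D.
have E0 := integral_adapted_increment G0_sigma G0_measurable hW G0W D (as_ _ D1) is_ isN.
have E1 := integral_adapted_increment_sqr G0_sigma G0_measurable hW G0W D (at_ _ D1) it itN.
have rn0 : r != 0 by rewrite gt_eqF.
have -> : \int[P]_w Y (t + r ^+ 2) w =
  \int[P]_w (Y t w + (r ^+ 2 * b t w + (r * (sg t w * N (t, r) w) +
    (r ^+ 2 * (tau t w * (N (t, r) w ^+ 2 - 1)) +
     r ^+ 3 * ito_remainder Y b sg tau (t, r) w)))).
  apply: eq_Rintegral => w _.
  by rewrite /ito_remainder /step_increment/=; field.
have iZ (c : R) (f : T -> R) : P.-integrable setT (EFin \o f) ->
    P.-integrable setT (EFin \o (fun w => c * f w)).
  by move=> h; exact: (integrableZl measurableT c h).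
have iD (f g : T -> R) : P.-integrable setT (EFin \o f) ->
    P.-integrable setT (EFin \o g) -> P.-integrable setT (EFin \o (fun w => f w + g w)).
  by move=> h h'; exact: (integrableD measurableT h h').
have q1 := iZ (r ^+ 2) _ itN; have q2 := iZ (r ^+ 3) _ ir.
have q3 := iD _ _ q1 q2; have q4 := iZ r _ isN; have q5 := iD _ _ q4 q3.
have q6 := iZ (r ^+ 2) _ ib; have q7 := iD _ _ q6 q5.
rewrite (RintegralD measurableT i1 q7) (RintegralD measurableT q6 q5).
rewrite (RintegralD measurableT q4 q3) (RintegralD measurableT q1 q2).
rewrite !RintegralZl// E0 E1 !mulr0 !add0r.
rewrite [X in `|X|](_ : _ = r ^+ 3 * \int[P]_w ito_remainder Y b sg tau (t, r) w); last first.
  by ring.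
rewrite normrM (gtr0_norm (exprn_gt0 3 r0)) mulrC ler_pM2r ?exprn_gt0//.
exact: hC.
Qed.
End ito_process.

(** * The paths of the expansion coefficients *)

Section drift_decomposition.
Context {R : realType}.

(** The forcing term of the linear equation for [x m]: it depends on the levels below [m] only. *)
Definition lower_drift (m : nat) (x : nat -> R) : R :=
  if (m <= 1)%N then 0 else - (3 * x 0%N * comp_sum x m 2) - comp_sum x m 3.

Lemma drift_lowerE m (x : nat -> R) : (0 < m)%N ->
  drift m x = (1 - 3 * x 0%N ^+ 2) * x m + lower_drift m x.
Proof. by case: m => [//|[|m]] _ /=; rewrite /lower_drift/= ?addr0// addrA. Qed.

Section ring_closed_drift.
Context {A B : Type}.
Variable Q : (A -> B -> R) -> Prop.
Hypothesis Qcst : forall c : R, Q (fun _ _ => c).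
Hypothesis QD : forall f g, Q f -> Q g -> Q (fun a b => f a b + g a b).
Hypothesis QM : forall f g, Q f -> Q g -> Q (fun a b => f a b * g a b).

Let Q_eq f g : Q f -> (forall a b, g a b = f a b) -> Q g.
Proof. by move=> Qf gf; have -> : g = f by apply/funext => a; apply/funext. Qed.

Lemma ring_closed_lower_drift (x : nat -> A -> B -> R) m :
  (forall j, (j < m)%N -> Q (x j)) ->
  Q (fun a b => lower_drift m (fun j => x j a b)).
Proof.
move=> Qx; rewrite /lower_drift; case: leqP => [_|m1]; first exact: Qcst.
have h2 := ring_closed_comp_sum Qcst QD QM (leqnn 2)
  (fun j (jm : (0 < j < m)%N) => Qx j (proj2 (andP jm))).
have h3 := ring_closed_comp_sum Qcst QD QM (isT : (2 <= 3)%N)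
  (fun j (jm : (0 < j < m)%N) => Qx j (proj2 (andP jm))).
have h0 := Qx 0%N (ltnW m1).
apply: Q_eq (QD (QM (QM (Qcst (-3)) h0) h2) (QM (Qcst (-1)) h3)) _ => a b.
by rewrite mulN1r !mulNr.
Qed.

Lemma ring_closed_drift (x : nat -> A -> B -> R) m :
  (forall j, (j <= m)%N -> Q (x j)) ->
  Q (fun a b => drift m (fun j => x j a b)).
Proof.
move=> Qx; have h0 := Qx 0%N (leq0n m); have hm := Qx m (leqnn m).
case: m Qx hm => [|m] Qx hm.
  apply: Q_eq (QD h0 (QM (Qcst (-1)) (QM h0 (QM h0 h0)))) _ => a b /=.
  by rewrite mulN1r !exprS expr0 mulr1.
have hl := @ring_closed_lower_drift x m.+1 (fun j jm => Qx j (ltnW jm)).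
apply: Q_eq (QD (QM (QD (Qcst 1) (QM (Qcst (-3)) (QM h0 h0))) hm) hl) _ => a b.
by rewrite drift_lowerE// expr2 mulNr.
Qed.
End ring_closed_drift.

Lemma continuous_drift m (x : nat -> R -> R) :
  (forall j, (j <= m)%N -> continuous (x j)) ->
  continuous (fun s => drift m (fun j => x j s)).
Proof.
move=> cx; apply: (@ring_closed_drift R unit (fun f => continuous (f ^~ tt))
  _ _ _ (fun j s _ => x j s)) => //.
- by move=> c s; exact: cvg_cst.
- by move=> f g cf cg s; apply: cvgD; [exact: cf|exact: cg].
- by move=> f g cf cg s; apply: cvgM; [exact: cf|exact: cg].
Qed.
End drift_decomposition.

Section path_equations.
Context d (T : measurableType d) (R : realType) (P : probability T R).
Variables (n : nat) (W : R -> {RV P >-> R}) (xi : nat -> {RV P >-> R}).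
Variable X : nat -> R -> {RV P >-> R}.
Hypothesis hW : brownian_motion W.
Hypothesis hX : expansion_coefficients n xi W X.

(** The noise enters at level 1 alone. Subtracting [noise_coef m * W] leaves a path that is
    differentiable at positive times, so each equation becomes an ordinary differential equation
    path by path. *)
Definition noise_coef (m : nat) : R := if m == 1%N then Num.sqrt 2 else 0.

(* Composing with the absolute value extends the paths continuously to negative
   times. *)
Record regular_path (w : T) : Prop := RegularPath {
  path_continuous : forall m, (m <= n)%N -> continuous (fun t : R => X m `|t| w);
  path_noise_continuous : continuous (fun t : R => W `|t| w);
  path_initial : forall m, (m <= n)%N -> X m 0 w = xi m w;
  path_derive : forall m (t : R), (m <= n)%N -> 0 < t ->
    is_derive t 1 (fun s : R => X m `|s| w - noise_coef m * W `|s| w)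
      (drift m (fun j => X j t w)) }.

(** Gathers the almost sure hypotheses on one event of full probability; the pathwise arguments that
    follow are deterministic. *)
Lemma ae_regular_path : {ae P, forall w, regular_path w}.
Proof.
have [W0 _ _ Wc] := hW.
have hX' : {ae P, forall w, forall m, (m <= n)%N ->
    {within `[0, +oo[, continuous (fun t => X m t w)} /\
    forall t, 0 <= t -> X m t w = xi m w
        + \int[lebesgue_measure]_(s in `[0, t]) drift m (fun j => X j s w)
        + (if m == 1%N then Num.sqrt 2 * W t w else 0)}.
  apply: ae_foralln => m; have [mn|nm] := boolP (m <= n)%N; last first.
    by apply: aeW.
  have := hX mn.
  by apply: filterS => w h _.
apply: filterS3 W0 Wc hX' => w W0 Wc hXw.
have cX m : (m <= n)%N -> continuous (fun t : R => X m `|t| w).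
  by move=> /hXw[cX _]; exact: (@continuous_normr_comp R (fun t => X m t w)).
have XE m t : (m <= n)%N -> 0 <= t -> X m t w - noise_coef m * W t w = xi m w
    + \int[lebesgue_measure]_(s in `[0, t]) drift m (fun j => X j s w).
  move=> mn t0; have [_ ->//] := hXw _ mn; rewrite /noise_coef.
  by case: ifP => _; rewrite ?mul0r ?subr0 ?addr0// addrK.
split => //.
- exact: (@continuous_normr_comp R (fun t => W t w)).
- move=> m mn; have := XE m 0 mn (lexx 0).
  by rewrite W0 mulr0 subr0 => ->; rewrite set_itv1 Rintegral_set1 addr0.
- move=> m t mn t0.
  have := @integral_eq_is_derive R (fun s => X m s w - noise_coef m * W s w)
    (fun s => drift m (fun j => X j s w)) (xi m w) _ _ t t0.
  move=> h; have {}h : is_derive t 1 (fun s => X m s w - noise_coef m * W s w) (drift m (fun j => X j t w)).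
    apply: h; last by move=> s s0; exact: XE.
    by apply: (@continuous_drift R m (fun j s => X j `|s| w)) => j jm; apply: cX; exact: leq_trans mn.
  apply: is_derive_near h; near=> s.
  have s0 : 0 < s by near: s; exact: lt_nbhsr.
  by rewrite gtr0_norm.
Unshelve. all: by end_near. Qed.

Lemma regular_path_flow w : regular_path w ->
  forall t : R, 0 <= t -> X 0%N t w = flow t (xi 0%N w).
Proof.
move=> [cX _ X0 dX] t t0.
have := @flow_unique R (fun s => X 0%N `|s| w) (cX 0%N (leq0n n)).
rewrite normr0 X0// => /(_ _ t t0); rewrite ger0_norm//; apply => s s0.
have := dX 0%N s (leq0n n) s0; rewrite /noise_coef/= (gtr0_norm s0).
by under eq_fun do rewrite mul0r subr0.
Qed.

(** Variation of constants: the integrating factor removes the linear term, and the derivative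
    contains nothing but the flow, the noise and lower levels. *)
Lemma regular_path_weighted w m (t : R) : regular_path w -> (0 < m <= n)%N ->
  0 < t ->
  is_derive t 1 (fun s : R => weight `|s| (xi 0%N w) *
      (X m `|s| w - noise_coef m * W `|s| w))
    (weight t (xi 0%N w) * ((1 - 3 * flow t (xi 0%N w) ^+ 2) *
       (noise_coef m * W t w) + lower_drift m (fun j => X j t w))).
Proof.
move=> rw /andP[m0 mn] t0.
have dZ := path_derive rw mn t0.
have dP : is_derive t 1 (fun s : R => weight `|s| (xi 0%N w))
    ((3 * flow t (xi 0%N w) ^+ 2 - 1) * weight t (xi 0%N w)).
  apply: is_derive_near (is_derive_weight (xi 0%N w) (ltW t0)); near=> s.
  have s0 : 0 < s by near: s; exact: lt_nbhsr.
  by rewrite gtr0_norm.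
have := is_deriveM dP dZ; rewrite drift_lowerE// (regular_path_flow rw (ltW t0)).
rewrite (gtr0_norm t0) => /is_derive_eq; apply.
by rewrite /GRing.scale/=; ring.
Unshelve. all: by end_near. Qed.
End path_equations.

Section good_coefficients.
Context d (T : measurableType d) (R : realType) (P : probability T R).
Variables (G0 : set_system T) (W : R -> {RV P >-> R}).
Hypothesis G0_sigma : sigma_algebra setT G0.
Hypothesis hW : brownian_motion W.
Variables (n : nat) (xi : nat -> {RV P >-> R}) (X : nat -> R -> {RV P >-> R}).
Hypothesis hX : expansion_coefficients n xi W X.
Hypothesis xiG0 : forall k (B : set R), (k <= n)%N -> measurable B ->
  G0 (xi k @^-1` B).
Hypothesis xi_moments : forall k, (k <= n)%N ->
  moment_bounded P [set: unit] (fun=> (xi k : T -> R)).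
Variables (r K : R).
Hypotheses (r0 : 0 < r) (r1 : r <= 1) (K1 : 1 <= K).
Hypothesis xi0_bounds : {ae P, forall w, r <= `|xi 0%N w| <= K}.
Variable Tm : R.
Hypothesis Tm0 : 0 < Tm.

Let K0 : 0 <= K. Proof. exact: le_trans ler01 K1. Qed.

Lemma adapted_xi k t : (k <= n)%N -> adapted P (past G0 W t) (xi k).
Proof. by move=> kn; apply: adapted_past_init => // B mB; exact: xiG0. Qed.

Lemma good_ae_eq (Y Z : R -> T -> R) : good G0 W Tm Y ->
  (forall t, time_domain Tm t -> measurable_fun setT (Z t)) ->
  {ae P, forall w, forall t, Y t w = Z t w} -> good G0 W Tm Z.
Proof.
move=> [mY aY cY hY] mZ YZ.
have YZt t : {ae P, forall w, Y t w = Z t w} by apply: filterS YZ.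
split.
- apply: (moment_bounded_le mY) => // t tT.
  by apply: filterS (YZt t) => w ->.
- by move=> t tT; apply: adapted_ae_eq (aY t tT) (mZ _ tT) (YZt t).
- by apply: filterS2 cY YZ => w cY YZ; rewrite (_ : Z ^~ w = Y ^~ w)//; apply/funext.
- apply: (moment_bounded_le hY) => tr D.
    apply: measurable_funM => //; apply: measurable_funB; apply: mZ.
      exact: step_domain_right.
    exact: step_domain_left.
  by apply: filterS YZ => w YZ; rewrite /step_increment !YZ.
Qed.

Let good_of_flow (h dh : R -> R -> R) (L : R) :
  (forall t, 0 <= t -> measurable_fun setT (h t)) ->
  (forall t z : R, 0 <= t -> is_derive t 1 (h ^~ z) (dh t z)) ->
  (forall t z, 0 <= t <= Tm -> r <= `|z| <= K -> `|h t z| <= L) ->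
  (forall t z, 0 <= t <= Tm -> r <= `|z| <= K -> `|dh t z| <= L) ->
  good G0 W Tm (fun t w => h `|t| (xi 0%N w)).
Proof.
move=> mh dhP hL dhL; apply: (@good_lipschitz _ _ _ _ _ _ _ _ L).
- by move=> t _; apply: measurableT_comp => //; exact: mh.
- move=> t _; apply: (@adapted_comp _ _ _ _ _ _ (h `|t|)); first exact: mh.
  exact: adapted_xi.
- apply: aeW => w t; apply: (@cvg_comp _ _ _ (fun t : R => `|t|) (h ^~ (xi 0%N w)) _ (nbhs (`|t| : R))).
    exact: norm_continuous.
  exact: (continuous_of_is_derive (dhP _ _ (normr_ge0 t))).
- apply: filterS xi0_bounds => w zrK t /andP[t0 tT].
  by rewrite (ger0_norm t0) hL// t0.
- apply: filterS xi0_bounds => w zrK s t s0; rewrite le_eqVlt => /predU1P[<- _|st tT].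
    by rewrite !subrr normr0 mulr0.
  rewrite (ger0_norm s0) (ger0_norm (le_trans s0 (ltW st))).
  have [||c] := @MVT _ (h ^~ (xi 0%N w)) (dh ^~ (xi 0%N w)) s t st.
    by move=> u; rewrite in_itv/= => /andP[su _]; apply: dhP; exact: le_trans (ltW su).
    apply: continuous_in_subspaceT => u; rewrite inE/= in_itv/= => /andP[su _].
    by apply: continuous_of_is_derive (dhP _ _ (le_trans s0 su)).
  rewrite in_itv/= => /andP[sc ct] ->.
  rewrite normrM (gtr0_norm (_ : 0 < t - s)) ?subr_gt0// ler_wpM2r ?subr_ge0 ?(ltW st)//.
  by rewrite dhL// (le_trans s0 (ltW sc)) (le_trans (ltW ct)).
Qed.

Lemma good_flow : good G0 W Tm (fun t w => flow `|t| (xi 0%N w)).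
Proof.
apply: (@good_of_flow flow (fun t z => flow t z - flow t z ^+ 3) (K + K ^+ 3)).
- exact: measurable_flow.
- exact: is_derive_flow.
- move=> t z /andP[t0 _] zrK; rewrite (le_trans (flow_le r0 K1 t0 zrK))// lerDl.
  by rewrite exprn_ge0.
- move=> t z /andP[t0 _] zrK; rewrite (le_trans (ler_normB _ _))// lerD//.
    exact: (flow_le r0).
  rewrite normrX lerXn2r ?nnegrE//; exact: (flow_le r0).
Qed.

Let E2 : R := expR (2 * Tm).

Let weight_le t z : 0 <= t <= Tm -> r <= `|z| <= K -> `|weight t z| <= E2 * K ^+ 3.
Proof.
move=> /andP[t0 tT] zrK; rewrite ger0_norm ?(ltW (weight_gt0 z t0))//.
have /andP[_ h] := weight_bounds r0 r1 K1 t0 zrK.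
by rewrite (le_trans h)// ler_wpM2r ?exprn_ge0// ler_expR ler_pM2l.
Qed.

Let weightV_le t z : 0 <= t <= Tm -> r <= `|z| <= K ->
  `|(weight t z)^-1| <= (r ^+ 3)^-1.
Proof.
move=> /andP[t0 tT] zrK; have w0 := weight_gt0 z t0.
rewrite normfV ger0_norm ?(ltW w0)// lef_pV2 ?posrE ?exprn_gt0//.
have /andP[h _] := weight_bounds r0 r1 K1 t0 zrK.
apply: le_trans h; rewrite ler_peMl ?exprn_ge0 ?(ltW r0)//.
by rewrite -[leLHS]expR0 ler_expR mulr_ge0.
Qed.

Let dw_le t z : 0 <= t <= Tm -> r <= `|z| <= K ->
  `|3 * flow t z ^+ 2 - 1| <= 3 * K ^+ 2 + 1.
Proof.
move=> /andP[t0 tT] zrK; rewrite (le_trans (ler_normB _ _))// normr1 lerD//.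
rewrite normrM normrX ger0_norm// ler_pM2l// lerXn2r ?nnegrE//; exact: (flow_le r0).
Qed.

Let dw_bound_ge1 : 1 <= 3 * K ^+ 2 + 1.
Proof. by rewrite lerDr mulr_ge0// exprn_ge0. Qed.

Lemma good_weight : good G0 W Tm (fun t w => weight `|t| (xi 0%N w)).
Proof.
apply: (@good_of_flow weight (fun t z => (3 * flow t z ^+ 2 - 1) * weight t z)
  ((3 * K ^+ 2 + 1) * (E2 * K ^+ 3))).
- by move=> t _; exact: measurable_weight.
- exact: is_derive_weight.
- move=> t z tT zrK; rewrite (le_trans (weight_le tT zrK))// ler_peMl//.
  by rewrite mulr_ge0 ?expR_ge0// exprn_ge0.
- move=> t z tT zrK; rewrite normrM ler_pM//; [exact: dw_le|exact: weight_le].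
Qed.

Lemma good_weightV : good G0 W Tm (fun t w => (weight `|t| (xi 0%N w))^-1).
Proof.
apply: (@good_of_flow (fun t z => (weight t z)^-1)
  (fun t z => - (3 * flow t z ^+ 2 - 1) / weight t z)
  ((3 * K ^+ 2 + 1) * (r ^+ 3)^-1)).
- move=> t t0; apply: continuous_measurable_fun => z; apply: cvgV.
    by rewrite gt_eqF// weight_gt0.
  apply: cvgM; first exact: cvg_cst.
  apply: (@continuous_comp _ _ _ (flow_den t) (fun x => x ^+ 3)).
    exact: continuous_flow_den.
  exact: exprn_continuous.
- move=> t z t0; have wn0 : weight t z != 0 by rewrite gt_eqF// weight_gt0.
  have := @is_deriveV _ (weight ^~ z) t _ 1 wn0 (is_derive_weight z t0).
  move=> /is_derive_eq; apply.
  by rewrite /GRing.scale/=; field.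
- move=> t z tT zrK; rewrite (le_trans (weightV_le tT zrK))// ler_peMl//.
  by rewrite invr_ge0 exprn_ge0// ltW.
- move=> t z tT zrK; rewrite normrM normrN ler_pM//; [exact: dw_le|exact: weightV_le].
Qed.

Lemma good_brownian : good G0 W Tm (fun t => W `|t|).
Proof.
have [W0 _ _ Wc] := hW.
have mN := moment_bounded_increment hW Tm.
split.
(* [W t] is [sqrt t] times the normalized increment over the step starting at 0, so that its moments
   reduce to the uniform Gaussian bound. *)
- pose F (t : R) w := Num.sqrt t * normalized_increment W (0, Num.sqrt t) w.
  have mF : moment_bounded P (time_domain Tm) F.
    apply: moment_boundedM.
      apply: (@moment_bounded_cst _ _ _ _ _ _ _ (Num.sqrt Tm)) => t /andP[t0 tT].
      by rewrite ger0_norm// ler_wsqrtr.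
    split=> [t _|p]; first by apply: measurable_funM => //; exact: measurable_funB.
    (* At [t = 0] there is no admissible step. The quotient by 0 is 0 by convention, and the zeroth
       moment is then 1. *)
    have [C hC] := mN.2 p; exists (Num.max C 1) => t /andP[].
    rewrite le_eqVlt => /predU1P[<- _|t0 tT].
      rewrite (eq_integral (fun=> (0 ^+ p)%:E)); last first.
        by move=> w _; rewrite /normalized_increment/= sqrtr0 invr0 mulr0 normr0.
      rewrite integral_cst// [X in (_ * X)%E](_ : _ = 1%E); last exact: probability_setT.
      by rewrite mule1 lee_fin le_max expr0n orbC; case: eqP => _; rewrite ?lexx ?ler01.
    have D : step_domain Tm (0, Num.sqrt t).
      by split => //=; rewrite ?sqrtr_gt0// add0r sqr_sqrtr// ltW.
    by rewrite (le_trans (hC _ D))// lee_fin le_max lexx.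
  apply: (moment_bounded_le mF) => // t /andP[t0 _].
  apply: filterS W0 => w W0; rewrite (ger0_norm t0).
  rewrite /F /normalized_increment/= add0r sqr_sqrtr// W0 subr0.
  move: t0; rewrite le_eqVlt => /predU1P[<-|t0]; first by rewrite W0 normr0.
  by rewrite mulrC divfK// gt_eqF// sqrtr_gt0.
- move=> t /andP[t0 _]; rewrite ger0_norm//; exact: adapted_past_W.
- by apply: filterS Wc => w Wc; exact: (@continuous_normr_comp R (fun t => W t w)).
- apply: moment_bounded_eq mN _ => tr w [t0 tr0 _].
  rewrite /step_increment /normalized_increment ger0_norm ?addr_ge0 ?exprn_ge0 ?(ltW tr0)//.
  by rewrite ger0_norm.
Qed.

(** Strong induction along the triangular system: by variation of constants, [X m] is the inverse
    weight times a primitive, plus a multiple of [W]. All ingredients are [good] and the class is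
    closed under products. *)
Lemma good_X m : (m <= n)%N -> good G0 W Tm (fun t => X m `|t|).
Proof.
have arp := ae_regular_path hW hX.
have gD := @goodD _ _ _ P G0 W Tm.
have gM := @goodM _ _ _ P G0 W Tm.
have gC := @good_cst _ _ _ P G0 W Tm.
elim/ltn_ind: m => -[|m] IH mn.
  apply: (good_ae_eq good_flow) => //.
  by apply: filterS arp => w rw t; rewrite (regular_path_flow rw).
set c := noise_coef R m.+1.
have glow : good G0 W Tm (fun t w => lower_drift m.+1 (fun j => X j `|t| w)).
  apply: (@ring_closed_lower_drift R R T (good G0 W Tm) gC gD gM (fun j t w => X j `|t| w)) => j jm.
  by apply: IH => //; rewrite (leq_trans _ mn)// ltnW.
have gx2 : good G0 W Tm (fun t w => 1 + (-3) * (flow `|t| (xi 0%N w) * flow `|t| (xi 0%N w))).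
  by apply: gD (gC 1) (gM _ _ (gC (-3)) (gM _ _ good_flow good_flow)).
have gk := gM _ _ good_weight (gD _ _ (gM _ _ gx2 (gM _ _ (gC c) good_brownian)) glow).
set k := (X in good _ _ _ X) in gk.
pose I (t : R) w := weight `|t| (xi 0%N w) * (X m.+1 `|t| w - c * W `|t| w).
have mw t : measurable_fun setT (fun w => weight `|t| (xi 0%N w)).
  by apply: measurableT_comp => //; exact: measurable_weight.
have mI t : measurable_fun setT (I t).
  by apply: measurable_funM => //; apply: measurable_funB => //; exact: measurable_funM.
have I0 : {ae P, forall w, I 0 w = xi m.+1 w}.
  have [W0 _ _ _] := hW.
  apply: filterS2 W0 arp => w W0 rw.
  by rewrite /I normr0 weight0 mul1r W0 mulr0 subr0 (path_initial rw).
have [mk ak ck _] := gk.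
have gI : good G0 W Tm I.
  apply: (@good_primitive _ _ _ _ _ _ _ _ I k) => //.
  - apply: filterS arp => w rw t; apply: cvgM; first exact: continuous_weight_normr.
    apply: cvgB; first exact: (path_continuous rw mn).
    by apply: cvgM; [exact: cvg_cst|exact: (path_noise_continuous rw)].
  - apply: filterS arp => w rw t t0.
    have := regular_path_weighted rw (mn : (0 < m.+1 <= n)%N) t0.
    move=> /is_derive_eq; apply; rewrite /k (gtr0_norm t0).
    by congr (_ * (_ * _ + _)); ring.
  - apply: (moment_bounded_le (xi_moments mn)) => // _ _.
    by apply: filterS I0 => w ->.
  - move=> t; have h := @adapted_xi m.+1 t mn.
    apply: (@adapted_ae_eq _ _ _ _ _ (xi m.+1) (I 0)) => //.
    by apply: filterS I0 => w ->.
apply: (good_ae_eq (gD _ _ (gM _ _ good_weightV gI) (gM _ _ (gC c) good_brownian))) => //.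
apply: aeW => w t; rewrite /I mulKf ?subrK//.
by rewrite gt_eqF// weight_gt0.
Qed.
End good_coefficients.

(** A time integration carried out on a uniform grid. With [n.+1] steps of length [h = r^2], the
    local errors [C r^3] add up to [C Tm r], which vanishes as the grid is refined. *)
Lemma discrete_growth_bound (R : realType) (D B : R -> R) (Tm A a C : R) :
  0 < Tm -> 0 < a -> 0 <= A -> 0 <= C ->
  (forall s r, step_domain Tm (s, r) ->
    `|D (s + r ^+ 2) - D s - r ^+ 2 * B s| <= C * r ^+ 3) ->
  (forall s, 0 <= s <= Tm -> `|B s| <= A * expR (a * s)) ->
  `|D Tm| <= `|D 0| + A / a * expR (a * Tm).
Proof.
move=> Tm0 a0 A0 C0 hD hB.
(* [E] is the antiderivative of the bound on [B]. The inequality [expR x >= 1 + x] makes its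
   increment over a step at least [h] times the bound at the left end, so the discrete sum
   telescopes. *)
pose E s := A / a * expR (a * s).
suff Hn n : `|D Tm| <= `|D 0| + E Tm + C * Tm * Num.sqrt (Tm / n.+1%:R).
  apply/ler_addgt0Pr => e e0.
  have [n hn] : exists n, C * Tm * Num.sqrt (Tm / n.+1%:R) <= e.
    pose q := e / (C * Tm + 1).
    have CT0 : 0 <= C * Tm by rewrite mulr_ge0// ltW.
    have CT1 : 0 < C * Tm + 1 by rewrite ltr_wpDl.
    have q0 : 0 < q by rewrite divr_gt0.
    have [n] : exists n : nat, Tm / q ^+ 2 < n%:R.
      by exists (Num.bound (Tm / q ^+ 2)); rewrite archi_boundP// divr_ge0 ?sqr_ge0// ltW.
    rewrite ltr_pdivrMr ?exprn_gt0// => hn; exists n.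
    have : Num.sqrt (Tm / n.+1%:R) <= q.
      rewrite -[leRHS](ger0_norm (ltW q0)) -sqrtr_sqr ler_wsqrtr//.
      rewrite ler_pdivrMr ?ltr0n// mulrC ltW// (lt_le_trans hn)//.
      by rewrite ler_wpM2r ?sqr_ge0// ler_nat.
    move=> /(ler_wpM2l CT0) /le_trans; apply.
    by rewrite /q mulrCA ler_piMr ?(ltW e0)// ler_pdivrMr// mul1r lerDl.
  by rewrite (le_trans (Hn n))// lerD2l.
pose h := Tm / n.+1%:R; have h0 : 0 < h by rewrite divr_gt0.
pose r := Num.sqrt h; have r0 : 0 < r by rewrite sqrtr_gt0.
have r2 : r ^+ 2 = h by rewrite sqr_sqrtr// ltW.
have Nh : n.+1%:R * h = Tm by rewrite /h mulrC divfK// gt_eqF.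
have step k : (k <= n.+1)%N ->
    `|D (k%:R * h)| <= `|D 0| + E (k%:R * h) + k%:R * h * (C * r).
  elim: k => [_|k IH kn].
    by rewrite !mul0r addr0 lerDl /E mulr_ge0 ?expR_ge0// divr_ge0// ltW.
  have kh0 : 0 <= k%:R * h by rewrite mulr_ge0// ltW.
  have kh : k%:R * h + h <= Tm.
    by rewrite -Nh -{2}[h]mul1r -mulrDl ler_pM2r// natr1 ler_nat.
  have -> : k.+1%:R * h = k%:R * h + h by rewrite -natr1 mulrDl mul1r.
  have Dk : step_domain Tm (k%:R * h, r) by split => //=; rewrite r2.
  have := hD _ _ Dk; rewrite r2 => hD1.
  have hB1 : `|B (k%:R * h)| <= A * expR (a * (k%:R * h)).
    by apply: hB; rewrite kh0 (le_trans _ kh)// lerDl ltW.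
  have {}IH := IH (ltnW kn).
  set s := k%:R * h in kh0 kh Dk hD1 hB1 IH *.
  have hE : h * (A * expR (a * s)) <= E (s + h) - E s.
    rewrite /E; have -> : a * (s + h) = a * s + a * h by rewrite mulrDr.
    rewrite expRD -subr_ge0.
    have -> : A / a * (expR (a * s) * expR (a * h)) - A / a * expR (a * s) -
        h * (A * expR (a * s)) = A / a * expR (a * s) * (expR (a * h) - 1 - a * h).
      by field; rewrite gt_eqF.
    rewrite !mulr_ge0 ?expR_ge0 ?invr_ge0 ?(ltW a0)//.
    have := expR_ge1Dx (a * h); lra.
  have r3 : C * r ^+ 3 = h * (C * r) by rewrite exprSr r2; ring.
  have -> : D (s + h) = D s + h * B s + (D (s + h) - D s - h * B s) by ring.
  rewrite (le_trans (ler_normD _ _))//.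
  have : `|D s + h * B s| <= `|D s| + h * (A * expR (a * s)).
    by rewrite (le_trans (ler_normD _ _))// lerD2l normrM (gtr0_norm h0) ler_pM2l.
  rewrite r3 in hD1; rewrite mulrDl; lra.
have := step n.+1 (leqnn _); rewrite Nh => /le_trans; apply.
by rewrite lerD2l mulrA [Tm * C]mulrC.
Qed.

(** * Ito's formula for powers of polynomial-valued processes *)

Section ito_poly.
Context d (T : measurableType d) (R : realType) (P : probability T R).
Variables (G0 : set_system T) (W : R -> {RV P >-> R}).
Hypothesis G0_sigma : sigma_algebra setT G0.
Hypothesis hW : brownian_motion W.
Variable Tm : R.
Hypothesis Tm0 : 0 < Tm.
Variable n : nat.

(** Ito calculus for power series truncated at degree [n]: the coefficients of a product up to
    degree [n] involve coefficients of the factors up to degree [n] only. *)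
Definition ito_poly (p b s : R -> T -> {poly R}) : Prop := forall k, (k <= n)%N ->
  ito G0 W Tm (fun t w => (p t w)`_k) (fun t w => (b t w)`_k)
    (fun t w => (s t w)`_k).

Lemma ito_polyM p b s p' b' s' : ito_poly p b s -> ito_poly p' b' s' ->
  ito_poly (fun t w => p t w * p' t w)
    (fun t w => p t w * b' t w + b t w * p' t w + s t w * s' t w)
    (fun t w => p t w * s' t w + s t w * p' t w).
Proof.
move=> h h' k kn.
have hj (j : 'I_k.+1) : (j <= n)%N by rewrite (leq_trans _ kn)// -ltnS.
have hkj (j : 'I_k.+1) : (k - j <= n)%N by rewrite (leq_trans (leq_subr _ _)).
have := ito_sum (index_enum 'I_k.+1)
  (fun j : 'I_k.+1 => itoM hW (h _ (hj j)) (h' _ (hkj j))).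
move=> /ito_eq; apply => t w _.
- by rewrite coefM.
- by rewrite !coefD !coefM -!big_split.
- by rewrite coefD !coefM -big_split.
Qed.

(** Induction from the product rule. ['C(i, 2)] is half of [i (i - 1)], and it vanishes for [i < 2],
    where the exponent [i - 2] is truncated. *)
Lemma ito_polyX p b s i : ito_poly p b s ->
  ito_poly (fun t w => p t w ^+ i)
    (fun t w => i%:R *: (p t w ^+ i.-1 * b t w) +
       'C(i, 2)%:R *: (p t w ^+ (i - 2) * s t w ^+ 2))
    (fun t w => i%:R *: (p t w ^+ i.-1 * s t w)).
Proof.
move=> h; elim: i => [|i IH] k kn.
  have m1 : moment_bounded P (time_domain Tm) (fun _ _ => (k == 0%N)%:R : R).
    by apply: (@moment_bounded_cst _ _ _ _ _ _ (fun=> (k == 0%N)%:R) `|(k == 0%N)%:R|).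
  apply: (ito_eq (ito_static m1 _)); first by move=> t _; exact: adapted_cst.
  - by move=> t w _; rewrite expr0 coef1.
  - by move=> t w _; rewrite bin0n !scale0r addr0 coef0.
  - by move=> t w _; rewrite scale0r coef0.
have := ito_polyM h IH kn; move=> /ito_eq; apply => t w _.
- by rewrite exprS.
- congr ((polyseq _)`_k); set q := p t w; set u := b t w; set v := s t w.
  case: i {IH} => [|[|i]].
  + rewrite (_ : 'C(1, 2) = 0%N)// (_ : 'C(0, 2) = 0%N)// !scale0r scale1r !expr0.
    by ring.
  + rewrite (_ : 'C(2, 2) = 1%N)// (_ : 'C(1, 2) = 0%N)// !scale0r !scale1r.
    by rewrite -mul_polyC/= polyC_natr; ring.
  + rewrite binS bin1 natrD (_ : i.+3%:R = i.+2%:R + 1 :> R); last by rewrite natr1.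
    rewrite !subSS !subn0 /= -!mul_polyC; set e := i.+2%:R; set f := 'C(_, _)%:R.
    by rewrite !polyCD !exprS; ring.
- congr ((polyseq _)`_k); case: i {IH} => [|i] /=.
    by rewrite !scale0r scale1r !expr0; ring.
  rewrite (_ : i.+2%:R = i.+1%:R + 1 :> R); last by rewrite natr1.
  by rewrite -!mul_polyC polyCD exprS; ring.
Qed.
End ito_poly.

(** * Exponential convergence against test functions of the initial point *)

Section conditional_convergence.
Context d (T : measurableType d) (R : realType) (P : probability T R).
Variables (G0 : set_system T) (W : R -> {RV P >-> R}).
Hypothesis G0_sigma : sigma_algebra setT G0.
Hypothesis G0_measurable : G0 `<=` measurable.
Hypothesis hW : brownian_motion W.
Hypothesis G0W : independent_sigma P G0 (sigma_family [set t : R | 0 <= t] W).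
Variables (n : nat) (xi : nat -> {RV P >-> R}) (X : nat -> R -> {RV P >-> R}).
Hypothesis hX : expansion_coefficients n xi W X.
Hypothesis xiG0 : forall k (B : set R), (k <= n)%N -> measurable B ->
  G0 (xi k @^-1` B).
Hypothesis xi_moments : forall k, (k <= n)%N ->
  moment_bounded P [set: unit] (fun=> (xi k : T -> R)).
Variables (r K : R).
Hypotheses (r0 : 0 < r) (r1 : r <= 1) (K1 : 1 <= K).
Hypothesis xi0_bounds : {ae P, forall w, r <= `|xi 0%N w| <= K}.

Let K0 : 0 <= K. Proof. exact: le_trans ler01 K1. Qed.
Let z0 := xi 0%N.

Definition path_poly (t : R) (w : T) : {poly R} :=
  series_poly n (fun j => X j `|t| w).

(** This is [f (x + p) - f x] for [f u = u - u^3]: as a formal series, the fluctuation [p] around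
    the flow obeys the original equation. *)
Definition path_poly_drift (t : R) (w : T) : {poly R} :=
  let x := flow `|t| (z0 w) in
  (1 - 3 * x ^+ 2) *: path_poly t w - (3 * x) *: path_poly t w ^+ 2
    - path_poly t w ^+ 3.

Definition path_coef (m i : nat) (t : R) (w : T) : R := (path_poly t w ^+ i)`_m.

Section fixed_horizon.
Variable Tm : R.
Hypothesis Tm0 : 0 < Tm.

Let gX m (mn : (m <= n)%N) :=
  good_X G0_sigma hW hX xiG0 xi_moments r0 r1 K1 xi0_bounds Tm0 mn.
Let gF := good_flow W xiG0 r0 K1 xi0_bounds Tm.
Let gWt := good_weight W xiG0 r0 r1 K1 xi0_bounds Tm.
Let gW := good_brownian G0_sigma hW Tm.
Let gD := @goodD _ _ _ P G0 W Tm.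
Let gM := @goodM _ _ _ P G0 W Tm.
Let gC := @good_cst _ _ _ P G0 W Tm.

Lemma ito_path_poly : ito_poly G0 W Tm n path_poly path_poly_drift
  (fun _ _ => Num.sqrt 2 *: 'X).
Proof.
move=> [|k] kn.
  have m1 : moment_bounded P (time_domain Tm) (fun _ _ => 0 : R).
    by apply: (@moment_bounded_cst _ _ _ _ _ _ (fun=> 0) 0) => ? _; rewrite normr0.
  have c0 t w : (path_poly t w)`_0 = 0 by rewrite /path_poly coef_series_poly.
  apply: (ito_eq (ito_static m1 _)) => [t _|t w _|t w _|t w _].
  - exact: adapted_cst.
  - exact: c0.
  - by rewrite /path_poly_drift !coefB !coefZ !coef_exp_lt ?c0// !mulr0 !subr0.
  - by rewrite coefZ coefX mulr0.
(* At level 0 the flow is used in place of [X 0], as in [path_poly_drift]; the two agree almost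
   surely. *)
pose xp (j : nat) (t : R) (w : T) : R := if j == 0%N then flow `|t| (z0 w) else X j `|t| w.
have gxp j : (j <= n)%N -> good G0 W Tm (xp j).
  by rewrite /xp; case: j => [_|j jn]; [exact: gF|exact: gX].
pose dk t w := drift k.+1 (fun j => xp j t w).
have gdk : good G0 W Tm dk.
  apply: (@ring_closed_drift R R T (good G0 W Tm) gC gD gM xp k.+1) => j jk.
  by apply: gxp; exact: leq_trans kn.
set c := noise_coef R k.+1.
pose Z (t : R) w := X k.+1 `|t| w + (- c) * W `|t| w.
have gZ : good G0 W Tm Z.
  exact: (gD (gX kn) (gM (gC (- c)) gW)).
have pZ : ae_primitive P Z dk.
  apply: filterS (ae_regular_path hW hX) => w rw t t0.
  have := path_derive rw kn t0.
  have -> : (fun s : R => X k.+1 `|s| w - noise_coef R k.+1 * W `|s| w) = Z ^~ w.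
    by apply/funext => s; rewrite /Z mulNr.
  move=> /is_derive_eq; apply; rewrite /dk; congr drift.
  apply/funext => -[|j]; rewrite /xp/= (gtr0_norm t0)//.
  exact: regular_path_flow rw _ (ltW t0).
have := itoD (ito_primitive hW Tm0 gdk gZ pZ) (ito_brownian c gW).
move=> /ito_eq; apply => t w _.
- by rewrite /path_poly coef_series_poly// /Z mulNr subrK.
- rewrite addr0 /dk (@drift_polyE _ _ n)//=.
  have -> : series_poly n (fun j => xp j t w) = path_poly t w.
    by apply: eq_poly => -[].
  by rewrite /path_poly_drift !coefB !coefZ /xp.
- by rewrite add0r coefZ coefX /c /noise_coef; case: ifP; rewrite ?mulr1 ?mulr0.
Qed.

Lemma moment_bounded_path_coef m i : (m <= n)%N ->
  moment_bounded P (time_domain Tm) (path_coef m i).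
Proof.
by move=> mn; case: (ito_polyX hW i ito_path_poly mn) => tau [].
Qed.

End fixed_horizon.

(* Test functions of the initial point, supported where [xi 0] takes its values
   with a given sign [e]. *)
Definition test_function (e : R) (g : R -> R) : Prop :=
  [/\ measurable_fun setT g, exists M, forall z, `|g z| <= M &
    forall z, g z != 0 -> r <= `|z| <= K /\ 0 < e * z].

Let L1 (g : R -> R) : R := \int[P]_w `|g (z0 w)|.

Lemma test_functionM e g (h : R -> R) L : test_function e g ->
  measurable_fun setT h -> (forall z, r <= `|z| <= K -> `|h z| <= L) ->
  test_function e (fun z => g z * h z).
Proof.
move=> [mg [M gM] gs] mh hL; split; first exact: measurable_funM.
- exists (M * `|L|) => z; have [->|gz] := eqVneq (g z) 0.
    by rewrite mul0r normr0 mulr_ge0// (le_trans _ (gM 0)).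
  rewrite normrM ler_pM// (le_trans (hL _ _)) ?ler_norm//.
  by have [] := gs _ gz.
- by move=> z; rewrite mulf_eq0 negb_or => /andP[/gs].
Qed.

Lemma moment_bounded_test e g : test_function e g ->
  moment_bounded P [set: unit] (fun=> g \o z0).
Proof.
move=> [mg [M gM] _]; apply: (@moment_bounded_ae_le_cst _ _ _ _ _ _ _ M).
  by move=> _ _; exact: measurableT_comp.
by move=> _ _; apply: aeW => w /=.
Qed.

Lemma integrable_test e g : test_function e g ->
  P.-integrable setT (EFin \o (fun w => g (z0 w))).
Proof.
by move=> tg; exact: (moment_bounded_integrable (moment_bounded_test tg) (I : [set: unit] tt)).
Qed.

Lemma L1_ge0 g : 0 <= L1 g.
Proof. by apply: Rintegral_ge0 => w _. Qed.

Lemma L1M_le e g (h : R -> R) L : test_function e g ->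
  measurable_fun setT h -> (forall z, r <= `|z| <= K -> 0 < e * z -> `|h z| <= L) ->
  L1 (fun z => g z * h z) <= L * L1 g.
Proof.
move=> tg mh hL; have [mg [M gM] gs] := tg.
have ig : P.-integrable setT (EFin \o (fun w => `|g (z0 w)|)).
  exact: (integrable_norm (integrable_test tg)).
have gh z : `|g z * h z| <= L * `|g z|.
  have [->|gz] := eqVneq (g z) 0; first by rewrite mul0r normr0 mulr0.
  have [h1 h2] := gs _ gz.
  by rewrite normrM mulrC ler_wpM2r// hL.
have iLg := integrableZl measurableT L ig.
rewrite /L1 -RintegralZl//; apply: le_Rintegral => //.
apply: (le_integrable measurableT _ _ iLg).
- apply/measurable_EFinP; apply: measurableT_comp => //.
  by apply: measurable_funM; apply: measurableT_comp.
- move=> w _; rewrite /= lee_fin normr_id (le_trans (gh _))//.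
  by rewrite normrM normr_id ler_wpM2r// ler_norm.
Qed.

Lemma norm_integral_test_le e g (h : R -> R) L : test_function e g ->
  measurable_fun setT h -> (forall z, r <= `|z| <= K -> 0 < e * z -> `|h z| <= L) ->
  test_function e (fun z => g z * h z) ->
  `|\int[P]_w (g (z0 w) * h (z0 w))| <= L * L1 g.
Proof.
move=> tg mh hL tgh.
by rewrite (le_trans (le_normr_Rintegral measurableT (integrable_test tgh)))//;
  exact: (L1M_le tg).
Qed.

Lemma integrable_path_coef e g m i t c : (m <= n)%N -> 0 <= t ->
  test_function e g ->
  P.-integrable setT (EFin \o (fun w => g (z0 w) * (path_coef m i t w - c))).
Proof.
move=> mn t0 tg.
have Tm0 : 0 < t + 1 by rewrite ltr_wpDl ?ltr01.
have tT : time_domain (t + 1) t by rewrite /time_domain/= t0 lerDl ler01.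
have m1 : moment_bounded P (time_domain (t + 1)) (fun=> g \o z0).
  exact: (@moment_bounded_reindex _ _ _ _ _ _ _ _ (fun=> tt) _ (fun _ _ => I) (moment_bounded_test tg)).
have m2 : moment_bounded P (time_domain (t + 1)) (fun _ _ => - c).
  by apply: (@moment_bounded_cst _ _ _ _ _ _ (fun=> - c) `|c|) => _ _; rewrite normrN.
exact: (moment_bounded_integrable (moment_boundedM m1
  (moment_boundedD (moment_bounded_path_coef Tm0 i mn) m2)) tT).
Qed.

Section sign.
Variable e : R.
Hypothesis e1 : e ^+ 2 = 1.

(** The parameter is the opposite of the sign: [c_], with parameter -1, belongs to the equilibrium
    [e = 1], and [cbar_] to [e = -1]. *)
Let cc : nat -> nat -> R := wcoef (- e).

Hypothesis initial_bound : forall m i, (1 <= m <= n)%N -> (1 <= i <= m)%N ->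
  exists2 C, 0 <= C & forall g, test_function e g ->
    `|\int[P]_w (g (z0 w) * (path_coef m i 0 w - cc m i))| <= C * L1 g.

(** The constant does not depend on [g], and the bound is linear in the [L^1] norm. Time-dependent
    weights can therefore be moved into [g] before the induction hypothesis is applied. *)
Let conv m i := exists2 C, 0 <= C & forall t g, 0 <= t -> test_function e g ->
  `|\int[P]_w (g (z0 w) * (path_coef m i t w - cc m i))| <=
    C * expR (- t) * L1 g.

(** The boundary of the induction: outside the range both quantities are the same constant, 1 at
    [(0, 0)] and 0 elsewhere. *)
Let conv_trivial m i : ~~ (1 <= i <= m)%N -> conv m i.
Proof.
move=> im; exists 0 => // t g t0 tg.
suff E w : path_coef m i t w = cc m i.
  under eq_Rintegral do rewrite E subrr mulr0.
  by rewrite Rintegral_cst// !mul0r normr0.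
have p0 : (path_poly t w)`_0 = 0 by rewrite coef_series_poly.
rewrite /path_coef /cc; have [[m0 i0]|mi] := eqVneq (m, i) (0%N, 0%N).
  by rewrite m0 i0 expr0 coef1 wcoef00.
rewrite (wcoef_out _ mi im); case: i im mi => [|i] im mi.
  by rewrite expr0 coef1; move: mi; rewrite xpair_eqE andbT => /negbTE ->.
by rewrite coef_exp_lt// ltnNge; move: im; rewrite ltn0Sn.
Qed.

(** Stationarity: as [1 - 3 e^2 = - 2], this says that the drift of the system vanishes at [cc] when
    the flow sits at [e]. *)
Let cc_eq m i : (1 <= i <= m)%N ->
  2 * i%:R * cc m i = i%:R * (i%:R - 1) * cc (m - 2) (i - 2)
    - 3 * i%:R * e * cc m i.+1 - i%:R * cc m i.+2.
Proof. by move=> im; rewrite /cc (wcoef_rec _ im); field. Qed.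

Section inductive_step.
Variables (m i : nat).
Hypotheses (mn : (1 <= m <= n)%N) (im : (1 <= i <= m)%N).
Variable g : R -> R.
Hypothesis tg : test_function e g.

(* The factor [weight ^+ i] cancels the linear term [i (1 - 3 x^2)] of the
   drift. *)
Definition weighted_test (t : R) w := g (z0 w) * weight `|t| (z0 w) ^+ i.

Definition weighted_coef (t : R) w := weighted_test t w * (path_coef m i t w - cc m i).

(** What remains of the drift after the integrating factor has cancelled the linear term and the
    stationarity equation has been subtracted, using [x S - e c = x (S - c) + (x - e) c]. The first
    line is small because [x] tends to [e]; the others are deviations at indices with smaller
    [2 m - i]. *)
Definition drift_deviation (t : R) w : R := let x := flow `|t| (z0 w) in
  (3 * i%:R * (1 - x ^+ 2) * cc m i - 3 * i%:R * (x - e) * cc m i.+1)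
  - 3 * i%:R * (x * (path_coef m i.+1 t w - cc m i.+1))
  - i%:R * (path_coef m i.+2 t w - cc m i.+2)
  + i%:R * (i%:R - 1) * (path_coef (m - 2) (i - 2) t w - cc (m - 2) (i - 2)).

Lemma ito_weighted_coef Tm : 0 < Tm ->
  exists sg, ito G0 W Tm weighted_coef (fun t w => weighted_test t w * drift_deviation t w) sg.
Proof.
move=> Tm0.
have m_n : (m <= n)%N by case/andP: mn.
have gF := good_flow W xiG0 r0 K1 xi0_bounds Tm.
have gWt := good_weight W xiG0 r0 r1 K1 xi0_bounds Tm.
have gD := @goodD _ _ _ P G0 W Tm.
have gM := @goodM _ _ _ P G0 W Tm.
have gC := @good_cst _ _ _ P G0 W Tm.
have gg : good G0 W Tm (fun _ w => g (z0 w)).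
  apply: (good_static Tm (moment_bounded_test tg)) => t.
  case: tg => mg _ _; apply: (adapted_comp mg).
  by apply: adapted_past_init => // B mB; exact: xiG0.
have gwi := @ring_closed_exp R R T (good G0 W Tm) gC gM _ i gWt.
have gG : good G0 W Tm weighted_test by exact: gM _ _ gg gwi.
pose k (t : R) w := weighted_test t w * (i%:R * (3 * (flow `|t| (z0 w) * flow `|t| (z0 w)) + -1)).
have gk : good G0 W Tm k.
  exact: (gM _ _ gG (gM _ _ (gC i%:R) (gD _ _ (gM _ _ (gC 3) (gM _ _ gF gF)) (gC (-1))))).
have pG : ae_primitive P weighted_test k.
  apply: aeW => w t t0.
  have dP : is_derive t 1 (fun s : R => weight `|s| (z0 w))
      ((3 * flow t (z0 w) ^+ 2 - 1) * weight t (z0 w)).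
    apply: is_derive_near (is_derive_weight (z0 w) (ltW t0)); near=> s.
    have s0 : 0 < s by near: s; exact: lt_nbhsr.
    by rewrite gtr0_norm.
  have -> : weighted_test ^~ w = g (z0 w) *: ((fun s : R => weight `|s| (z0 w)) ^+ i).
    by apply/funext => s; rewrite /weighted_test !fctE.
  apply: is_derive_eq; rewrite /k /weighted_test /GRing.scale/= (gtr0_norm t0).
  by case: (i) im => [//|j] _ /=; rewrite [weight _ _ ^+ j.+1]exprS; ring.
have iG := ito_primitive hW Tm0 gk gG pG.
have iS := ito_polyX hW i (ito_path_poly Tm0) m_n.
have m1 : moment_bounded P (time_domain Tm) (fun _ _ => - cc m i).
  by apply: (@moment_bounded_cst _ _ _ _ _ _ (fun=> - cc m i) `|cc m i|) => _ _; rewrite normrN.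
have ic : ito G0 W Tm (fun _ _ => - cc m i) (fun _ _ => 0) (fun _ _ => 0).
  by apply: (ito_static m1) => t _; exact: adapted_cst.
have := itoM hW iG (itoD iS ic); set sg := (X in ito _ _ _ _ _ X) => h.
exists sg; apply: (ito_eq h) => // t w _.
rewrite mul0r addr0 addr0 /k -[path_poly t w ^+ i]/(path_poly t w ^+ i).
rewrite -mulrA -mulrDr; congr (_ * _).
rewrite /drift_deviation; set x := flow `|t| (z0 w).
have c1 : (i%:R *: (path_poly t w ^+ i.-1 * path_poly_drift t w))`_m =
    i%:R * ((1 - 3 * x ^+ 2) * path_coef m i t w - 3 * x * path_coef m i.+1 t w
      - path_coef m i.+2 t w).
  rewrite /path_poly_drift /path_coef -/x.
  move: (1 - 3 * x ^+ 2) (3 * x) (path_poly t w) => A B p.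
  have -> : i%:R *: (p ^+ i.-1 * (A *: p - B *: p ^+ 2 - p ^+ 3)) =
      i%:R *: (A *: p ^+ i - B *: p ^+ i.+1 - p ^+ i.+2).
    case: (i) im => [//|j] _ /=; rewrite -!mul_polyC !exprS; ring.
  by rewrite !(coefZ, coefB).
(* The squared noise is [2 'X^2]: the 2 turns ['C(i, 2)] into [i (i - 1)], and ['X^2] shifts the
   degree from [m] to [m - 2]. *)
have c2 : ('C(i, 2)%:R *: (path_poly t w ^+ (i - 2) * (Num.sqrt 2 *: 'X) ^+ 2))`_m =
    i%:R * (i%:R - 1) * path_coef (m - 2) (i - 2) t w.
  rewrite exprZn sqr_sqrtr// -scalerAr scalerA coefZ coefMXn.
  have -> : 'C(i, 2)%:R * 2 = i%:R * (i%:R - 1) :> R.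
    rewrite -natrM.
    have -> : ('C(i, 2) * 2 = i * i.-1)%N.
      by rewrite -[2%N in X in (_ * X)%N]/(2`!) bin_ffact ffactnS ffactn1.
    by case: (i) im => [//|j] _; rewrite natrM -natr1 addrK.
  (* For [m < 2] the shifted coefficient is absent; then [i = 1] and the factor [i - 1] vanishes as
     well. *)
  case: ltnP => [m2|//].
  have i1 : i = 1%N by move: im; case: (i) m2 => [|[|]]//; lia.
  by rewrite i1 subrr !(mulr0, mul0r).
rewrite coefD c1 c2.
have := cc_eq im; set a := path_coef m i t w; set b := path_coef m i.+1 t w.
set q := path_coef m i.+2 t w; set u := path_coef (m - 2) (i - 2) t w.
move: (cc m i) (cc m i.+1) (cc m i.+2) (cc (m - 2) (i - 2)) => y0 y1 y2 y3 hy.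
have -> : (path_poly t w ^+ i)`_m = a by [].
lra.
Unshelve. all: by end_near. Qed.

Lemma expectation_weighted_growth t : 0 < t ->
  (forall A a : R, 0 <= A -> 0 < a ->
    (forall s, 0 <= s <= t ->
      `|\int[P]_w (weighted_test s w * drift_deviation s w)| <= A * expR (a * s)) ->
    `|\int[P]_w weighted_coef t w| <= `|\int[P]_w weighted_coef 0 w| + A / a * expR (a * t)).
Proof.
move=> t0 A a A0 a0 hA.
have [sg iV] := ito_weighted_coef t0.
have [C C0 hC] := ito_expectation G0_sigma G0_measurable hW G0W iV.
apply: (@discrete_growth_bound R (fun s => \int[P]_w weighted_coef s w)
  (fun s => \int[P]_w (weighted_test s w * drift_deviation s w)) t A a C) => //.
exact: ltW.
Qed.
End inductive_step.

Let measurable_weightX i t : measurable_fun setT (fun z : R => weight t z ^+ i).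
Proof. by apply: measurable_funX; exact: measurable_weight. Qed.

Let weightX_le i t z : 0 <= t -> r <= `|z| <= K ->
  `|weight t z ^+ i| <= expR (2 * i%:R * t) * (K ^+ 3) ^+ i.
Proof.
move=> t0 zrK; have /andP[_ h] := weight_bounds r0 r1 K1 t0 zrK.
rewrite normrX (gtr0_norm (weight_gt0 z t0)).
have -> : expR (2 * i%:R * t) * (K ^+ 3) ^+ i = (expR (2 * t) * K ^+ 3) ^+ i.
  by rewrite [RHS]exprMn -expRM_natl; congr (expR _ * _); ring.
by rewrite lerXn2r ?nnegrE ?(ltW (weight_gt0 z t0))// mulr_ge0 ?expR_ge0 ?exprn_ge0.
Qed.

Let weightXV_le i t z : 0 <= t -> r <= `|z| <= K ->
  `|(weight t z ^+ i)^-1| <= expR (- (2 * i%:R * t)) * ((r ^+ 3) ^+ i)^-1.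
Proof.
move=> t0 zrK; have /andP[h _] := weight_bounds r0 r1 K1 t0 zrK.
have w0 := weight_gt0 z t0.
have rp : 0 < expR (2 * t) * r ^+ 3 by rewrite mulr_gt0 ?expR_gt0 ?exprn_gt0.
rewrite normfV normrX (gtr0_norm w0).
have -> : expR (- (2 * i%:R * t)) * ((r ^+ 3) ^+ i)^-1 = ((expR (2 * t) * r ^+ 3) ^+ i)^-1.
  by rewrite (exprMn _ (expR _)) -expRM_natl invfM -expRN; congr (expR (- _) * _); ring.
by rewrite lef_pV2 ?posrE ?exprn_gt0// lerXn2r ?nnegrE ?(ltW w0) ?(ltW rp).
Qed.

Let kappa := K ^+ 2 / r ^+ 2.

Let kappa0 : 0 <= kappa. Proof. by rewrite divr_ge0// exprn_ge0// ltW. Qed.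

Let exp2_le (s : R) : 0 <= s -> expR (- (2 * s)) <= expR (- s).
Proof. by move=> s0; rewrite ler_expR lerN2; lra. Qed.

(** The weight contributes [exp(2 i s)], and every term of the deviation decays at least like
    [exp(- s)]: by convergence of the flow or by the induction hypotheses. *)
Let deviation_bound m i : (1 <= m <= n)%N -> (1 <= i <= m)%N ->
  conv m i.+1 -> conv m i.+2 -> conv (m - 2) (i - 2) ->
  exists2 B, 0 <= B & forall g s, test_function e g -> 0 <= s ->
    `|\int[P]_w (weighted_test i g s w * drift_deviation m i s w)| <=
    B * L1 g * expR ((2 * i%:R - 1) * s).
Proof.
move=> mn im [C1 C10 h1] [C2 C20 h2] [C3 C30 h3].
have m_n : (m <= n)%N by case/andP: mn.
have m2_n : (m - 2 <= n)%N by rewrite (leq_trans (leq_subr _ _)).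
pose I := i%:R : R; have I0 : 0 <= I by [].
have I1 : 0 <= I - 1 by rewrite subr_ge0 ler1n; case/andP: im.
pose B0 := 3 * I * kappa * (`|cc m i| + `|cc m i.+1|).
have I3 : 0 <= 3 * I by rewrite mulr_ge0.
have B00 : 0 <= B0.
  exact: mulr_ge0 (mulr_ge0 I3 kappa0) (addr_ge0 (normr_ge0 _) (normr_ge0 _)).
pose B1 := B0 + 3 * I * C1 * K + I * C2 + I * (I - 1) * C3.
have B10 : 0 <= B1.
  exact: addr_ge0 (addr_ge0 (addr_ge0 B00 (mulr_ge0 (mulr_ge0 I3 C10) K0))
    (mulr_ge0 I0 C20)) (mulr_ge0 (mulr_ge0 I0 I1) C30).
have KI0 : 0 <= (K ^+ 3) ^+ i by rewrite !exprn_ge0.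
exists (B1 * (K ^+ 3) ^+ i) => [|g s tg s0]; first by rewrite mulr_ge0.
(* The weight, and for the index [i.+1] also the flow, become part of the test function, to which
   the induction hypotheses apply. *)
pose g3 z := g z * weight s z ^+ i.
have mF := measurable_flow s0.
have tg3 : test_function e g3.
  by apply: (test_functionM tg (@measurable_weightX i s)) => z; exact: weightX_le.
pose h0 z := 3 * I * (1 - flow s z ^+ 2) * cc m i - 3 * I * (flow s z - e) * cc m i.+1.
have mh0 : measurable_fun setT h0.
  apply: measurable_funB; apply: measurable_funM => //; apply: measurable_funM => //;
    apply: measurable_funB => //; exact: measurable_funX.
have h0_le z : r <= `|z| <= K -> 0 < e * z -> `|h0 z| <= B0 * expR (- s).
  move=> zrK ez; rewrite (le_trans (ler_normB _ _))//.
  have k1 := sqr_flow_sub1 r0 r1 K1 s0 zrK; rewrite -/kappa distrC in k1.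
  have k2 := flow_sub_sign r0 r1 K1 e1 ez s0 zrK; rewrite -/kappa in k2.
  have k3 := ler_wpM2l kappa0 (exp2_le s0).
  rewrite !normrM !(ger0_norm I0) normr_nat.
  have k4 := le_trans k1 k3; have k5 := le_trans k2 k3.
  have -> : B0 * expR (- s) = 3 * I * (kappa * expR (- s)) * `|cc m i| +
      3 * I * (kappa * expR (- s)) * `|cc m i.+1| by rewrite /B0; ring.
  by apply: lerD; rewrite ler_wpM2r// ler_wpM2l// mulr_ge0.
have th0 : test_function e (fun z => g3 z * h0 z).
  apply: (test_functionM (L := 3 * I * (1 + K ^+ 2) * `|cc m i| +
    3 * I * (K + `|e|) * `|cc m i.+1|) tg3 mh0) => z zrK.
  have fK := flow_le r0 K1 s0 zrK.
  rewrite (le_trans (ler_normB _ _))// !normrM !(ger0_norm I0) normr_nat.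
  apply: lerD; rewrite ler_wpM2r// ler_wpM2l ?mulr_ge0//.
    rewrite (le_trans (ler_normB _ _))// normr1 lerD2l normrX.
    by rewrite lerXn2r ?nnegrE.
  by rewrite (le_trans (ler_normB _ _))// lerD2r.
have tg3x : test_function e (fun z => g3 z * flow s z).
  by apply: (test_functionM tg3 mF) => z; exact: (flow_le r0 K1).
pose Es := expR (- s).
have Es0 : 0 <= Es by exact: expR_ge0.
have b0 := norm_integral_test_le tg3 mh0 h0_le th0.
have b1 := h1 s _ s0 tg3x.
have b2 := h2 s _ s0 tg3.
have b3 := h3 s _ s0 tg3.
have Lx : L1 (fun z => g3 z * flow s z) <= K * L1 g3.
  by apply: (L1M_le tg3 mF) => z zrK _; exact: (flow_le r0 K1).
have L3 : L1 g3 <= expR (2 * I * s) * (K ^+ 3) ^+ i * L1 g.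
  by apply: (L1M_le tg (@measurable_weightX i s)) => z zrK _; exact: weightX_le.
have i0 := integrable_test th0.
have i1 := @integrable_path_coef _ _ m i.+1 s (cc m i.+1) m_n s0 tg3x.
have i2 := @integrable_path_coef _ _ m i.+2 s (cc m i.+2) m_n s0 tg3.
have i3 := @integrable_path_coef _ _ (m - 2) (i - 2) s (cc (m - 2) (i - 2)) m2_n s0 tg3.
have j1 := integrableZl measurableT (- (3 * I)) i1.
have j2 := integrableZl measurableT (- I) i2.
have j3 := integrableZl measurableT (I * (I - 1)) i3.
have j23 := integrableD measurableT j2 j3.
have j123 := integrableD measurableT j1 j23.
have -> : \int[P]_w (weighted_test i g s w * drift_deviation m i s w) =
  \int[P]_w (g3 (z0 w) * h0 (z0 w) + (- (3 * I) * (g3 (z0 w) * flow s (z0 w) * (path_coef m i.+1 s w - cc m i.+1)) +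
   (- I * (g3 (z0 w) * (path_coef m i.+2 s w - cc m i.+2)) +
    I * (I - 1) * (g3 (z0 w) * (path_coef (m - 2) (i - 2) s w - cc (m - 2) (i - 2)))))).
  apply: eq_Rintegral => w _.
  rewrite /weighted_test /drift_deviation (ger0_norm s0) /g3 /h0 -/I; ring.
rewrite (RintegralD measurableT i0 j123) (RintegralD measurableT j1 j23).
rewrite (RintegralD measurableT j2 j3) !RintegralZl//.
move: b0 b1 b2 b3; set a0 := \int[P]_w _; set a1 := \int[P]_w _.
set a2 := \int[P]_w _; set a3 := \int[P]_w _ => b0 b1 b2 b3.
apply: (@le_trans _ _ (B1 * Es * L1 g3)).
  have -> : B1 * Es * L1 g3 = B0 * Es * L1 g3 + (3 * I * (C1 * Es * (K * L1 g3)) +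
      (I * (C2 * Es * L1 g3) + I * (I - 1) * (C3 * Es * L1 g3))).
    by rewrite /B1; ring.
  have n1 : `|- (3 * I) * a1| <= 3 * I * (C1 * Es * (K * L1 g3)).
    rewrite normrM normrN (ger0_norm I3) ler_wpM2l//.
    by rewrite (le_trans b1)// ler_wpM2l// mulr_ge0.
  have n2 : `|- I * a2| <= I * (C2 * Es * L1 g3).
    by rewrite normrM normrN (ger0_norm I0) ler_wpM2l.
  have n3 : `|I * (I - 1) * a3| <= I * (I - 1) * (C3 * Es * L1 g3).
    by rewrite normrM (ger0_norm (mulr_ge0 I0 I1)) ler_wpM2l// mulr_ge0.
  exact: le_trans (ler_normD _ _) (lerD b0 (le_trans (ler_normD _ _)
    (lerD n1 (le_trans (ler_normD _ _) (lerD n2 n3))))).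
have -> : B1 * (K ^+ 3) ^+ i * L1 g * expR ((2 * i%:R - 1) * s) =
   B1 * Es * (expR (2 * I * s) * (K ^+ 3) ^+ i * L1 g).
  rewrite (_ : (2 * i%:R - 1) * s = 2 * I * s - s); last by rewrite /I; ring.
  by rewrite expRD -/Es; ring.
by rewrite ler_wpM2l// mulr_ge0.
Qed.

Let conv_step m i : (1 <= m <= n)%N -> (1 <= i <= m)%N ->
  conv m i.+1 -> conv m i.+2 -> conv (m - 2) (i - 2) -> conv m i.
Proof.
move=> mn im c1 c2 c3; have [B B0 hB] := deviation_bound mn im c1 c2 c3.
have [C0 C00 hC0] := initial_bound mn im.
pose a := 2 * i%:R - 1 : R.
have i1 : 1 <= i%:R :> R by rewrite ler1n; case/andP: im.
have a0 : 0 < a by rewrite /a; lra.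
pose rho := ((r ^+ 3) ^+ i)^-1.
have rho0 : 0 <= rho by rewrite invr_ge0 !exprn_ge0// ltW.
exists ((C0 + B / a) * rho) => [|t g t0 tg].
  by rewrite mulr_ge0// addr_ge0// divr_ge0// ltW.
(* The test function is divided by the weight at the final time [t], so that the weighted quantity
   at [t] is the one wanted. Its [L^1] norm gains [exp(- 2 i t)], which against the growth
   [exp((2 i - 1) t)] leaves [exp(- t)]. *)
pose gt z := g z * (weight t z ^+ i)^-1.
have mV : measurable_fun setT (fun z : R => (weight t z ^+ i)^-1).
  apply: continuous_measurable_fun => z; apply: cvgV.
    by rewrite gt_eqF// exprn_gt0// weight_gt0.
  apply: (@continuous_comp _ _ _ (weight t) (fun x => x ^+ i)); last exact: exprn_continuous.
  apply: cvgM; first exact: cvg_cst.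
  apply: (@continuous_comp _ _ _ (flow_den t) (fun x => x ^+ 3)).
    exact: continuous_flow_den.
  exact: exprn_continuous.
have tgt : test_function e gt.
  by apply: (test_functionM tg mV) => z; exact: weightXV_le.
have Lgt : L1 gt <= expR (- (2 * i%:R * t)) * rho * L1 g.
  by apply: (L1M_le tg mV) => z zrK _; exact: weightXV_le.
have Lgt0 := L1_ge0 gt; have Lg0 := L1_ge0 g.
have E0 : 1 <= expR (a * t) by rewrite -[leLHS]expR0 ler_expR mulr_ge0// ltW.
suff main : `|\int[P]_w (g (z0 w) * (path_coef m i t w - cc m i))| <=
    (C0 + B / a) * expR (a * t) * L1 gt.
  apply: le_trans main _.
  have -> : (C0 + B / a) * rho * expR (- t) * L1 g =
      (C0 + B / a) * expR (a * t) * (expR (- (2 * i%:R * t)) * rho * L1 g).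
    have -> : - t = a * t + - (2 * i%:R * t) by rewrite /a; ring.
    by rewrite expRD; ring.
  by rewrite ler_wpM2l// mulr_ge0 ?expR_ge0// addr_ge0// divr_ge0// ltW.
have init : `|\int[P]_w weighted_coef m i gt 0 w| <= C0 * L1 gt.
  have -> : \int[P]_w weighted_coef m i gt 0 w =
      \int[P]_w (gt (z0 w) * (path_coef m i 0 w - cc m i)).
    apply: eq_Rintegral => w _.
    by rewrite /weighted_coef /weighted_test normr0 weight0 expr1n mulr1.
  exact: hC0.
have VE w : weighted_coef m i gt t w = g (z0 w) * (path_coef m i t w - cc m i).
  rewrite /weighted_coef /weighted_test (ger0_norm t0) /gt divfK//.
  by rewrite gt_eqF// exprn_gt0// weight_gt0.
have <- : \int[P]_w weighted_coef m i gt t w =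
    \int[P]_w (g (z0 w) * (path_coef m i t w - cc m i)).
  by apply: eq_Rintegral => w _; rewrite VE.
move: t0; rewrite le_eqVlt => /predU1P[t0|t0].
  rewrite -t0 mulr0 expR0 mulr1; apply: le_trans init _.
  by rewrite ler_wpM2r// lerDl divr_ge0// ltW.
have := @expectation_weighted_growth m i mn im gt tgt t t0 (B * L1 gt) a _ a0.
move=> /(_ (mulr_ge0 B0 Lgt0)) h.
apply: le_trans (h _) _; first by move=> s /andP[s0 _]; exact: hB.
apply: (@le_trans _ _ (C0 * L1 gt * expR (a * t) + B * L1 gt / a * expR (a * t))).
  rewrite lerD2r (le_trans init)// ler_peMr// mulr_ge0//.
by rewrite le_eqVlt; apply/orP; left; apply/eqP; ring.
Qed.

Lemma conditional_convergence m i : (m <= n)%N -> exists2 C, 0 <= C &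
  forall t g, 0 <= t -> test_function e g ->
  `|\int[P]_w (g (xi 0%N w) * (path_coef m i t w - wcoef (- e) m i))| <=
    C * expR (- t) * \int[P]_w `|g (xi 0%N w)|.
Proof.
have [N] := ubnP (2 * m - i)%N; elim: N m i => // N IH m i mN mn.
have [im|im] := boolP (1 <= i <= m)%N; last exact: conv_trivial.
have mn' : (1 <= m <= n)%N by rewrite mn andbT; lia.
apply: conv_step => //; apply: IH; lia.
Qed.
End sign.
End conditional_convergence.

(** * Conditional expectations *)

Section conditional_expectation.
Context d (T : measurableType d) (R : realType) (P : probability T R).

(** Radon-Nikodym on the real line: the image under [X] of the charge with density [Y] is dominated
    by the law of [X], and its density composed with [X] is a version. *)
Lemma cond_expP (Y X : T -> R) : P.-integrable setT (EFin \o Y) ->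
  measurable_fun setT X -> is_cond_exp P Y X (cond_exp P Y X).
Proof.
move=> iY mX.
suff ex : exists Z, is_cond_exp P Y X Z.
  exact: (@xgetPex _ _ [set Z | is_cond_exp P Y X Z] ex).
pose X' : {mfun T >-> R} := mfun_Sub (mem_set mX).
have mXp B : measurable B -> measurable (X @^-1` B).
  by move=> mB; rewrite -[X in measurable X]setTI; exact: (mX measurableT B mB).
pose mu := distribution P X'.
pose nu : {charge set R -> \bar R} :=
  measure_function_pushforward__canonical__charge_Charge (induced_charge iY) mX.
have numu : nu `<< mu.
  apply/null_content_dominatesP => B mB muB.
  apply: null_set_integral => //; first exact: mXp.
  by apply: measurable_funTS; exact: measurable_int iY.
pose h := Radon_Nikodym nu mu.
have hfin x : h x \is a fin_num by exact: Radon_Nikodym_fin_num.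
have hint : mu.-integrable setT h by exact: Radon_Nikodym_integrable.
have mh := measurable_int _ hint.
have mfh : measurable_fun setT (fine \o h) by exact: measurableT_comp.
have hE : EFin \o (fun w => fine (h (X w))) = h \o X.
  by apply/funext => w; rewrite /= fineK.
have ihX : P.-integrable setT (h \o X).
  apply/integrableP; split; first exact: measurableT_comp.
  move/integrableP : hint => [_]; apply: le_lt_trans.
  by rewrite (ge0_integral_pushforward mX)//; exact: measurableT_comp.
exists (fun w => fine (h (X w))); split.
- move=> _ [B mB <-]; exists ((fine \o h) @^-1` B) => //.
  by rewrite -[X in measurable X]setTI; exact: (mfh measurableT B mB).
- by rewrite hE.
- move=> _ [B mB <-]; rewrite setTI.
  transitivity (nu B); last by [].
  rewrite (Radon_Nikodym_integral numu mB) (integral_pushforward mX)//.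
  + by rewrite -hE.
  + by apply: (integrableS measurableT _ _ ihX) => //; exact: mXp.
Qed.
End conditional_expectation.

Section test_functions.
Context d (T : measurableType d) (R : realType) (P : probability T R).
Implicit Types (U Y Z : T -> R) (g : R -> R).
Variable X : T -> R.
Hypothesis mX : measurable_fun setT X.

Let mXp B : measurable B -> measurable (X @^-1` B).
Proof. by move=> mB; rewrite -[X in measurable X]setTI; exact: (mX measurableT mB). Qed.

Lemma integrable_boundedM U (f : T -> R) M : P.-integrable setT (EFin \o U) ->
  measurable_fun setT f -> (forall w, `|f w| <= M) ->
  P.-integrable setT (EFin \o (fun w => f w * U w)).
Proof.
move=> iU mf fM.
have mU : measurable_fun setT U by apply/measurable_EFinP; exact: measurable_int iU.
apply: (le_integrable measurableT _ _ (integrableZl measurableT M (integrable_norm iU))).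
  by apply/measurable_EFinP; exact: measurable_funM.
move=> w _; rewrite /= lee_fin normrM [leRHS]normrM normr_id ler_wpM2r//.
by rewrite (le_trans (fM w))// ler_norm.
Qed.

(** The integer part of [N g] is a sum of indicators of level sets, against each of which [U] has a
    nonnegative integral, and it differs from [N g] by at most 1. So [N] times the integral is at
    least minus the [L^1] norm of [U] for every [N], which excludes a negative value. *)
Lemma bounded_test_integral_ge0 U g M : P.-integrable setT (EFin \o U) ->
  (forall B, measurable B -> 0 <= \int[P]_(w in X @^-1` B) U w) ->
  measurable_fun setT g -> (forall x, 0 <= g x <= M) ->
  0 <= \int[P]_w (g (X w) * U w).
Proof.
move=> iU U0 mg gM.
have mgX : measurable_fun setT (g \o X) by exact: measurableT_comp.
have iUn := integrable_norm iU.
have igU : P.-integrable setT (EFin \o (fun w => g (X w) * U w)).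
  apply: (@integrable_boundedM _ (g \o X) M) => // w.
  by have /andP[g0 gM'] := gM (X w); rewrite /= ger0_norm.
have key (N : nat) : - (\int[P]_w `|U w|) <= N%:R * \int[P]_w (g (X w) * U w).
  pose B k := [set x | k.+1%:R <= N%:R * g x].
  have mB k : measurable (B k).
    rewrite -[X in measurable X]setTI.
    apply: measurable_fun_le => //.
    by apply: measurable_funM.
  have simple L : P.-integrable setT (EFin \o (fun w => (\sum_(k < L) \1_(B k) (X w)) * U w)) /\
      0 <= \int[P]_w ((\sum_(k < L) \1_(B k) (X w)) * U w).
    elim: L => [|L [iL L0]].
      have E w : (\sum_(k < 0) \1_(B k) (X w)) * U w = 0 by rewrite big_ord0 mul0r.
      split; first by under [X in _.-integrable _ X]eq_fun do rewrite /= E; exact: integrable0.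
      by under eq_Rintegral do rewrite E; rewrite Rintegral_cst// mul0r.
    have i1 : P.-integrable setT (EFin \o (fun w => \1_(B L) (X w) * U w)).
      apply: (@integrable_boundedM _ (fun w => \1_(B L) (X w)) 1) => //.
        by apply: measurableT_comp.
      by move=> w; rewrite indicE; case: (_ \in _); rewrite ?normr1 ?normr0.
    have E w : (\sum_(k < L.+1) \1_(B k) (X w)) * U w =
        (\sum_(k < L) \1_(B k) (X w)) * U w + \1_(B L) (X w) * U w.
      by rewrite big_ord_recr mulrDl.
    split; first by under [X in _.-integrable _ X]eq_fun do rewrite /= E; exact: (integrableD measurableT iL i1).
    under eq_Rintegral do rewrite E.
    rewrite RintegralD// addr_ge0//; have := U0 _ (mB L).
    rewrite Rintegral_mkcond; congr (_ <= _); apply: eq_Rintegral => w _.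
    rewrite patchE indicE.
    have -> : (X w \in B L) = (w \in X @^-1` B L).
      by apply/idP/idP => /set_mem ?; exact: mem_set.
    by case: (_ \in _); rewrite ?mul1r ?mul0r.
  pose L := (Num.truncn (N%:R * M)).+1.
  have sE x : \sum_(k < L) \1_(B k) x = (Num.truncn (N%:R * g x))%:R :> R.
    have -> : Num.truncn (N%:R * g x) = (\sum_(k < L) (k < Num.truncn (N%:R * g x)))%N.
      have : (Num.truncn (N%:R * g x) <= L)%N.
        apply: leqW; apply: le_truncn; rewrite ler_wpM2l//.
        by have /andP[] := gM x.
      elim: L {simple} => [|L IH] tL.
        by rewrite big_ord0; apply/eqP; rewrite -leqn0.
      rewrite big_ord_recr/=; move: tL; rewrite leq_eqVlt => /predU1P[tL|/[!ltnS] tL].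
        rewrite tL ltnSn (eq_bigr (fun=> 1%N)) => [|k _]; last by rewrite ltnS (ltnW (ltn_ord k)).
        by rewrite sum1_card card_ord addn1.
      by rewrite -IH// ltnNge tL addn0.
    rewrite natr_sum; apply: eq_bigr => k _; rewrite indicE truncn_gt_nat.
    rewrite (_ : (x \in B k) = (k.+1%:R <= N%:R * g x))//.
    by apply/idP/idP => [/set_mem//|h]; exact: mem_set.
  have [iL L0] := simple L.
  rewrite lerNl -RintegralZl// -subr_ge0 opprK -RintegralD//; last first.
    exact: (integrableZl measurableT N%:R igU).
  apply: (le_trans L0); apply: le_Rintegral => //.
    exact: (integrableD measurableT iUn (integrableZl measurableT N%:R igU)).
  move=> w _; rewrite sE mulrA.
  have /andP[g0 _] := gM (X w).
  have /truncn_itv/andP[h1 h2] : 0 <= N%:R * g (X w) by rewrite mulr_ge0.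
  rewrite -lerBlDr -mulrBl (le_trans (ler_norm _))// normrM ler_piMl//.
  by rewrite ler_norml; apply/andP; split; move: h1 h2; rewrite -natr1; lra.
apply: contraT; rewrite -ltNge => neg.
set I := \int[P]_w _ in neg key.
have [N hN] : exists N : nat, (\int[P]_w `|U w|) < N%:R * - I.
  exists (Num.truncn (\int[P]_w `|U w| / - I)).+1.
  by rewrite -ltr_pdivrMr ?oppr_gt0// truncnS_gt.
by have := key N; rewrite lerNl -mulrN leNgt hN.
Qed.

(** Positivity applied to [C - s Y] for both signs [s]. *)
Let nonneg_test_bound Y g M C : P.-integrable setT (EFin \o Y) ->
  (forall B, measurable B ->
    `|\int[P]_(w in X @^-1` B) Y w| <= C * fine (P (X @^-1` B))) ->
  measurable_fun setT g -> (forall x, 0 <= g x <= M) ->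
  `|\int[P]_w (g (X w) * Y w)| <= C * \int[P]_w g (X w).
Proof.
move=> iY YC mg gM.
have mgX : measurable_fun setT (g \o X) by exact: measurableT_comp.
have gXM w : `|(g \o X) w| <= M.
  by have /andP[g0 gM'] := gM (X w); rewrite /= ger0_norm.
have iC : P.-integrable setT (EFin \o (fun=> C : R)) by exact: finite_measure_integrable_cst.
have i1 : P.-integrable setT (EFin \o (fun=> 1 : R)) by exact: finite_measure_integrable_cst.
have igY := integrable_boundedM iY mgX gXM.
have ig : P.-integrable setT (EFin \o (fun w => g (X w))).
  have := integrable_boundedM i1 mgX gXM.
  by under [X in _.-integrable _ X]eq_fun do rewrite /= mulr1.
suff main (s : R) : s ^+ 2 = 1 -> s * \int[P]_w (g (X w) * Y w) <= C * \int[P]_w g (X w).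
  rewrite ler_norml lerNl -mulN1r; apply/andP; split.
    by apply: main; rewrite sqrrN expr1n.
  by rewrite -[leLHS]mul1r; apply: main; rewrite expr1n.
move=> s1.
have isY := integrableZl measurableT (- s) iY.
have := @bounded_test_integral_ge0 (fun w => C + - s * Y w) g M
  (integrableD measurableT iC isY) _ mg gM.
have E : \int[P]_w (g (X w) * (C + - s * Y w)) =
    C * \int[P]_w g (X w) - s * \int[P]_w (g (X w) * Y w).
  rewrite -mulNr -!RintegralZl//.
  rewrite -RintegralD//; [|exact: (integrableZl measurableT C ig)|exact: (integrableZl measurableT (- s) igY)].
  by apply: eq_Rintegral => w _; ring.
rewrite E subr_ge0; apply => B mB.
have mXB := mXp mB.
have iYB : P.-integrable (X @^-1` B) (EFin \o Y) by exact: (integrableS measurableT _ _ iY).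
rewrite RintegralD//; last 2 first.
- by exact: (integrableS measurableT _ _ iC).
- by exact: (integrableS measurableT _ _ isY).
rewrite Rintegral_cst// RintegralZl// mulNr subr_ge0 (le_trans _ (YC _ mB))//.
rewrite (le_trans (ler_norm _))// normrM ler_piMl// -(@ler_pXn2r _ 2)// ?nnegrE//.
by rewrite real_normK ?num_real// s1 expr1n.
Qed.

(** Duality in one direction: a bound over the events of [X], the form in which A3 is available,
    becomes a bound against bounded test functions, linear in their [L^1] norm. The test function is
    split into its positive and negative parts. *)
Lemma bounded_test_integral_bound Y g M C : P.-integrable setT (EFin \o Y) ->
  (forall B, measurable B ->
    `|\int[P]_(w in X @^-1` B) Y w| <= C * fine (P (X @^-1` B))) ->
  measurable_fun setT g -> (forall x, `|g x| <= M) ->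
  `|\int[P]_w (g (X w) * Y w)| <= C * \int[P]_w `|g (X w)|.
Proof.
move=> iY YC mg gM.
pose p x := Num.max (g x) 0; pose q x := Num.max (- g x) 0.
have mp : measurable_fun setT p by apply: measurable_maxr.
have mq : measurable_fun setT q by apply: measurable_maxr => //; exact: measurableT_comp.
have pM x : 0 <= p x <= M.
  rewrite /p le_max lexx orbT/= ge_max (le_trans (ler_norm _) (gM x)).
  exact: le_trans (gM x).
have qM x : 0 <= q x <= M.
  rewrite /q le_max lexx orbT/= ge_max (le_trans (normr_ge0 _) (gM x)) andbT.
  by apply: le_trans (gM x); rewrite -normrN ler_norm.
have gE x : g x = p x - q x.
  by rewrite /p /q; case: (lerP 0 (g x)) => h; case: lerP; lra.
have ngE x : `|g x| = p x + q x.
  rewrite /p /q; case: (lerP 0 (g x)) => h.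
    by rewrite ger0_norm//; case: lerP; lra.
  by rewrite ltr0_norm//; case: lerP; lra.
have i1 : P.-integrable setT (EFin \o (fun=> 1 : R)) by exact: finite_measure_integrable_cst.
have hX (f : R -> R) (mf : measurable_fun setT f) (fM : forall x, 0 <= f x <= M) (Z : T -> R) :
    P.-integrable setT (EFin \o Z) ->
    P.-integrable setT (EFin \o (fun w => f (X w) * Z w)).
  move=> iZ; apply: (@integrable_boundedM _ (f \o X) M iZ).
    exact: measurableT_comp.
  by move=> w; have /andP[f0 fM'] := fM (X w); rewrite /= ger0_norm.
have hX1 (f : R -> R) (mf : measurable_fun setT f) (fM : forall x, 0 <= f x <= M) :
    P.-integrable setT (EFin \o (fun w => f (X w))).
  by have := hX f mf fM _ i1; under [X in _.-integrable _ X]eq_fun do rewrite /= mulr1.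
have -> : \int[P]_w (g (X w) * Y w) =
    \int[P]_w (p (X w) * Y w) - \int[P]_w (q (X w) * Y w).
  rewrite -RintegralB//; [|exact: hX|exact: hX].
  by apply: eq_Rintegral => w _; rewrite gE mulrBl.
have -> : \int[P]_w `|g (X w)| = \int[P]_w p (X w) + \int[P]_w q (X w).
  rewrite -RintegralD//; [|exact: hX1|exact: hX1].
  by apply: eq_Rintegral => w _; rewrite ngE.
rewrite mulrDr (le_trans (ler_normB _ _))// lerD//; exact: (@nonneg_test_bound _ _ M).
Qed.

(** Duality in the other direction. The event where [X] is in [D] and [Z > c] belongs to the
    sigma-algebra of [X], so [Y] replaces [Z] on it: the positive function [Z - c] has an integral
    at most 0 there, and the event is null. *)
Lemma cond_exp_ae_le Y Z (D : set R) (c : R) : is_cond_exp P Y X Z ->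
  P.-integrable setT (EFin \o Y) -> measurable D ->
  (forall B, measurable B -> B `<=` D ->
    \int[P]_(w in X @^-1` B) Y w <= c * fine (P (X @^-1` B))) ->
  {ae P, forall w, D (X w) -> Z w <= c}.
Proof.
move=> [sZ iZ ZE] iY mD Yc.
have [B0 mB0 B0E] : sigma_of X (Z @^-1` `]c, +oo[).
  by apply: sZ; exists `]c, +oo[%classic => //; rewrite setTI.
rewrite setTI in B0E.
pose A := X @^-1` (B0 `&` D).
have mA : measurable A by apply: mXp; exact: measurableI.
have AZ w : A w -> c < Z w.
  by move=> [B0w _]; have : (X @^-1` B0) w by []; rewrite B0E /= in_itv/= andbT.
have iZA : P.-integrable A (EFin \o Z) by exact: (integrableS measurableT _ _ iZ).
have icA : P.-integrable A (EFin \o cst c).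
  exact: finite_measure_integrable_cst.
have iA : P.-integrable A (EFin \o (fun w => Z w - c)).
  exact: (integrableB mA iZA icA).
have int_le : \int[P]_(w in A) (Z w - c) <= 0.
  rewrite RintegralB// Rintegral_cst// subr_le0.
  have -> : \int[P]_(w in A) Z w = \int[P]_(w in A) Y w.
    by congr fine; apply: ZE; exists (B0 `&` D); [exact: measurableI|rewrite setTI].
  by apply: Yc; [exact: measurableI|move=> x []].
have : (\int[P]_(w in A) `|(Z w - c)%:E| = 0)%E.
  transitivity (\int[P]_(w in A) (Z w - c)%:E)%E.
    apply: eq_integral => w /set_mem /AZ h.
    by rewrite gee0_abs// lee_fin subr_ge0 ltW.
  rewrite -(fineK (integrable_fin_num mA iA)); congr EFin.
  apply/eqP; rewrite eq_le int_le; apply: Rintegral_ge0 => w /AZ.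
  by rewrite subr_ge0 => /ltW.
move/(ae_eq_integral_abs P mA (measurable_int _ iA)); apply: filterS => w h Dw.
rewrite leNgt; apply/negP => cZ.
have Aw : A w by split => //; have : (X @^-1` B0) w by rewrite B0E /= in_itv/= andbT.
by have := h Aw => -[]; move/eqP; rewrite subr_eq0 gt_eqF.
Qed.
End test_functions.

Section integral_extras.
Context d (T : measurableType d) (R : realType) (P : probability T R).
Implicit Types f g : T -> R.

Lemma ae_eq_Rintegral f g : measurable_fun setT f -> measurable_fun setT g ->
  {ae P, forall w, f w = g w} -> \int[P]_w f w = \int[P]_w g w.
Proof.
move=> mf mg fg; congr fine; apply: ae_eq_integral => //.
- exact/measurable_EFinP.
- exact/measurable_EFinP.
- by apply: filterS fg => w -> _.
Qed.

Lemma ae_eq_integrable f g : P.-integrable setT (EFin \o f) ->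
  measurable_fun setT g -> {ae P, forall w, f w = g w} ->
  P.-integrable setT (EFin \o g).
Proof.
move=> /integrableP[mf foo] mg fg; apply/integrableP; split.
  exact/measurable_EFinP.
apply: le_lt_trans foo; rewrite le_eqVlt; apply/orP; left; apply/eqP.
apply: ae_eq_integral => //.
- by apply: measurableT_comp => //; exact/measurable_EFinP.
- exact: measurableT_comp.
- by apply: filterS fg => w /= -> _.
Qed.

Lemma norm_Rintegral_le_ae (D : set T) f c : measurable D ->
  P.-integrable D (EFin \o f) -> {ae P, forall w, `|f w| <= c} ->
  `|\int[P]_(w in D) f w| <= c * fine (P D).
Proof.
move=> mD iF fc.
rewrite -Rintegral_cst// (le_trans (le_normr_Rintegral mD iF))//.
have c0 : 0 <= c.
  have [w hw] : exists w, `|f w| <= c; last exact: le_trans hw.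
  apply: contrapT => /forallNP h.
  have : P.-negligible setT by apply: negligibleS fc => w _; exact: h.
  move/(measure_negligible measurableT); rewrite [X in X = _](probability_setT P).
  by move/eqP; rewrite onee_eq0.
have icD : P.-integrable D (EFin \o cst c) by exact: finite_measure_integrable_cst.
apply: fine_le.
- exact: (integrable_fin_num mD (integrable_norm iF)).
- exact: (integrable_fin_num mD icD).
- apply: ae_ge0_le_integral => //.
  + exact: (measurable_int _ (integrable_norm iF)).
  + by apply: filterS fc => w h _; rewrite lee_fin.
Qed.

Lemma Rintegral_sum (I : Type) (s : seq I) (p : pred I) (F : I -> T -> R)
    (D : set T) : measurable D ->
  (forall i, p i -> P.-integrable D (EFin \o F i)) ->
  P.-integrable D (EFin \o (fun w => \sum_(i <- s | p i) F i w)) /\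
  \int[P]_(w in D) (\sum_(i <- s | p i) F i w) =
    \sum_(i <- s | p i) \int[P]_(w in D) F i w.
Proof.
move=> mD iF; elim: s => [|i s [IH1 IH2]].
  split.
    by under [X in _.-integrable _ X]eq_fun do rewrite /= big_nil; exact: integrable0.
  by rewrite big_nil; under eq_Rintegral do rewrite big_nil; rewrite Rintegral_cst// mul0r.
have [pi|npi] := boolP (p i); last first.
  have E w : \sum_(j <- i :: s | p j) F j w = \sum_(j <- s | p j) F j w.
    by rewrite big_cons (negbTE npi).
  split; first by under [X in _.-integrable _ X]eq_fun do rewrite /= E.
  by rewrite big_cons (negbTE npi) -IH2; apply: eq_Rintegral => w _.
have E w : \sum_(j <- i :: s | p j) F j w = F i w + \sum_(j <- s | p j) F j w.
  by rewrite big_cons pi.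
split.
  by under [X in _.-integrable _ X]eq_fun do rewrite /= E; exact: (integrableD mD (iF _ pi) IH1).
rewrite big_cons pi -IH2 -RintegralD//; last exact: iF.
by apply: eq_Rintegral => w _.
Qed.

(** Turns lower bounds into upper bounds. Stated with [is_cond_exp], it keeps the version [Z],
    whereas [cond_exp] of the opposite variable might select another one. *)
Lemma is_cond_expN (Y X Z : T -> R) : is_cond_exp P Y X Z ->
  P.-integrable setT (EFin \o Y) -> measurable_fun setT X ->
  is_cond_exp P (fun w => - Y w) X (fun w => - Z w).
Proof.
move=> [sZ iZ ZE] iY mX; split.
- move=> _ [B mB <-]; apply: sZ; exists (-%R @^-1` B) => //.
  by rewrite -[X in measurable X]setTI; exact: (oppr_measurable measurableT mB).
- exact: (integrableN iZ).
- move=> A sA.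
  have mA : measurable A by case: sA => B mB <-; exact: mX.
  have iZA : P.-integrable A (EFin \o Z) by exact: (integrableS measurableT mA _ iZ).
  have iYA : P.-integrable A (EFin \o Y) by exact: (integrableS measurableT mA _ iY).
  have N (f : T -> R) : P.-integrable A (EFin \o f) ->
      (\int[P]_(w in A) (- f w)%:E = - \int[P]_(w in A) (f w)%:E)%E.
    move=> iF; rewrite -integralN; first by apply: eq_integral => w _; rewrite EFinN.
    exact: (integrable_add_def mA iF).
  by rewrite !N// ZE.
Qed.
End integral_extras.

(** * Weak expansion *)

Section weak_expansion.
Context d (T : measurableType d) (R : realType) (P : probability T R).
Variables (G0 : set_system T) (W : R -> {RV P >-> R}).
Hypothesis G0_sigma : sigma_algebra setT G0.
Hypothesis G0_measurable : G0 `<=` measurable.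
Hypothesis hW : brownian_motion W.
Hypothesis G0W : independent_sigma P G0 (sigma_family [set t : R | 0 <= t] W).
Variables (n : nat) (xi : nat -> {RV P >-> R}) (X : nat -> R -> {RV P >-> R}).
Hypothesis hX : expansion_coefficients n xi W X.
Hypothesis xiG0 : forall k (B : set R), (k <= n)%N -> measurable B ->
  G0 (xi k @^-1` B).
Hypothesis xi_moments : forall k, (k <= n)%N ->
  moment_bounded P [set: unit] (fun=> (xi k : T -> R)).
Hypothesis hA3 : assumption_A3 n xi.
Variables (r K : R).
Hypotheses (r0 : 0 < r) (r1 : r <= 1) (K1 : 1 <= K).
Hypothesis xi0_bounds : {ae P, forall w, r <= `|xi 0%N w| <= K}.

Let K0 : 0 <= K. Proof. exact: le_trans ler01 K1. Qed.
Let mxi0 : measurable_fun setT (xi 0%N : T -> R). Proof. exact: measurable_funP. Qed.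

Let mxi0p (B : set R) : measurable B -> measurable (xi 0%N @^-1` B).
Proof. by move=> mB; rewrite -[X in measurable X]setTI; exact: (mxi0 measurableT mB). Qed.

Let support (e : R) : set R := [set z | r <= `|z| <= K /\ 0 < e * z].

Let measurable_support e : measurable (support e).
Proof.
pose b z := (r <= `|z| <= K) && (0 < e * z).
have mb : measurable_fun setT b.
  apply: measurable_and; last exact: measurable_fun_ltr.
  by apply: measurable_and; apply: measurable_fun_ler => //; exact: normr_measurable.
have -> : support e = setT `&` b @^-1` [set true].
  by rewrite setTI; apply/seteqP; split=> z /andP.
exact: mb.
Qed.

Let moment_bounded_comp_sum m i : (m <= n)%N ->
  moment_bounded P [set: unit] (fun _ w => comp_sum (fun j => xi j w) m i) /\
  forall j, j \in compositions m i ->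
  moment_bounded P [set: unit] (fun _ w => \prod_(k < i) xi (j k) w).
Proof.
move=> mn.
have mC c : moment_bounded P [set: unit] (fun _ _ => c : R).
  by apply: (@moment_bounded_cst _ _ _ _ _ _ (fun=> c) `|c|).
have mD := @moment_boundedD _ _ _ P unit setT.
have mM := @moment_boundedM _ _ _ P unit setT.
have mj (j : {ffun 'I_i -> 'I_m.+1}) :
    moment_bounded P [set: unit] (fun _ w => \prod_(k < i) xi (j k) w).
  apply: (@ring_closed_prod R unit T (moment_bounded P [set: unit]) mC mM) => k _.
  by apply: xi_moments; rewrite (leq_trans _ mn)// -ltnS.
split => //.
by apply: (@ring_closed_sum R unit T (moment_bounded P [set: unit]) mC mD) => j _.
Qed.

(** A3 bounds a sum of chosen versions. Integrated over an event of [xi 0], each version may be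
    exchanged for its product of initial data, which yields a bound on the sum over compositions
    over such events and, by duality, against test functions. *)
Let initial_bound e m i : (1 <= m <= n)%N -> (1 <= i <= m)%N ->
  exists2 C, 0 <= C & forall g, test_function r K e g ->
    `|\int[P]_w (g (xi 0%N w) * (path_coef n X m i 0 w - wcoef (- e) m i))| <=
      C * \int[P]_w `|g (xi 0%N w)|.
Proof.
move=> mn im; have [C C0 hC] := hA3 mn im.
have /andP[m1 mn'] := mn; have /andP[i1 im'] := im.
set c := wcoef _ _ _.
exists (C + `|c|) => [|g tg]; first by rewrite addr_ge0// ltW.
have [mbY mbF] := moment_bounded_comp_sum i mn'.
pose Y w := comp_sum (fun j => xi j w) m i.
have iY : P.-integrable setT (EFin \o Y).
  exact: (moment_bounded_integrable mbY (I : [set: unit] tt)).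
pose Fj (j : {ffun 'I_i -> 'I_m.+1}) (w : T) : R := \prod_(k < i) xi (j k) w.
have iF j : j \in compositions m i -> P.-integrable setT (EFin \o Fj j).
  by move=> /mbF h; exact: (moment_bounded_integrable h (I : [set: unit] tt)).
have YC B : measurable B -> `|\int[P]_(w in xi 0%N @^-1` B) Y w| <=
    C * fine (P (xi 0%N @^-1` B)).
  move=> /[dup] mB /mxi0p mXB.
  pose Zj j := cond_exp P (Fj j) (xi 0%N).
  have hZ j : j \in compositions m i -> is_cond_exp P (Fj j) (xi 0%N) (Zj j).
    by move=> jC; apply: cond_expP => //; exact: iF.
  have iZ j : j \in compositions m i -> P.-integrable (xi 0%N @^-1` B) (EFin \o Zj j).
    by move=> /hZ[_ h _]; exact: (integrableS measurableT mXB _ h).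
  have iFB j : j \in compositions m i -> P.-integrable (xi 0%N @^-1` B) (EFin \o Fj j).
    by move=> /iF h; exact: (integrableS measurableT mXB _ h).
  have [_ ->] := Rintegral_sum (index_enum _) mXB iFB.
  rewrite (eq_bigr (fun j => \int[P]_(w in xi 0%N @^-1` B) Zj j w)); last first.
    move=> j /hZ[_ _ h]; congr fine; apply/esym/h.
    by exists B => //; rewrite setTI.
  have [iS <-] := Rintegral_sum (index_enum _) mXB iZ.
  exact: norm_Rintegral_le_ae.
have [mg [M gM] gs] := tg.
have bound := bounded_test_integral_bound mxi0 iY YC mg gM.
have ig := integrable_test xi tg.
have igY : P.-integrable setT (EFin \o (fun w => g (xi 0%N w) * Y w)).
  by apply: (@integrable_boundedM _ _ _ _ _ (g \o xi 0%N) M iY) => [|w]; [exact: (measurableT_comp mg mxi0)|exact: gM].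
have -> : \int[P]_w (g (xi 0%N w) * (path_coef n X m i 0 w - c)) =
    \int[P]_w (g (xi 0%N w) * Y w) - c * \int[P]_w g (xi 0%N w).
  have icg := integrableZl measurableT c ig.
  rewrite -RintegralZl// -RintegralB//; apply: ae_eq_Rintegral.
  - apply/measurable_EFinP; apply: (measurable_int P).
    by apply: (integrable_path_coef G0_sigma hW hX xiG0 xi_moments r0 r1 K1 xi0_bounds _ _ mn' (lexx 0) tg).
  - by apply/measurable_EFinP; apply: (measurable_int P); exact: (integrableB measurableT igY icg).
  - apply: filterS (ae_regular_path hW hX) => w rw.
    rewrite mulrBr [c * _]mulrC; congr (_ * _ - _).
    rewrite /Y (comp_sumE _ mn' i1) /path_coef /path_poly normr0.
    suff -> : series_poly n (fun j => X j 0 w) = series_poly n (fun j => xi j w) by [].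
    by apply: eq_poly => -[//|j] jn; exact: (path_initial rw).
rewrite mulrDl (le_trans (ler_normB _ _))// lerD// normrM ler_wpM2l//.
exact: le_normr_Rintegral.
Qed.

(** Indicators of events of [xi 0] with sign [e] are test functions. The tested estimate then
    compares the integral of [S_] over each such event with multiples of its probability, and this
    determines almost sure bounds from both sides. *)
Lemma cond_exp_path_bound e m i : e ^+ 2 = 1 -> (1 <= m <= n)%N ->
  (1 <= i <= m)%N -> exists2 C, 0 <= C & forall t : R, 0 <= t ->
    P.-integrable setT (EFin \o S_ X m i t) /\
    {ae P, forall w, 0 < e * xi 0%N w ->
      `|cond_exp P (S_ X m i t) (xi 0%N) w - wcoef (- e) m i| <= C * expR (- t)}.
Proof.
move=> e1 mn im; have /andP[m1 mn'] := mn; have /andP[i1 im'] := im.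
have [C C0 hC] := conditional_convergence G0_sigma G0_measurable hW G0W hX xiG0
  xi_moments r0 r1 K1 xi0_bounds e1 (@initial_bound e) i mn'.
exists C => // t t0; set c := wcoef _ _ _.
have SE w : S_ X m i t w = path_coef n X m i t w.
  by rewrite /S_ (comp_sumE _ mn' i1) /path_coef /path_poly (ger0_norm t0).
have iS : P.-integrable setT (EFin \o S_ X m i t).
  have Tm0 : 0 < t + 1 by rewrite ltr_wpDl ?ltr01.
  have tT : time_domain (t + 1) t by rewrite /time_domain/= t0 lerDl ler01.
  have h := moment_bounded_path_coef G0_sigma hW hX xiG0 xi_moments r0 r1 K1 xi0_bounds Tm0 i mn'.
  have := moment_bounded_integrable h tT.
  by rewrite (_ : path_coef n X m i t = S_ X m i t)//; apply/funext => w; rewrite SE.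
split => //; set k := C * expR (- t).
have bound B : measurable B -> B `<=` support e ->
    `|\int[P]_(w in xi 0%N @^-1` B) S_ X m i t w - c * fine (P (xi 0%N @^-1` B))| <=
      k * fine (P (xi 0%N @^-1` B)).
  move=> mB Bs; have mXB := mxi0p mB.
  have tB : test_function r K e (\1_B : R -> R).
    split; first exact: measurable_indic.
    - by exists 1 => z; rewrite indicE; case: (_ \in _); rewrite ?normr1 ?normr0.
    - move=> z; rewrite indicE; have [/set_mem/Bs//|_] := boolP (z \in B).
      by rewrite eqxx.
  have E (f : T -> R) : \int[P]_w (\1_B (xi 0%N w) * f w) =
      \int[P]_(w in xi 0%N @^-1` B) f w.
    rewrite [RHS]Rintegral_mkcond; apply: eq_Rintegral => w _.
    rewrite patchE indicE.
    have -> : (xi 0%N w \in B) = (w \in xi 0%N @^-1` B).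
      by apply/idP/idP => /set_mem ?; exact: mem_set.
    by case: (_ \in _); rewrite ?mul1r ?mul0r.
  have := hC t _ t0 tB; rewrite E.
  have -> : \int[P]_w `|\1_B (xi 0%N w) : R| = fine (P (xi 0%N @^-1` B)).
    transitivity (\int[P]_w (\1_B (xi 0%N w) * (1 : R))).
      by apply: eq_Rintegral => w _; rewrite mulr1 ger0_norm.
    by rewrite E Rintegral_cst// mul1r.
  have iSB : P.-integrable (xi 0%N @^-1` B) (EFin \o S_ X m i t).
    exact: (integrableS measurableT mXB _ iS).
  have icB : P.-integrable (xi 0%N @^-1` B) (EFin \o cst c) by exact: finite_measure_integrable_cst.
  have -> : \int[P]_(w in xi 0%N @^-1` B) (path_coef n X m i t w - c) =
      \int[P]_(w in xi 0%N @^-1` B) (S_ X m i t w - c).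
    by apply: eq_Rintegral => w _; rewrite SE.
  by rewrite RintegralB// Rintegral_cst.
have hZ := cond_expP iS mxi0.
have iN : P.-integrable setT (EFin \o (fun w => - S_ X m i t w)) by exact: (integrableN iS).
have upper : {ae P, forall w, support e (xi 0%N w) -> cond_exp P (S_ X m i t) (xi 0%N) w <= k + c}.
  apply: (cond_exp_ae_le mxi0 hZ iS (measurable_support e)) => B mB /(bound B mB).
  by rewrite ler_norml mulrDl => /andP[_]; rewrite lerBlDr.
have lower : {ae P, forall w, support e (xi 0%N w) -> - cond_exp P (S_ X m i t) (xi 0%N) w <= k - c}.
  apply: (cond_exp_ae_le mxi0 (is_cond_expN hZ iS mxi0) iN (measurable_support e)) => B mB Bs.
  have -> : \int[P]_(w in xi 0%N @^-1` B) - S_ X m i t w =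
      - \int[P]_(w in xi 0%N @^-1` B) S_ X m i t w.
    rewrite -mulN1r -RintegralZl//; [|exact: mxi0p|].
      by apply: eq_Rintegral => w _; rewrite mulN1r.
    exact: (integrableS measurableT (mxi0p mB) _ iS).
  by have := bound B mB Bs; rewrite ler_norml => /andP[]; lra.
apply: filterS3 xi0_bounds upper lower => w hw hu hl ew.
have hs : support e (xi 0%N w) by [].
by rewrite ler_norml; move: (hu hs) (hl hs); lra.
Qed.

Section smooth_observable.
Variables (F : R -> R) (M : R).
Hypothesis hF : continuously_differentiable n.+1 F.
Hypothesis FM : forall i (x : R), (i <= n.+1)%N -> `|x| <= K -> `|derive1n i F x| <= M.

Let M0 : 0 <= M.
Proof.
by apply: le_trans (FM (leq0n _) (_ : `|0| <= K)); rewrite ?normr0.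
Qed.

Let continuous_derive1n i : (i <= n.+1)%N -> continuous (derive1n i F).
Proof.
rewrite leq_eqVlt => /predU1P[->|]; first by case: hF.
move=> ilt x; have [hd _] := hF.
exact/differentiable_continuous/derivable1_diffP/hd.
Qed.

(** The derivative of order [i.+1] enters here, with [i] up to [n]: this is where regularity of
    order [n + 1] is used. *)
Let derive1n_lipschitz i (x y : R) : (i <= n)%N -> `|x| <= K -> `|y| <= K ->
  `|derive1n i F x - derive1n i F y| <= M * `|x - y|.
Proof.
move=> lin; wlog xy : x y / y <= x.
  move=> h xK yK; have [yx|/ltW xy] := leP y x; first exact: h.
  by rewrite distrC [X in M * X]distrC; exact: h.
move=> xK yK.
have [c cI ->] : exists2 c, c \in `[y, x]%R &
    derive1n i F x - derive1n i F y = derive1n i.+1 F c * (x - y).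
  apply: MVT_segment => // [z _|].
    by rewrite derive1nS derive1E; apply/derivableP; have [hd _] := hF; exact: hd.
  by apply: continuous_subspaceT; apply: continuous_derive1n; exact: leqW.
rewrite normrM ler_wpM2r// FM// ler_norml.
move: cI xK yK; rewrite in_itv/= !ler_norml => /andP[? ?] /andP[? ?] /andP[? ?].
by apply/andP; split; lra.
Qed.

Let cut (e : R) (i : nat) (t z : R) : R := \1_(support e) z * derive1n i F (flow t z).

Let indic_test e : test_function r K e (\1_(support e)).
Proof.
split; first exact: measurable_indic.
- by exists 1 => z; rewrite indicE; case: (_ \in _); rewrite ?normr1 ?normr0.
- by move=> z; rewrite indicE; have [/set_mem//|_] := boolP (z \in _); rewrite eqxx.
Qed.

Let measurable_derive_flow i t : (i <= n)%N -> 0 <= t ->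
  measurable_fun setT (fun z : R => derive1n i F (flow t z)).
Proof.
move=> lin t0; apply: measurableT_comp; last exact: measurable_flow.
by apply: continuous_measurable_fun; apply: continuous_derive1n; exact: leqW.
Qed.

Let cut_test e i t : (i <= n)%N -> 0 <= t -> test_function r K e (cut e i t).
Proof.
move=> lin t0; apply: (@test_functionM _ _ _ _ _ _ M (indic_test e)).
  exact: measurable_derive_flow.
by move=> z zrK; rewrite FM ?leqW//; exact: (flow_le r0 K1 t0 zrK).
Qed.

Let mass e := \int[P]_w (\1_(support e) (xi 0%N w) : R).

(** Split as the test of [S - c] against the derivative of [F] along the flow, plus [c] times the
    error of replacing the flow by [e] in that derivative. The second part is controlled by the
    Lipschitz bound and the convergence of the flow. *)
Let weak_term e m i : e ^+ 2 = 1 -> (m <= n)%N -> (i <= m)%N ->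
  exists2 C, 0 <= C & forall t : R, 0 <= t ->
    P.-integrable setT (EFin \o (fun w => cut e i t (xi 0%N w) * path_coef n X m i t w)) /\
    `|\int[P]_w (cut e i t (xi 0%N w) * path_coef n X m i t w) -
      wcoef (- e) m i * (derive1n i F e * mass e)| <= C * expR (- t).
Proof.
move=> e1 mn im.
have [C C0 hC] := conditional_convergence G0_sigma G0_measurable hW G0W hX xiG0
  xi_moments r0 r1 K1 xi0_bounds e1 (@initial_bound e) i mn.
set c := wcoef _ _ _ in hC *.
have lin := leq_trans im mn.
pose k := K ^+ 2 / r ^+ 2.
have k0 : 0 <= k by rewrite divr_ge0// sqr_ge0.
have L1_le (g : R -> R) N : test_function r K e g -> (forall z, `|g z| <= N) ->
    \int[P]_w `|g (xi 0%N w)| <= N.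
  move=> tg gN.
  rewrite (@le_trans _ _ (\int[P]_w (cst N w)))//.
    apply: le_Rintegral => //.
    - exact: (integrable_norm (integrable_test xi tg)).
    - exact: finite_measure_integrable_cst.
  rewrite Rintegral_cst// [X in _ * X](_ : _ = 1) ?mulr1//.
  by rewrite [X in fine X](_ : _ = 1%E)//; exact: probability_setT.
exists (C * M + `|c| * (M * k * 1)) => [|t t0].
  apply: addr_ge0; first exact: mulr_ge0.
  by apply: mulr_ge0 => //; rewrite mulr1; exact: mulr_ge0.
have tc := cut_test e lin t0.
have ic := integrable_test xi tc.
have ipc0 := integrable_path_coef G0_sigma hW hX xiG0 xi_moments r0 r1 K1 xi0_bounds i 0 mn t0 tc.
have ipc : P.-integrable setT (EFin \o (fun w => cut e i t (xi 0%N w) * path_coef n X m i t w)).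
  by move: ipc0; under [X in _.-integrable _ X]eq_fun do rewrite /= subr0.
split => //.
have -> : \int[P]_w (cut e i t (xi 0%N w) * path_coef n X m i t w) - c * (derive1n i F e * mass e) =
    \int[P]_w (cut e i t (xi 0%N w) * (path_coef n X m i t w - c)) +
    c * (\int[P]_w cut e i t (xi 0%N w) - derive1n i F e * mass e).
  have -> : \int[P]_w (cut e i t (xi 0%N w) * (path_coef n X m i t w - c)) =
    \int[P]_w (cut e i t (xi 0%N w) * path_coef n X m i t w) - c * \int[P]_w cut e i t (xi 0%N w).
    have icc := integrableZl measurableT c ic.
    rewrite -RintegralZl// -RintegralB//.
    by apply: eq_Rintegral => w _; ring.
  by ring.
have indM (a : R) z : `|\1_(support e) z * a| <= `|a|.
  by rewrite indicE; case: (_ \in _); rewrite ?mul1r ?mul0r ?normr0.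
apply: (le_trans (ler_normD _ _)); rewrite [leRHS]mulrDl; apply: lerD.
  apply: (le_trans (hC t _ t0 tc)); rewrite mulrAC ler_wpM2r ?expR_ge0// ler_wpM2l//.
  apply: L1_le => // z; rewrite /cut indicE.
  have [/set_mem[zrK _]|_] := boolP (z \in _); last by rewrite mul0r normr0.
  by rewrite mul1r FM ?leqW//; exact: (flow_le r0 K1 t0 zrK).
rewrite normrM -[leRHS]mulrA ler_wpM2l//.
have iind := integrable_test xi (indic_test e).
have -> : \int[P]_w cut e i t (xi 0%N w) - derive1n i F e * mass e =
    \int[P]_w (\1_(support e) (xi 0%N w) *
      (derive1n i F (flow t (xi 0%N w)) - derive1n i F e)).
  have im' := integrableZl measurableT (derive1n i F e) iind.
  rewrite /mass -RintegralZl// -RintegralB//.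
  by apply: eq_Rintegral => w _; rewrite /cut mulrBr [in RHS]mulrC mulrC [X in _ - X]mulrC.
pose h z := derive1n i F (flow t z) - derive1n i F e.
have mh : measurable_fun setT h.
  by apply: measurable_funB => //; exact: measurable_derive_flow.
have ne : `|e| <= K.
  suff -> : `|e| = 1 by [].
  by apply/eqP; rewrite -(@eqrXn2 _ 2)// expr1n real_normK ?num_real// e1.
have hL z : r <= `|z| <= K -> 0 < e * z -> `|h z| <= M * (k * expR (- (2 * t))).
  move=> zrK ez; apply: (le_trans (derive1n_lipschitz lin _ ne)).
    exact: (flow_le r0 K1 t0 zrK).
  by rewrite ler_wpM2l//; exact: (flow_sub_sign r0 r1 K1 e1 ez t0 zrK).
have th : test_function r K e (fun z => \1_(support e) z * h z).
  apply: (@test_functionM _ _ _ _ _ _ (M *+ 2) (indic_test e) mh) => z zrK.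
  rewrite mulr2n (le_trans (ler_normB _ _))// lerD//.
    by rewrite FM ?leqW//; exact: (flow_le r0 K1 t0 zrK).
  by rewrite FM ?leqW.
apply: (le_trans (norm_integral_test_le xi (indic_test e) mh hL th)).
have l1 : \int[P]_w `|\1_(support e) (xi 0%N w) : R| <= 1.
  by apply: L1_le => [|z]; [exact: indic_test|rewrite -[X in `|X|]mulr1 (le_trans (indM _ _))// normr1].
rewrite -[M * k * 1 * _]mulrA mul1r -[M * k * _]mulrA.
have l2 : M * (k * expR (- (2 * t))) <= M * (k * expR (- t)).
  by rewrite ler_wpM2l// ler_wpM2l// ler_expR; lra.
apply: le_trans l2; rewrite -[leRHS]mulr1 ler_wpM2l//.
by rewrite mulr_ge0// mulr_ge0// expR_ge0.
Qed.

Let massE e : e ^+ 2 = 1 ->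
  mass e = fine (P [set w | 0 < e * xi 0%N w]).
Proof.
move=> e1; pose E := [set w | 0 < e * xi 0%N w].
have mE : measurable E.
  have mb : measurable_fun setT (fun w => 0 < e * xi 0%N w).
    by apply: measurable_fun_ltr => //; apply: measurable_funM.
  by rewrite -[E]setTI; exact: (mb measurableT [set true] I).
rewrite /mass (@ae_eq_Rintegral _ _ _ P _ (\1_E))//.
- by rewrite /Rintegral integral_indic// setIT.
- by apply: measurableT_comp mxi0; exact: measurable_indic.
- apply: filterS xi0_bounds => w zrK; rewrite !indicE; congr (_%:R).
  by congr nat_of_bool; apply/idP/idP => /set_mem h; apply/mem_set; [case: h|split].
Qed.

Let path_term m i t w : R :=
  (i`!%:R)^-1 * (derive1n i F (X 0%N t w) * path_coef n X m i t w).

Let limit_term m i : R :=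
  (i`!%:R)^-1 * (c_ m i * (derive1n i F 1 * mass 1) +
                 cbar_ m i * (derive1n i F (-1) * mass (-1))).

(** As [xi 0] is bounded away from 0, the two cut-offs by sign add up to 1 almost surely. *)
Let path_term_bound m i : (m <= n)%N -> (i <= m)%N ->
  exists2 C, 0 <= C & forall t : R, 0 <= t ->
    P.-integrable setT (EFin \o path_term m i t) /\
    `|\int[P]_w path_term m i t w - limit_term m i| <= C * expR (- t).
Proof.
move=> mn im; have lin := leq_trans im mn.
have eN1 : (-1 : R) ^+ 2 = 1 by rewrite sqrrN expr1n.
have [C1 C10 h1] := weak_term (expr1n _ 2 : (1 : R) ^+ 2 = 1) mn im.
have [C2 C20 h2] := weak_term eN1 mn im.
have f0 : 0 <= (i`!%:R)^-1 :> R by rewrite invr_ge0 ler0n.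
exists ((i`!%:R)^-1 * (C1 + C2)) => [|t t0]; first by rewrite mulr_ge0// addr_ge0.
have [i1 b1] := h1 t t0; have [i2 b2] := h2 t t0.
rewrite opprK in b2.
pose f w := (i`!%:R)^-1 * (cut 1 i t (xi 0%N w) * path_coef n X m i t w +
  cut (-1) i t (xi 0%N w) * path_coef n X m i t w).
have i12 := integrableD measurableT i1 i2.
have iF : P.-integrable setT (EFin \o f) by exact: (integrableZl measurableT _ i12).
have Tm0 : 0 < t + 1 by rewrite ltr_wpDl ?ltr01.
have tT : time_domain (t + 1) t by rewrite /time_domain/= t0 lerDl ler01.
have [mpc _] := moment_bounded_path_coef G0_sigma hW hX xiG0 xi_moments r0 r1 K1 xi0_bounds Tm0 i mn.
have mpt : measurable_fun setT (path_term m i t).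
  apply: measurable_funM => //; apply: measurable_funM; last exact: mpc.
  apply: measurableT_comp => //.
  by apply: continuous_measurable_fun; apply: continuous_derive1n; exact: leqW.
have mf : measurable_fun setT f by apply/measurable_EFinP; exact: (measurable_int _ iF).
have fE : {ae P, forall w, f w = path_term m i t w}.
  apply: filterS2 xi0_bounds (ae_regular_path hW hX) => w zrK rw.
  rewrite /f /path_term /cut -mulrDl -mulrDl (regular_path_flow rw t0).
  congr (_ * (_ * _)); rewrite -[RHS]mul1r; congr (_ * _).
  have z0 : xi 0%N w != 0.
    by rewrite -normr_gt0 (lt_le_trans r0)//; case/andP: zrK.
  rewrite !indicE; have [zp|zn] := ltrP 0 (xi 0%N w).
    rewrite mem_set ?memNset ?addr0//.
      by move=> [_]; rewrite mulN1r oppr_gt0 ltNge ltW.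
    by split => //; rewrite mul1r.
  rewrite memNset ?mem_set ?add0r//.
    by split => //; rewrite mulN1r oppr_gt0 lt_neqAle z0.
  by move=> [_]; rewrite mul1r ltNge zn.
split; first exact: (ae_eq_integrable iF).
rewrite -(ae_eq_Rintegral mf mpt fE) /f /limit_term.
rewrite RintegralZl// -mulrBr normrM (ger0_norm f0) -mulrA ler_wpM2l//.
rewrite RintegralD// opprD addrACA mulrDl (le_trans (ler_normD _ _))//.
by rewrite lerD.
Qed.

Let path_sum_bound m (s : seq nat) : (m <= n)%N -> (forall i, i \in s -> (i <= m)%N) ->
  exists2 C, 0 <= C & forall t : R, 0 <= t ->
    P.-integrable setT (EFin \o (fun w => \sum_(i <- s) path_term m i t w)) /\
    `|\int[P]_w (\sum_(i <- s) path_term m i t w) - \sum_(i <- s) limit_term m i|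
      <= C * expR (- t).
Proof.
move=> mn; elim: s => [_|i s IH si].
  exists 0 => // t _; split.
    by under [X in _.-integrable _ X]eq_fun do rewrite /= big_nil; exact: integrable0.
  under eq_Rintegral do rewrite big_nil.
  by rewrite big_nil Rintegral_cst// !mul0r subr0 normr0.
have [|C1 C10 h1] := IH; first by move=> j js; apply: si; rewrite in_cons js orbT.
have [|C2 C20 h2] := @path_term_bound m i mn; first by apply: si; rewrite in_cons eqxx.
exists (C2 + C1) => [|t t0]; first exact: addr_ge0.
have [i1 b1] := h1 t t0; have [i2 b2] := h2 t t0; split.
  under [X in _.-integrable _ X]eq_fun do rewrite /= big_cons.
  exact: (integrableD measurableT i2 i1).
under eq_Rintegral do rewrite big_cons.
rewrite big_cons RintegralD// opprD addrACA mulrDl (le_trans (ler_normD _ _))//.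
by rewrite lerD.
Qed.

Lemma weak_expansion_bound m : (m <= n)%N ->
  exists2 C, 0 <= C & forall t : R, 0 <= t ->
    (`|a_ X m t F - (b_ xi m F)%:E| <= (C * expR (- t))%:E)%E.
Proof.
(* For [m = 0] the single index 0 is taken, at which the path coefficient is 1; the zeroth
   coefficient then follows the same pattern. *)
move=> mn; pose s := if m == 0%N then [:: 0%N] else index_iota 1 m.+1.
have sm i : i \in s -> (i <= m)%N.
  rewrite /s; case: ifP => _; first by rewrite inE => /eqP ->.
  by rewrite mem_index_iota ltnS => /andP[].
have [C C0 hC] := path_sum_bound mn sm; exists C => // t t0.
have [iS bS] := hC t t0.
have -> : a_ X m t F = (\int[P]_w (\sum_(i <- s) path_term m i t w))%:E.
  rewrite /Rintegral fineK; last exact: (integrable_fin_num measurableT iS).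
  rewrite /a_ /s; case: ifPn => [/eqP m0|m0]; rewrite unlock; apply: eq_integral => w _.
    by rewrite big_seq1 /path_term m0 /path_coef fact0 invr1 mul1r expr0 coef1 mulr1.
  rewrite /path_term; congr EFin; rewrite big_nat [RHS]big_nat.
  apply: eq_bigr => i /andP[i1 im].
  by rewrite mulrA /S_ (comp_sumE _ mn i1) /path_coef /path_poly (ger0_norm t0).
have -> : b_ xi m F = \sum_(i <- s) limit_term m i.
  have m1 : mass 1 = fine (P [set w | 0 < xi 0%N w]).
    rewrite massE ?expr1n//; congr (fine (P _)).
    by apply/funext => w /=; rewrite mul1r.
  have mN1 : mass (-1) = fine (P [set w | xi 0%N w < 0]).
    rewrite massE ?sqrrN ?expr1n//; congr (fine (P _)).
    by apply/funext => w /=; rewrite mulN1r oppr_gt0.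
  rewrite /b_ /limit_term -m1 -mN1 /s; case: ifPn => [/eqP m0|m0].
    by rewrite big_seq1 m0 fact0 invr1 mul1r /c_ /cbar_ !wcoef00 !mul1r.
  rewrite !mulr_sumr -big_split/=; apply: eq_bigr => i _.
  by ring.
by rewrite -EFinB lee_fin.
Qed.
End smooth_observable.
End weak_expansion.

(** * From the assumptions to the theorem *)

Lemma assumption_A1_moments d (T : measurableType d) (R : realType)
    (P : probability T R) n (xie : R -> {RV P >-> R}) (xi : nat -> {RV P >-> R}) k :
  assumption_A1 n xie xi -> (k <= n)%N ->
  moment_bounded P [set: unit] (fun=> (xi k : T -> R)).
Proof.
move=> hA1 kn; split=> [_ _|p]; first exact: measurable_funP.
(* A1 requires an exponent at least 1, hence [p.+1]; the moment of order [p] is recovered from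
   [|x|^p <= 1 + |x|^(2 (p + 1))]. *)
have p1 : 1 <= p.+1%:R :> R by rewrite ler1n.
have [+ _] := hA1 p.+1%:R k p1 kn; rewrite unlock.
under eq_integral do rewrite -natrM powR_mulrn//.
set I := (\int[P]_w (`|xi k w| ^+ (2 * p.+1))%:E)%E => Ioo.
have I0 : (0 <= I)%E by apply: integral_ge0 => w _; rewrite lee_fin exprn_ge0.
have mq q : measurable_fun setT (fun w => (`|xi k w| ^+ q)%:E).
  by apply: measurable_normX; exact: measurable_funP.
exists (1 + fine I) => _ _.
rewrite EFinD fineK ?ge0_fin_numE//.
have -> : (1 + I = \int[P]_w (1 + (`|xi k w| ^+ (2 * p.+1))%:E))%E.
  rewrite ge0_integralD//.
  congr (_ + _)%E => //; apply/esym.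
  apply: etrans (integral_cst P measurableT 1%E) _.
  by rewrite mul1e; exact: probability_setT.
apply: ge0_le_integral => //.
- exact: emeasurable_funD.
- move=> w _; rewrite -EFinD lee_fin; have [w1|/ltW w1] := lerP `|xi k w| 1.
    by rewrite (le_trans (exprn_ile1 _ _ w1))// lerDl exprn_ge0.
  by rewrite (le_trans (ler_weXn2l w1 (_ : p <= 2 * p.+1)%N))// ?lerDr//; lia.
Qed.

Theorem theorem1p4 (d : measure_display) (T : measurableType d) (R : realType)
  (P : probability T R) (n : nat)
  (W : R -> {RV P >-> R}) (xie : R -> {RV P >-> R}) (xi : nat -> {RV P >-> R})
  (X : nat -> R -> {RV P >-> R}) (F : R -> R)
  (hW : brownian_motion W)
  (hindep : independent_sigma P (init_sigma n xie xi)
              (sigma_family [set t | 0 <= t] W))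
  (hA1 : assumption_A1 n xie xi)
  (hA2 : assumption_A2 xi)
  (hA3 : assumption_A3 n xi)
  (hX : expansion_coefficients n xi W X)
  (hF : continuously_differentiable n.+1 F)
  (hFgrowth : exists q C : R, [/\ 0 < q, 0 < C &
     forall (x : R) (i : nat), (i <= n.+1)%N ->
       `|derive1n i F x| <= C * (1 + `|x| `^ q)]) :
  (forall m i : nat, (1 <= m <= n)%N -> (1 <= i <= m)%N ->
     exists2 C : R, 0 < C & forall t : R, 0 <= t ->
       [/\ P.-integrable setT (EFin \o S_ X m i t),
           {ae P, forall w, 0 < xi 0%N w ->
              `|cond_exp P (S_ X m i t) (xi 0%N) w - c_ m i| <= C * expR (- t)}
         & {ae P, forall w, xi 0%N w < 0 ->
              `|cond_exp P (S_ X m i t) (xi 0%N) w - cbar_ m i|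
                <= C * expR (- t)}])
  /\
  (forall m : nat, (m <= n)%N ->
     exists2 C : R, 0 < C & forall t : R, 0 <= t ->
       (`|a_ X m t F - (b_ xi m F)%:E| <= (C * expR (- t))%:E)%E).
Proof.
have G0_sigma : sigma_algebra setT (init_sigma n xie xi) by exact: smallest_sigma_algebra.
have mpre (f : {RV P >-> R}) : sigma_of f `<=` measurable.
  by move=> _ [B mB <-]; exact: (measurable_funP f measurableT B mB).
have G0_measurable : init_sigma n xie xi `<=` measurable.
  apply: smallest_sub; first exact: sigma_algebra_measurable.
  by move=> A [[e _]|[k _]]; exact: mpre.
have xiG0 k (B : set R) : (k <= n)%N -> measurable B ->
    init_sigma n xie xi (xi k @^-1` B).
  move=> kn mB; apply: sub_sigma_algebra; right; exists k => //.
  by exists B => //; rewrite setTI.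
have xi_moments k (kn : (k <= n)%N) := assumption_A1_moments hA1 kn.
have [rmin [rmax [rmin0 rmm hr]]] := hA2.
(* The bounds of A2 are widened so that 1, the modulus of both equilibria, lies between them. *)
pose r := Num.min 1 rmin; pose K := Num.max 1 rmax.
have r0 : 0 < r by rewrite lt_min ltr01.
have r1 : r <= 1 by rewrite ge_min lexx.
have K1 : 1 <= K by rewrite le_max lexx.
have xi0_bounds : {ae P, forall w, r <= `|xi 0%N w| <= K}.
  apply: filterS hr => w /andP[h1 h2].
  by rewrite ge_min le_max (ltW h1) (ltW h2) !orbT.
split=> [m i mn im|m mn].
  have bound := cond_exp_path_bound G0_sigma G0_measurable hW hindep hX xiG0
    xi_moments hA3 r0 r1 K1 xi0_bounds.
  have [C1 C10 h1] := bound 1 m i (expr1n _ 2) mn im.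
  have eN1 : (-1 : R) ^+ 2 = 1 by rewrite sqrrN expr1n.
  have [C2 C20 h2] := bound (-1) m i eN1 mn im.
  exists (C1 + C2 + 1) => [|t t0]; first by rewrite ltr_wpDl// addr_ge0.
  have [iS b1] := h1 t t0; have [_ b2] := h2 t t0.
  have le1 : C1 * expR (- t) <= (C1 + C2 + 1) * expR (- t).
    by rewrite ler_wpM2r ?expR_ge0//; lra.
  have le2 : C2 * expR (- t) <= (C1 + C2 + 1) * expR (- t).
    by rewrite ler_wpM2r ?expR_ge0//; lra.
  split => //.
  - by apply: filterS b1 => w; rewrite mul1r => h /h /le_trans; apply.
  - apply: filterS b2 => w; rewrite mulN1r oppr_gt0 opprK => h /h /le_trans; exact.
have [q [C [q0 C0 hC]]] := hFgrowth.
(* The flow and both equilibria stay in [[-K, K]], where polynomial growth becomes the uniform bound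
   [C (1 + K^q)]. *)
have [|C' C'0 h] := @weak_expansion_bound _ _ _ _ _ _ G0_sigma G0_measurable hW
  hindep _ _ _ hX xiG0 xi_moments hA3 _ _ r0 r1 K1 xi0_bounds F (C * (1 + K `^ q)) hF _ m mn.
  move=> i x iN xK; rewrite (le_trans (hC x i iN))// ler_wpM2l ?(ltW C0)// lerD2l.
  by apply: ge0_ler_powR; rewrite ?nnegrE ?(ltW q0)// (le_trans ler01).
exists (C' + 1) => [|t t0]; first by rewrite ltr_wpDl.
rewrite (le_trans (h t t0))// lee_fin ler_wpM2r ?expR_ge0//.
by rewrite lerDl.
Qed.
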